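(* Let $0\le \beta<1$ and let $c$ be a positive number with $c<\sqrt{1-\beta}$. Then for all sufficiently large $T$ there exists a real number $t$ with $T^{\beta}\le t\le T$ such that \[ \left|\zeta\Big(\tfrac12+it\Big)\right| \ge \exp\left(c\sqrt{\frac{\log T\,\log\log\log T}{\log\log T}}\right). \]
   Context: $\zeta$ denotes the Riemann zeta function. *)

(* Defs.v *)
From Stdlib Require Import Reals.
From Coquelicot Require Import Coquelicot.
Open Scope R_scope.

Definition npow_neg (n : nat) (s : C) : C :=
  (exp (- Re s * ln (INR n)) * cos (Im s * ln (INR n)),
   - (exp (- Re s * ln (INR n)) * sin (Im s * ln (INR n)))).

(* Dirichlet eta function eta(s) = sum_{n>=1} (-1)^(n-1) n^(-s),
   a convergent series for Re s > 0 (real and imaginary parts summed separately). *)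
Definition dirichlet_eta (s : C) : C :=
  (Series (fun k => (-1) ^ k * Re (npow_neg (S k) s)),
   Series (fun k => (-1) ^ k * Im (npow_neg (S k) s))).

(* Riemann zeta function in the half-plane Re s > 0 (s not a zero of 1 - 2^(1-s)),
   via the standard continuation zeta(s) = eta(s) / (1 - 2^(1-s)). *)
Definition zeta (s : C) : C :=
  Cdiv (dirichlet_eta s) (Cminus (RtoC 1) (Cmult (RtoC 2) (npow_neg 2 s))).

(* Main.v *)
Require Import Defs.
From Stdlib Require Import Reals Lra Lia Classical.
From Coquelicot Require Import Coquelicot.
From HB Require Import structures.
From mathcomp Require Import all_boot zify.
Open Scope R_scope.
Arguments INR : simpl never.

(** Resonance method of Soundararajan and of Bondarenko and Seip, with all averages
    replaced by finite sums.

    Averaging zeta(1/2 + iu) over a binomial (discrete Gaussian) kernel of bounded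
    width in u turns it, up to O(1) for |t| >= T^beta, into a Dirichlet polynomial
    A(t) = sum_{m <= N} g(m) m^(-1/2-it) with N about T^2 and nonnegative weights g
    that are harmless for small m but make sum_m g(m) m^(-1/2) as small as T^epsilon.
    A(t) is tested against R2(t) conj(R1(t)) over t = j - j', 0 <= j, j' < J with J
    about T/2: the Fejer kernel is nonnegative, so only favourable terms need to be
    kept, and the range |t| < T^beta is absorbed as long as the resonators have at
    most T^kappa terms with beta + kappa < 1.

    R1 and R2 run over products of primes taken from consecutive blocks, w_j (for R1)
    or w_j - r_j (for R2) of them in block j, with weight n^(-1/2). Fixing these
    numbers exactly makes the correlation an identity between elementary symmetric
    functions of 1/p, and with r_j = rho/j, w_j proportional to r_j^2 the gain is
    exp(sum_j r_j). Mertens' first theorem with a crude error term is enough to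
    evaluate the blocks. *)

(** The shape r_j = rho/j solves an optimization. If consecutive blocks have ratio e^h and the first
    lies near log T, then w_j primes of block j can be chosen in about exp(w_j j h) ways. Since w_j
    is proportional to r_j^2, the budget of T^kappa terms bounds sum_j j r_j^2, while the logarithm
    of the gain is sum_j r_j. At the optimum r_j = rho/j the gain is rho log n and the cost is
    proportional to rho^2 log n, where n is the number of blocks and log n is about logloglog T.
    Eliminating rho produces the factor sqrt(logloglog T), and kappa < 1 - beta produces the
    constant sqrt(1 - beta). Exact numbers of primes also leave no tail to truncate: the length of a
    resonator is a product of binomial coefficients, and every integer m taken from zeta satisfies
    log m <= Lambda with Lambda = O(rho loglog T logloglog T). The averaging kernel costs a factor
    exp(-O(Lambda^2 / log T)), that is exp(-O(loglog T logloglog T)), which is negligible against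
    exp(rho logloglog T). *)

HB.instance Definition _ := Monoid.isComLaw.Build R 0 Rplus
  (fun x y z => Logic.eq_sym (Rplus_assoc x y z)) Rplus_comm Rplus_0_l.
HB.instance Definition _ := Monoid.isComLaw.Build R 1 Rmult
  (fun x y z => Logic.eq_sym (Rmult_assoc x y z)) Rmult_comm Rmult_1_l.
HB.instance Definition _ := Monoid.isMulLaw.Build R 0 Rmult Rmult_0_l Rmult_0_r.
HB.instance Definition _ := Monoid.isAddLaw.Build R Rmult Rplus
  Rmult_plus_distr_r Rmult_plus_distr_l.
HB.instance Definition _ := Monoid.isComLaw.Build C (RtoC 0) Cplus
  Cplus_assoc Cplus_comm Cplus_0_l.
HB.instance Definition _ := Monoid.isComLaw.Build C (RtoC 1) Cmult
  Cmult_assoc Cmult_comm Cmult_1_l.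
HB.instance Definition _ := Monoid.isMulLaw.Build C (RtoC 0) Cmult
  Cmult_0_l Cmult_0_r.
HB.instance Definition _ := Monoid.isAddLaw.Build C Cmult Cplus
  Cmult_plus_distr_r Cmult_plus_distr_l.

Notation "\sum_ ( i <- r | P ) F" := (\big[Rplus/R0]_(i <- r | P%B) F) : R_scope.
Notation "\sum_ ( m <= i < n | P ) F" := (\big[Rplus/R0]_(m <= i < n | P%B) F) : R_scope.
Notation "\sum_ ( m <= i < n ) F" := (\big[Rplus/R0]_(m <= i < n) F) : R_scope.
Notation "\sum_ ( i | P ) F" := (\big[Rplus/R0]_(i | P%B) F) : R_scope.
Notation "\sum_ i F" := (\big[Rplus/R0]_i F) : R_scope.
Notation "\sum_ ( i < n ) F" := (\big[Rplus/R0]_(i < n) F) : R_scope.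
Notation "\sum_ ( i < n | P ) F" := (\big[Rplus/R0]_(i < n | P%B) F) : R_scope.
Notation "\sum_ ( i 'in' A ) F" := (\big[Rplus/R0]_(i in A) F) : R_scope.
Notation "\prod_ ( i <- r | P ) F" := (\big[Rmult/R1]_(i <- r | P%B) F) : R_scope.
Notation "\prod_ ( i < n ) F" := (\big[Rmult/R1]_(i < n) F) : R_scope.
Notation "\prod_ ( i 'in' A ) F" := (\big[Rmult/R1]_(i in A) F) : R_scope.
Notation "\prod_ i F" := (\big[Rmult/R1]_i F) : R_scope.

(** * Inequalities for finite sums and products *)

Lemma sumR_le (I : Type) (r : seq I) (P : pred I) (F G : I -> R) :
  (forall i, P i -> F i <= G i) ->
  \sum_(i <- r | P i) F i <= \sum_(i <- r | P i) G i.
Proof.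
  move=> H; apply: (big_ind2 Rle) => //; first by lra.
  by move=> *; apply: Rplus_le_compat.
Qed.

Lemma sumR_ge0 (I : Type) (r : seq I) (P : pred I) (F : I -> R) :
  (forall i, P i -> 0 <= F i) -> 0 <= \sum_(i <- r | P i) F i.
Proof.
  move=> H; apply: big_ind => //; first by lra.
  by move=> *; apply: Rplus_le_le_0_compat.
Qed.

Lemma prodR_gt0 (I : Type) (r : seq I) (P : pred I) (F : I -> R) :
  (forall i, P i -> 0 < F i) -> 0 < \prod_(i <- r | P i) F i.
Proof.
  move=> H; apply: big_ind => //; first by lra.
  by move=> *; apply: Rmult_lt_0_compat.
Qed.

Lemma prodR_ge0 (I : Type) (r : seq I) (P : pred I) (F : I -> R) :
  (forall i, P i -> 0 <= F i) -> 0 <= \prod_(i <- r | P i) F i.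
Proof.
  move=> H; apply: big_ind => //; first by lra.
  by move=> *; apply: Rmult_le_pos.
Qed.

Lemma prodR_le (I : Type) (r : seq I) (P : pred I) (F G : I -> R) :
  (forall i, P i -> 0 <= F i <= G i) ->
  \prod_(i <- r | P i) F i <= \prod_(i <- r | P i) G i.
Proof.
  move=> H.
  suff: 0 <= \prod_(i <- r | P i) F i <= \prod_(i <- r | P i) G i by case.
  apply: (big_ind2 (fun x y => 0 <= x <= y)) => //; first by lra.
  move=> x1 x2 y1 y2 [? ?] [? ?]; split; first by apply: Rmult_le_pos.
  by apply: Rmult_le_compat.
Qed.

Lemma sumR_mull (I : Type) (r : seq I) (P : pred I) (F : I -> R) x :
  x * \sum_(i <- r | P i) F i = \sum_(i <- r | P i) x * F i.
Proof. exact: big_distrr. Qed.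

Lemma sumR_mulr (I : Type) (r : seq I) (P : pred I) (F : I -> R) x :
  (\sum_(i <- r | P i) F i) * x = \sum_(i <- r | P i) F i * x.
Proof. exact: big_distrl. Qed.

Lemma sumR_subset (I : finType) (P Q : pred I) (F : I -> R) :
  (forall i, P i -> Q i) -> (forall i, Q i -> 0 <= F i) ->
  \sum_(i | P i) F i <= \sum_(i | Q i) F i.
Proof.
  move=> PQ F0.
  rewrite (big_mkcond P) (big_mkcond Q); apply: sumR_le => i _.
  case Pi: (P i); first by rewrite PQ //; lra.
  case Qi: (Q i); [exact: F0 | lra].
Qed.

Lemma sumR_const_nat n x : \sum_(i < n) x = INR n * x.
Proof.
  rewrite big_const_ord; elim: n => [|n IH]; first by rewrite INR_0 /=; lra.
  rewrite S_INR /= IH; lra.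
Qed.

Lemma INR_sum (I : Type) (r : seq I) (P : pred I) (F : I -> nat) :
  INR (\sum_(i <- r | P i) F i)%N = \sum_(i <- r | P i) INR (F i).
Proof. by apply: (big_morph INR) => // x y; rewrite -plus_INR. Qed.

Lemma INR_prod (I : Type) (r : seq I) (P : pred I) (F : I -> nat) :
  INR (\prod_(i <- r | P i) F i)%N = \prod_(i <- r | P i) INR (F i).
Proof. by apply: (big_morph INR) => // x y; rewrite -mult_INR. Qed.

Lemma ln_prod (I : Type) (r : seq I) (P : pred I) (F : I -> R) :
  (forall i, P i -> 0 < F i) ->
  ln (\prod_(i <- r | P i) F i) = \sum_(i <- r | P i) ln (F i).
Proof.
  move=> F0.
  suff: 0 < \prod_(i <- r | P i) F i /\
    ln (\prod_(i <- r | P i) F i) = \sum_(i <- r | P i) ln (F i) by case.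
  apply: (big_ind2 (fun x y => 0 < x /\ ln x = y)).
  - split; [lra | exact: ln_1].
  - move=> x1 x2 y1 y2 [? <-] [? <-]; split; first exact: Rmult_lt_0_compat.
    exact: ln_mult.
  - by move=> i Pi; split; first exact: F0.
Qed.

Lemma exp_sum (I : Type) (r : seq I) (P : pred I) (F : I -> R) :
  exp (\sum_(i <- r | P i) F i) = \prod_(i <- r | P i) exp (F i).
Proof. apply: (big_morph exp); [exact: exp_plus | exact: exp_0]. Qed.

Lemma prodR_mul (I : Type) (r : seq I) (P : pred I) (F G : I -> R) :
  \prod_(i <- r | P i) (F i * G i) =
  (\prod_(i <- r | P i) F i) * \prod_(i <- r | P i) G i.
Proof. exact: big_split. Qed.

Lemma prodR_inv (I : Type) (r : seq I) (P : pred I) (F : I -> R) :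
  (forall i, P i -> 0 < F i) ->
  / \prod_(i <- r | P i) F i = \prod_(i <- r | P i) / F i.
Proof.
  move=> F0.
  suff: 0 < \prod_(i <- r | P i) F i /\
    / \prod_(i <- r | P i) F i = \prod_(i <- r | P i) / F i by case.
  apply: (big_ind2 (fun x y => 0 < x /\ / x = y)).
  - split; [lra | exact: Rinv_1].
  - move=> x1 x2 y1 y2 [? <-] [? <-]; split; first exact: Rmult_lt_0_compat.
    rewrite Rinv_mult; lra.
  - by move=> i Pi; split; first exact: F0.
Qed.

(** The quadratic form sum_i (x F_i + y G_i)^2 is nonnegative. At (m, -a) this reads a (a b - m^2)
    >= 0; if a = 0, the point (-(b+1), m) forces m = 0. *)
Lemma Cauchy_Schwarz (I : Type) (r : seq I) (P : pred I) (F G : I -> R) :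
  (\sum_(i <- r | P i) F i * G i) ^ 2 <=
  (\sum_(i <- r | P i) F i ^ 2) * \sum_(i <- r | P i) G i ^ 2.
Proof.
  set a := \sum_(i <- r | P i) F i ^ 2.
  set b := \sum_(i <- r | P i) G i ^ 2.
  set m := \sum_(i <- r | P i) F i * G i.
  have q x y : 0 <= x ^ 2 * a + 2 * x * y * m + y ^ 2 * b.
  { rewrite /a /b /m !sumR_mull -!big_split /=.
    apply: sumR_ge0 => i _.
    have := pow2_ge_0 (x * F i + y * G i); nra. }
  have a0 : 0 <= a by apply: sumR_ge0 => i _; exact: pow2_ge_0.
  have b0 : 0 <= b by apply: sumR_ge0 => i _; exact: pow2_ge_0.
  have q1 := q m (- a).
  have q2 := q 1 (- m).
  have [a1|a1] : 0 < a \/ a = 0 by lra.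
  - have : 0 <= a * (a * b - m ^ 2) by nra.
    nra.
  - have q3 := q (- (b + 1)) m.
    rewrite a1 in q3 *; nra.
Qed.

Lemma Cauchy_Schwarz_sqrt (I : Type) (r : seq I) (P : pred I) (F G : I -> R) :
  \sum_(i <- r | P i) F i * G i <=
  sqrt (\sum_(i <- r | P i) F i ^ 2) * sqrt (\sum_(i <- r | P i) G i ^ 2).
Proof.
  have a0 : 0 <= \sum_(i <- r | P i) F i ^ 2 by apply: sumR_ge0 => i _; exact: pow2_ge_0.
  have b0 : 0 <= \sum_(i <- r | P i) G i ^ 2 by apply: sumR_ge0 => i _; exact: pow2_ge_0.
  rewrite -sqrt_mult //; apply: Rle_trans (Rle_abs _) _.
  rewrite -sqrt_Rsqr_abs; apply: sqrt_le_1_alt.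
  rewrite Rsqr_pow2; exact: Cauchy_Schwarz.
Qed.

Lemma Cmod_sum_le (I : Type) (r : seq I) (P : pred I) (F : I -> C) :
  Cmod (\big[Cplus/RtoC 0]_(i <- r | P i) F i) <= \sum_(i <- r | P i) Cmod (F i).
Proof.
  apply: (big_ind2 (fun x y => Cmod x <= y)); first by rewrite Cmod_0; lra.
  - move=> x1 x2 y1 y2 h1 h2; apply: Rle_trans (Cmod_triangle _ _) _; lra.
  - by move=> *; lra.
Qed.

Lemma Re_sum (I : Type) (r : seq I) (P : pred I) (F : I -> C) :
  Re (\big[Cplus/RtoC 0]_(i <- r | P i) F i) = \sum_(i <- r | P i) Re (F i).
Proof. by apply: (big_morph Re). Qed.

Lemma Im_sum (I : Type) (r : seq I) (P : pred I) (F : I -> C) :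
  Im (\big[Cplus/RtoC 0]_(i <- r | P i) F i) = \sum_(i <- r | P i) Im (F i).
Proof. by apply: (big_morph Im). Qed.

Lemma Cconj_sum (I : Type) (r : seq I) (P : pred I) (F : I -> C) :
  Cconj (\big[Cplus/RtoC 0]_(i <- r | P i) F i) =
  \big[Cplus/RtoC 0]_(i <- r | P i) Cconj (F i).
Proof.
  apply: (big_morph Cconj); first exact: Cplus_conj.
  by rewrite /Cconj /= Ropp_0.
Qed.

(** * Approximation of zeta on the critical line *)

Definition cexp (x : R) : C := (cos x, sin x).

(* [pw w 0 (ln n)] and [pw w (PI/2) (ln n)] are the real and imaginary parts of
   n^(-1/2-iw), and [pole w phi v] is the antiderivative of [exp v * pw w phi v]. *)
Definition pw (w phi v : R) : R := exp (- (v / 2)) * cos (w * v + phi).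
Definition pole (w phi v : R) : R :=
  exp (v / 2) * (cos (w * v + phi) / 2 + w * sin (w * v + phi)) / (1 / 4 + w ^ 2).

Lemma quarter_sq_gt0 (w : R) : 0 < 1 / 4 + w ^ 2.
Proof. have := pow2_ge_0 w; lra. Qed.

Lemma mean_value_le (f df : R -> R) (K a b : R) :
  a <= b -> (forall x, a <= x <= b -> is_derive f x (df x)) ->
  (forall x, a <= x <= b -> Rabs (df x) <= K) ->
  Rabs (f b - f a) <= K * (b - a).
Proof.
  move=> ab D B.
  have [c [hc ->]] : exists c, Rmin a b <= c <= Rmax a b /\ f b - f a = df c * (b - a).
  { apply: MVT_gen => x; rewrite Rmin_left // Rmax_right // => hx.
    - apply: D; lra.
    - apply: derivable_continuous_pt; exists (df x).
      by apply/is_derive_Reals; apply: D. }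
  rewrite Rmin_left // Rmax_right // in hc.
  rewrite Rabs_mult (Rabs_pos_eq (b - a)); last lra.
  apply: Rmult_le_compat_r; [lra | exact: B].
Qed.

Lemma pole_derive (w phi v : R) :
  is_derive (pole w phi) v (exp (v / 2) * cos (w * v + phi)).
Proof.
  have h := quarter_sq_gt0 w.
  rewrite /pole; auto_derive => //; rewrite /Rdiv; field; lra.
Qed.

Lemma exp_half_ln (x : R) : 0 < x -> exp (ln x / 2) = sqrt x.
Proof.
  move=> x0; apply: Rsqr_inj; [exact/Rlt_le/exp_pos | exact: sqrt_pos |].
  rewrite Rsqr_sqrt; last lra.
  rewrite /Rsqr -exp_plus -{3}(exp_ln x) //; congr exp; field.
Qed.

Lemma exp_neg_half_ln (x : R) : 0 < x -> exp (- (ln x / 2)) = / sqrt x.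
Proof. by move=> x0; rewrite exp_Ropp exp_half_ln. Qed.

Lemma pole_ln_derive (w phi x : R) : 0 < x ->
  is_derive (fun x => pole w phi (ln x)) x (pw w phi (ln x)).
Proof.
  move=> x0.
  have -> : pw w phi (ln x) = / x * (exp (ln x / 2) * cos (w * ln x + phi)).
  { rewrite /pw exp_half_ln // exp_neg_half_ln //.
    have s0 := sqrt_lt_R0 _ x0.
    rewrite -{3}(sqrt_sqrt x); last lra. field; lra. }
  apply: (is_derive_comp (pole w phi) ln); first exact: pole_derive.
  exact: is_derive_ln.
Qed.

Lemma pw_ln_derive (w phi x : R) : 0 < x ->
  is_derive (fun x => pw w phi (ln x)) x
   (- (exp (- (ln x / 2)) * (cos (w * ln x + phi) / 2 + w * sin (w * ln x + phi))) / x).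
Proof. move=> x0; rewrite /pw; auto_derive => //; rewrite /Rdiv; field; lra. Qed.

Lemma cos_sin_comb_le (w y : R) : Rabs (cos y / 2 + w * sin y) <= 1 / 2 + Rabs w.
Proof.
  have [c1 c2] := COS_bound y.
  have hs : Rabs (sin y) <= 1 by apply: Rabs_le; exact: SIN_bound.
  have h : Rabs (w * sin y) <= Rabs w.
  { rewrite Rabs_mult; have := Rabs_pos w; have := Rabs_pos (sin y); nra. }
  have := Rle_abs (w * sin y); have := Rle_abs (- (w * sin y)); rewrite Rabs_Ropp.
  move=> *; apply: Rabs_le; lra.
Qed.

(** The increment of [pole] is the integral of the summand over [x, x+1], hence the summand at some
    point c of that interval. Moving from c to x+1 costs at most the supremum of the derivative,
    which is of order x^(-3/2). *)
Lemma pw_pole_step (w phi x : R) : 1 <= x ->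
  Rabs (pw w phi (ln (x + 1)) - (pole w phi (ln (x + 1)) - pole w phi (ln x)))
    <= (1 / 2 + Rabs w) / (x * sqrt x).
Proof.
  move=> x1.
  set K := (_ / _).
  have sx : 0 < sqrt x by apply: sqrt_lt_R0; lra.
  have D y : x <= y <= x + 1 ->
    Rabs (- (exp (- (ln y / 2)) * (cos (w * ln y + phi) / 2 + w * sin (w * ln y + phi))) / y) <= K.
  { move=> hy.
    have y0 : 0 < y by lra.
    have sy : sqrt x <= sqrt y by apply: sqrt_le_1_alt; lra.
    rewrite exp_neg_half_ln // Rabs_div; last lra.
    rewrite Rabs_Ropp Rabs_mult (Rabs_pos_eq y); last lra.
    rewrite Rabs_pos_eq; last by apply/Rlt_le/Rinv_0_lt_compat; lra.
    have h := cos_sin_comb_le w (w * ln y + phi).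
    have p0 := Rabs_pos (cos (w * ln y + phi) / 2 + w * sin (w * ln y + phi)).
    rewrite /K /Rdiv.
    have -> : / sqrt y * Rabs (cos (w * ln y + phi) */ 2 + w * sin (w * ln y + phi)) * / y
      = Rabs (cos (w * ln y + phi) */ 2 + w * sin (w * ln y + phi)) * / (y * sqrt y)
      by field; lra.
    apply: Rmult_le_compat => //.
    - apply/Rlt_le/Rinv_0_lt_compat; nra.
    - apply: Rinv_le_contravar; nra. }
  have K0 : 0 <= K by apply: Rle_trans (Rabs_pos _) (D x _); lra.
  have [c [hc e]] : exists c, x <= c <= x + 1 /\
    pole w phi (ln (x + 1)) - pole w phi (ln x) = pw w phi (ln c) * (x + 1 - x).
  { have [c [hc e]] : exists c, Rmin x (x + 1) <= c <= Rmax x (x + 1) /\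
      pole w phi (ln (x + 1)) - pole w phi (ln x) = pw w phi (ln c) * (x + 1 - x).
    { apply: (MVT_gen (fun y => pole w phi (ln y)) x (x + 1) (fun y => pw w phi (ln y))) => y;
        rewrite Rmin_left; try lra; rewrite Rmax_right; try lra; move=> hy.
      - apply: pole_ln_derive; lra.
      - apply: derivable_continuous_pt; exists (pw w phi (ln y)).
        apply/is_derive_Reals; apply: pole_ln_derive; lra. }
    by exists c; rewrite Rmin_left in hc; try lra; rewrite Rmax_right in hc; try lra. }
  rewrite e.
  have -> : x + 1 - x = 1 by ring. rewrite Rmult_1_r.
  apply: Rle_trans (_ : K * (x + 1 - c) <= _); last by nra.
  apply: (mean_value_le (fun y => pw w phi (ln y)) _ K c (x + 1)); first lra.
  - move=> y hy; apply: pw_ln_derive; lra.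
  - move=> y hy; apply: D; lra.
Qed.

(** A telescoping majorant for x^(-3/2). With a = sqrt x and b = sqrt (x+1) one has (b-a)(b+a) = 1,
    so the claim is b (b+a) <= 4 a^2, which follows from b <= 3a/2. *)
Lemma inv_three_halves_le (x : R) : 1 <= x ->
  / (x * sqrt x) <= 4 * (/ sqrt x - / sqrt (x + 1)).
Proof.
  move=> x1.
  have s1 : 1 <= sqrt x by rewrite -sqrt_1; apply: sqrt_le_1_alt.
  have s2 : sqrt x <= sqrt (x + 1) by apply: sqrt_le_1_alt; lra.
  have e1 : sqrt x * sqrt x = x by apply: sqrt_sqrt; lra.
  have e2 : sqrt (x + 1) * sqrt (x + 1) = x + 1 by apply: sqrt_sqrt; lra.
  move: (sqrt x) (sqrt (x + 1)) s1 s2 e1 e2 => a b s1 s2 e1 e2.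
  have h : 0 < x * a * b by apply: Rmult_lt_0_compat; [apply: Rmult_lt_0_compat|]; lra.
  apply: (Rmult_le_reg_l (x * a * b)) => //.
  have -> : x * a * b * / (x * a) = b by field; lra.
  have -> : x * a * b * (4 * (/ a - / b)) = 4 * x * (b - a) by field; lra.
  have hb : b <= 3/2 * a.
  { apply: Rnot_lt_le => hb.
    have : 3 / 2 * a * (3 / 2 * a) < b * b by apply: Rmult_le_0_lt_compat; lra.
    nra. }
  have e3 : (b - a) * (b + a) = 1 by nra.
  have h4 : b * (b + a) <= 4 * x by nra.
  have h5 : (b - a) * (b * (b + a)) <= (b - a) * (4 * x) by apply: Rmult_le_compat_l; lra.
  have -> : b = b * ((b - a) * (b + a)) by rewrite e3; ring.
  have -> : b * ((b - a) * (b + a)) - a = b - a by rewrite e3; ring.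
  lra.
Qed.

(** [u - d] increases, [u + d] decreases, and they have the same limit, which therefore lies between
    them; this gives convergence and its rate together. *)
Lemma lim_of_telescoping (u d : nat -> R) :
  (forall n, Rabs (u (S n) - u n) <= d n - d (S n)) -> is_lim_seq d 0 ->
  exists l : R, is_lim_seq u l /\ forall n, Rabs (u n - l) <= d n.
Proof.
  move=> H d0.
  have Hn n : d (S n) <= d n by have := H n; have := Rabs_pos (u (S n) - u n); lra.
  have dp n : 0 <= d n.
  { have := is_lim_seq_decr_compare d 0 d0 Hn n; by []. }
  have inc n : u n - d n <= u (S n) - d (S n).
  { have := H n; have := Rle_abs (- (u (S n) - u n)); rewrite Rabs_Ropp; lra. }
  have dec n : u (S n) + d (S n) <= u n + d n.
  { have := H n; have := Rle_abs (u (S n) - u n); lra. }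
  have bd n : u 0%N - d 0%N <= u n + d n.
  { apply: Rle_trans (_ : u n - d n <= _); last by have := dp n; lra.
    elim: n => [|n IH]; first lra. exact: Rle_trans IH (inc n). }
  have [l hl] := ex_finite_lim_seq_decr _ _ dec bd.
  have ul : is_lim_seq u l.
  { apply: (is_lim_seq_ext (fun n => (u n + d n) - d n)); first by move=> n; ring.
    have -> : Rbar.Finite l = Rbar.Finite (l - 0) by congr Rbar.Finite; ring.
    exact: is_lim_seq_minus'. }
  have ll : is_lim_seq (fun n => u n - d n) l.
  { have -> : Rbar.Finite l = Rbar.Finite (l - 0) by congr Rbar.Finite; ring.
    exact: is_lim_seq_minus'. }
  exists l; split=> // n.
  have h1 := is_lim_seq_decr_compare _ _ hl dec n.
  have h2 := is_lim_seq_incr_compare _ _ ll inc n.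
  apply: Rabs_le; rewrite /= in h1 h2; lra.
Qed.

(** Real part (phi = 0) or imaginary part (phi = PI/2) of sum_{n<=N} n^(-s) - N^(1-s)/(1-s) at s =
    1/2 + iw, an expression tending to zeta(s). *)
Definition zeta_partial (w phi : R) (N : nat) : R :=
  \sum_(1 <= n < N.+1) pw w phi (ln (INR n)) - pole w phi (ln (INR N)).

Lemma inv_sqrt_lim0 (K : R) : is_lim_seq (fun n => K / sqrt (INR n.+1)) 0.
Proof.
  have -> : Rbar.Finite 0 = Rbar_mult K 0 by rewrite /= Rmult_0_r.
  apply: is_lim_seq_scal_l.
  apply/(is_lim_seq_incr_1 (fun n => / sqrt (INR n))).
  have -> : Rbar.Finite 0 = Rbar_inv p_infty by [].
  apply: is_lim_seq_inv => //.
  apply: filterlim_comp is_lim_seq_INR filterlim_sqrt_p.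
Qed.

Lemma zeta_partial_lim (w phi : R) :
  exists l : R, is_lim_seq (fun n => zeta_partial w phi n.+1) l /\
    forall n, (0 < n)%N ->
      Rabs (zeta_partial w phi n - l) <= (2 + 4 * Rabs w) / sqrt (INR n).
Proof.
  pose d n := (2 + 4 * Rabs w) / sqrt (INR n.+1).
  have H n : Rabs (zeta_partial w phi n.+2 - zeta_partial w phi n.+1) <= d n - d n.+1.
  { rewrite /zeta_partial big_nat_recr // /d; set s := \big[_/_]_(_ <= _ < _) _.
    set x := INR n.+1; have -> : INR n.+2 = x + 1 by rewrite /x (S_INR n.+1).
    have x1 : 1 <= x by rewrite /x S_INR; have := pos_INR n; lra.
    have h := pw_pole_step w phi x x1.
    have h' := inv_three_halves_le x x1.
    rewrite /=; have -> : s + pw w phi (ln (x + 1)) - pole w phi (ln (x + 1)) -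
      (s - pole w phi (ln x)) =
      pw w phi (ln (x + 1)) - (pole w phi (ln (x + 1)) - pole w phi (ln x)) by ring.
    apply: Rle_trans h _; rewrite /Rdiv; have := Rabs_pos w; nra. }
  have [l [h1 h2]] := lim_of_telescoping _ _ H (inv_sqrt_lim0 _).
  exists l; split=> //; case=> [|n] // _; exact: h2.
Qed.

(** [sum_n a (2N+1)] has an even number of terms, the only case in which an alternating sum pairs
    off against doubled terms. *)
Lemma lim_of_odd_lim (a : nat -> R) (l : R) :
  is_lim_seq (fun N => sum_n a (2 * N + 1)%N) l -> is_lim_seq a 0 ->
  is_lim_seq (sum_n a) l.
Proof.
  move=> /is_lim_seq_spec H1 /is_lim_seq_spec H2; apply/is_lim_seq_spec => e.
  have [N1 h1] := H1 (pos_div_2 e). have [N2 h2] := H2 (pos_div_2 e).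
  exists (2 * N1 + N2 + 1)%N => n hn.
  have e0 := cond_pos e.
  have [[k hk]|[k hk]] := Nat.Even_or_Odd n.
  - have := h1 k ltac:(lia); have := h2 n.+1 ltac:(lia).
    have -> : (2 * k + 1)%N = n.+1 by lia.
    rewrite sum_Sn /plus /= Rminus_0_r => h3 h4.
    have -> : sum_n a n - l = (sum_n a n + a n.+1 - l) + - a n.+1 by ring.
    apply: Rle_lt_trans (Rabs_triang _ _) _; rewrite Rabs_Ropp; lra.
  - have -> : n = (2 * k + 1)%N by lia.
    have := h1 k ltac:(lia); rewrite /=; lra.
Qed.

(** Multiplying n^(-s) by a complex number of modulus 1 shifts the phase, so phases 0 and PI/2
    determine all others. This is how multiplication by 2^(1-s) is carried out componentwise. *)
Lemma pw_shift (w psi v : R) :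
  pw w psi v = cos psi * pw w 0 v + sin psi * pw w (PI / 2) v.
Proof. rewrite /pw Rplus_0_r !cos_plus cos_PI2 sin_PI2; ring. Qed.

Lemma pole_shift (w psi v : R) :
  pole w psi v = cos psi * pole w 0 v + sin psi * pole w (PI / 2) v.
Proof.
  have := quarter_sq_gt0 w => ?.
  rewrite /pole Rplus_0_r !cos_plus !sin_plus cos_PI2 sin_PI2; field; lra.
Qed.

Lemma zeta_partial_shift (w psi : R) (N : nat) :
  zeta_partial w psi N =
  cos psi * zeta_partial w 0 N + sin psi * zeta_partial w (PI / 2) N.
Proof.
  rewrite /zeta_partial pole_shift !Rmult_minus_distr_l !sumR_mull.
  rewrite (eq_bigr (fun n => cos psi * pw w 0 (ln (INR n)) +
             sin psi * pw w (PI / 2) (ln (INR n)))); last by move=> n _; exact: pw_shift.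
  rewrite big_split /=; ring.
Qed.

Lemma pw_double (w phi : R) (n : nat) : (0 < n)%N ->
  2 * pw w phi (ln (INR (n.*2))) = sqrt 2 * pw w (phi + w * ln 2) (ln (INR n)).
Proof.
  move=> n0.
  have n0' : 0 < INR n by apply: lt_0_INR; apply/ltP.
  have e2 : INR 2 = 2 by [].
  rewrite -mul2n mult_INR e2 ln_mult; try lra.
  rewrite /pw.
  have -> : - ((ln 2 + ln (INR n)) / 2) = - (ln 2 / 2) + - (ln (INR n) / 2) by field.
  rewrite exp_plus exp_neg_half_ln; last lra.
  have -> : w * (ln 2 + ln (INR n)) + phi = w * ln (INR n) + (phi + w * ln 2) by ring.
  have s2 : sqrt 2 * sqrt 2 = 2 by apply: sqrt_sqrt; lra.
  have s0 : 0 < sqrt 2 by apply: sqrt_lt_R0; lra.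
  rewrite -{1}s2; field; lra.
Qed.

Lemma pole_double (w phi : R) (n : nat) : (0 < n)%N ->
  pole w phi (ln (INR (n.*2))) = sqrt 2 * pole w (phi + w * ln 2) (ln (INR n)).
Proof.
  move=> n0.
  have n0' : 0 < INR n by apply: lt_0_INR; apply/ltP.
  have e2 : INR 2 = 2 by [].
  rewrite -mul2n mult_INR e2 ln_mult; try lra.
  rewrite /pole.
  have -> : (ln 2 + ln (INR n)) / 2 = ln 2 / 2 + ln (INR n) / 2 by field.
  rewrite exp_plus exp_half_ln; last lra.
  have -> : w * (ln 2 + ln (INR n)) + phi = w * ln (INR n) + (phi + w * ln 2) by ring.
  rewrite /Rdiv; ring.
Qed.

(** Finite form of eta(s) = (1 - 2^(1-s)) zeta(s): the alternating sum is the full sum minus twice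
    the even terms, and passing from n to 2n multiplies by a number of modulus sqrt 2 and phase w ln
    2. The two pole terms cancel exactly. *)
Lemma eta_partial (w phi : R) (N : nat) :
  zeta_partial w phi N.+1.*2 - sqrt 2 * zeta_partial w (phi + w * ln 2) N.+1 =
  sum_n (fun k => (-1) ^ k * pw w phi (ln (INR k.+1))) (2 * N + 1)%N.
Proof.
  rewrite /zeta_partial pole_double //.
  set P := pole _ _ _.
  suff <- : \sum_(1 <= n < N.+1.*2.+1) pw w phi (ln (INR n)) -
    sqrt 2 * \sum_(1 <= n < N.+2) pw w (phi + w * ln 2) (ln (INR n)) =
    sum_n (fun k => (-1) ^ k * pw w phi (ln (INR k.+1))) (2 * N + 1)%N by ring.
  clear P; elim: N => [|N IH].
  - rewrite [(2 * 0 + 1)%N]/= sum_Sn sum_O /plus.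
    rewrite /index_iota !big_cons !big_nil.
    have := pw_double w phi 1 isT.
    rewrite -[1.*2]/2%N; set x := pw _ _ _; set y := pw _ _ _; set z := pw _ _ _.
    rewrite /plus /=; lra.
  - have -> : (2 * N.+1 + 1)%N = (2 * N + 1).+2 by lia.
    rewrite !sum_Sn -IH /plus.
    have h := pw_double w phi N.+2 isT.
    have -> : (2 * N + 1).+3 = N.+2.*2 by lia.
    have -> : (2 * N + 1).+2 = N.+1.*2.+1 by lia.
    rewrite (big_nat_recr N.+2) //; have -> : N.+2.*2.+1 = N.+1.*2.+3 by lia.
    rewrite (big_nat_recr N.+1.*2.+2) // (big_nat_recr N.+1.*2.+1) //.
    rewrite -[N.+1.*2.+2]doubleS.
    have -> : (-1) ^ N.+1.*2.+1 = -1.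
    { have -> : N.+1.*2.+1 = S (2 * N.+1) by lia. exact: pow_1_odd. }
    have -> : (-1) ^ (2 * N + 1).+1 = 1.
    { have -> : (2 * N + 1).+1 = (2 * N.+1)%coq_nat by lia. exact: pow_1_even. }
    rewrite /=; lra.
Qed.

Lemma pw_lim0 (w phi : R) : is_lim_seq (fun k => (-1) ^ k * pw w phi (ln (INR k.+1))) 0.
Proof.
  apply/is_lim_seq_abs_0.
  apply: (is_lim_seq_le_le (fun _ => 0) _ (fun k => 1 / sqrt (INR k.+1))).
  - move=> n; split; first exact: Rabs_pos.
    rewrite /pw Rabs_mult pow_1_abs Rabs_mult.
    rewrite exp_neg_half_ln; last by apply: lt_0_INR; lia.
    have h : 0 < / sqrt (INR n.+1).
    { apply/Rinv_0_lt_compat/sqrt_lt_R0/lt_0_INR; lia. }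
    rewrite (Rabs_pos_eq (/ _)); last lra.
    have hc : Rabs (cos (w * ln (INR n.+1) + phi)) <= 1 by apply: Rabs_le; exact: COS_bound.
    rewrite /Rdiv; nra.
  - exact: is_lim_seq_const.
  - exact: inv_sqrt_lim0.
Qed.

Lemma eta_component (w phi l l' : R) :
  is_lim_seq (fun n => zeta_partial w phi n.+1) l ->
  is_lim_seq (fun n => zeta_partial w (phi + w * ln 2) n.+1) l' ->
  Series (fun k => (-1) ^ k * pw w phi (ln (INR k.+1))) = l - sqrt 2 * l'.
Proof.
  move=> h h'; apply: is_series_unique.
  apply: lim_of_odd_lim (pw_lim0 w phi).
  apply: (is_lim_seq_ext (fun N => zeta_partial w phi N.+1.*2 -
    sqrt 2 * zeta_partial w (phi + w * ln 2) N.+1)); first exact: eta_partial.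
  apply: is_lim_seq_minus'; last first.
  { have -> : Rbar.Finite (sqrt 2 * l') = Rbar_mult (sqrt 2) l' by [].
    exact: is_lim_seq_scal_l. }
  apply: (is_lim_seq_ext (fun N => zeta_partial w phi (N.*2.+1).+1)); first by [].
  apply: (is_lim_seq_subseq (fun n => zeta_partial w phi n.+1) l (fun N => N.*2.+1)) h.
  by apply: eventually_subseq => n; lia.
Qed.

(** The limits [l0], [l1] of the partial expressions satisfy eta = (1 - 2^(1-s)) (l0, l1). Division
    is possible because 2^(1-s) has modulus sqrt 2, so it cannot equal 1. *)
Lemma zeta_approx (w : R) (N : nat) : (0 < N)%N ->
  Rabs (Re (zeta (1/2, w)) - zeta_partial w 0 N) <= (2 + 4 * Rabs w) / sqrt (INR N) /\
  Rabs (Im (zeta (1/2, w)) - zeta_partial w (PI / 2) N) <= (2 + 4 * Rabs w) / sqrt (INR N).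
Proof.
  have [l0 [h0 b0]] := zeta_partial_lim w 0.
  have [l1 [h1 b1]] := zeta_partial_lim w (PI / 2).
  have sh psi : is_lim_seq (fun n => zeta_partial w psi n.+1) (cos psi * l0 + sin psi * l1).
  { apply: (is_lim_seq_ext (fun n => cos psi * zeta_partial w 0 n.+1 +
      sin psi * zeta_partial w (PI / 2) n.+1)).
    - by move=> n; rewrite -zeta_partial_shift.
    - by apply: is_lim_seq_plus'; [apply: (is_lim_seq_scal_l _ _ l0) | apply: (is_lim_seq_scal_l _ _ l1)]. }
  set al := w * ln 2 in sh.
  have s2 : sqrt 2 * sqrt 2 = 2 by apply: sqrt_sqrt; lra.
  have s0 : 0 < sqrt 2 by apply: sqrt_lt_R0; lra.
  suff -> : zeta (1/2, w) = (l0, l1).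
  { move=> N0; split; rewrite /= Rabs_minus_sym; [exact: b0 | exact: b1]. }
  have e2 : Cmult (RtoC 2) (npow_neg 2 (1/2, w)) = (sqrt 2 * cos al, - (sqrt 2 * sin al)).
  { have E2 : INR 2 = 2 by [].
    rewrite /npow_neg /Cmult /RtoC; cbn [Re Im fst snd]; rewrite E2.
    have -> : - (1 / 2) * ln 2 = - (ln 2 / 2) by field.
    rewrite exp_neg_half_ln -/al; last lra.
    have -> : / sqrt 2 = sqrt 2 / 2 by rewrite -{3}s2; field; lra.
    congr pair; field. }
  have eeta : dirichlet_eta (1/2, w) =
    (l0 - sqrt 2 * (cos al * l0 + sin al * l1), l1 - sqrt 2 * (cos al * l1 - sin al * l0)).
  { rewrite /dirichlet_eta; congr pair.
    - rewrite -(eta_component w 0 l0 _ h0 _); last first.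
      { rewrite Rplus_0_l; exact: sh. }
      apply: Series_ext => k; rewrite /npow_neg /pw; cbn [Re Im fst snd].
      congr (_ * (exp _ * cos _)); field.
    - have := sh (PI / 2 + al).
      rewrite sin_plus cos_plus sin_PI2 cos_PI2 => h.
      have -> : cos al * l1 - sin al * l0 =
        (0 * cos al - 1 * sin al) * l0 + (1 * cos al + 0 * sin al) * l1 by ring.
      rewrite -(eta_component w (PI / 2) l1 _ h1 h).
      apply: Series_ext => k; rewrite /npow_neg /pw; cbn [Re Im fst snd].
      rewrite cos_plus cos_PI2 sin_PI2.
      have -> : - (1 / 2) * ln (INR k.+1) = - (ln (INR k.+1) / 2) by field.
      ring. }
  rewrite /zeta e2 eeta.
  set d := Cminus _ _.
  have d0 : d <> RtoC 0.
  { rewrite /d /Cminus /Cplus /Copp /RtoC /= => -[ec es].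
    have := sin2_cos2 al; rewrite /Rsqr.
    have c1 : sqrt 2 * cos al = 1 by lra.
    have c2 : sqrt 2 * sin al = 0 by lra.
    move=> h; nra. }
  have -> : (l0 - sqrt 2 * (cos al * l0 + sin al * l1),
             l1 - sqrt 2 * (cos al * l1 - sin al * l0)) = Cmult d (l0, l1).
  { rewrite /d /Cminus /Cplus /Copp /RtoC /Cmult /=; congr pair; ring. }
  by rewrite /Cdiv (Cmult_comm d) -Cmult_assoc Cinv_r // Cmult_1_r.
Qed.

(** The test points j - j' take both signs, whereas large values are wanted at positive t only;
    conjugation transfers the bounds. *)
Lemma zeta_conj (w : R) : zeta (1/2, - w) = Cconj (zeta (1/2, w)).
Proof.
  have h n : npow_neg n (1/2, - w) = Cconj (npow_neg n (1/2, w)).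
  { rewrite /npow_neg /Cconj; cbn [Re Im fst snd].
    have -> : - w * ln (INR n) = - (w * ln (INR n)) by ring.
    rewrite cos_neg sin_neg; congr pair; ring. }
  have he : dirichlet_eta (1/2, - w) = Cconj (dirichlet_eta (1/2, w)).
  { rewrite /dirichlet_eta /Cconj; cbn [fst snd]; rewrite -Series_opp; congr pair;
      apply: Series_ext => k; rewrite h // /Cconj; rewrite /Re /Im /=; ring. }
  rewrite /zeta he h; set z := npow_neg 2 (1/2, w).
  have -> : (RtoC 1 - RtoC 2 * Cconj (z))%C =
    Cconj (RtoC 1 - RtoC 2 * z)%C.
  { rewrite Cminus_conj Cmult_conj /Cconj /RtoC /= Ropp_0 //. }
  rewrite Cdiv_conj //.
  move=> /(f_equal Cmod); rewrite Cmod_0.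
  have s2 : sqrt 2 * sqrt 2 = 2 by apply: sqrt_sqrt; lra.
  have s0 : 0 < sqrt 2 by apply: sqrt_lt_R0; lra.
  have hm : Cmod (RtoC 2 * z)%C = sqrt 2.
  { rewrite Cmod_mult Cmod_R Rabs_pos_eq; last lra.
    have -> : z = (RtoC (/ sqrt 2) * Cconj (cexp (w * ln 2)))%C.
    { rewrite /z /npow_neg /cexp /Cconj /RtoC /Cmult; cbn [Re Im fst snd].
      have -> : INR 2 = 2 by [].
      have -> : - (1 / 2) * ln 2 = - (ln 2 / 2) by field.
      rewrite exp_neg_half_ln; last lra. congr pair; ring. }
    rewrite Cmod_mult Cmod_conj Cmod_R Rabs_pos_eq; last by apply/Rlt_le/Rinv_0_lt_compat.
    have -> : Cmod (cexp (w * ln 2)) = 1.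
    { rewrite /Cmod /cexp /= -[RHS]sqrt_1; congr sqrt.
      have := sin2_cos2 (w * ln 2); rewrite /Rsqr; lra. }
    rewrite -{1}s2; field; lra. }
  set x := (RtoC 2 * _)%C in hm *.
  have := Cmod_triangle (RtoC 1) (x - RtoC 1)%C.
  have -> : (RtoC 1 + (x - RtoC 1) = x)%C by ring.
  have -> : Cmod (x - RtoC 1)%C = Cmod (RtoC 1 - x)%C.
  { rewrite -Cmod_opp; congr Cmod; ring. }
  rewrite hm Cmod_1 => h1 h2; rewrite h2 in h1. nra.
Qed.

(** * Averaging zeta against a binomial kernel *)

(** Expectation of f after k steps of a symmetric walk of step a from t, that is, binomial weights
    2^(-k) C(k,i) at t + (k-2i)a. Exponentials in u are eigenfunctions: frequency v is multiplied by
    cos(av)^k. *)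
Fixpoint avg (a : R) (k : nat) (f : R -> R) (t : R) : R :=
  match k with
  | O => f t
  | S k => (avg a k f (t + a) + avg a k f (t - a)) / 2
  end.

Lemma avg_minus a k f g t :
  avg a k (fun u => f u - g u) t = avg a k f t - avg a k g t.
Proof. by elim: k t => [|k IH] t //=; rewrite !IH; field. Qed.

Lemma avg_scal a k c f t : avg a k (fun u => c * f u) t = c * avg a k f t.
Proof. by elim: k t => [|k IH] t //=; rewrite !IH; field. Qed.

Lemma avg_sum (I : Type) (r : seq I) (P : pred I) a k (f : I -> R -> R) t :
  avg a k (fun u => \sum_(i <- r | P i) f i u) t = \sum_(i <- r | P i) avg a k (f i) t.
Proof.
  elim: k t => [|k IH] t //=.
  by rewrite !IH -big_split /Rdiv sumR_mulr.
Qed.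

Lemma avg_bound a k f t B : 0 <= a ->
  (forall u, Rabs (u - t) <= INR k * a -> Rabs (f u) <= B) ->
  Rabs (avg a k f t) <= B.
Proof.
  move=> a0; elim: k t => [|k IH] t h /=.
  - by apply: h; rewrite INR_0 Rminus_diag Rabs_R0; lra.
  - have h1 : Rabs (avg a k f (t + a)) <= B.
    { apply: IH => u hu; apply: h; rewrite S_INR.
      have -> : u - t = (u - (t + a)) + a by ring.
      apply: Rle_trans (Rabs_triang _ _) _; rewrite (Rabs_pos_eq a) //; lra. }
    have h2 : Rabs (avg a k f (t - a)) <= B.
    { apply: IH => u hu; apply: h; rewrite S_INR.
      have -> : u - t = (u - (t - a)) + - a by ring.
      apply: Rle_trans (Rabs_triang _ _) _; rewrite Rabs_Ropp (Rabs_pos_eq a) //; lra. }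
    rewrite Rabs_div; last lra. rewrite (Rabs_pos_eq 2); last lra.
    have := Rabs_triang (avg a k f (t + a)) (avg a k f (t - a)); lra.
Qed.

Lemma avg_cos a k t v phi :
  avg a k (fun w => cos (w * v + phi)) t = cos (a * v) ^ k * cos (t * v + phi).
Proof.
  elim: k t => [|k IH] t /=; first by ring.
  rewrite !IH.
  have -> : (t + a) * v + phi = (t * v + phi) + a * v by ring.
  have -> : (t - a) * v + phi = (t * v + phi) - a * v by ring.
  rewrite cos_plus cos_minus; field.
Qed.

Lemma avg_pw a k t v phi :
  avg a k (fun w => pw w phi v) t = cos (a * v) ^ k * pw t phi v.
Proof. rewrite /pw avg_scal avg_cos; ring. Qed.

Lemma avg_derive a k (F dF : R -> R -> R) t v :
  (forall w, is_derive (F w) v (dF w v)) ->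
  is_derive (fun v => avg a k (fun w => F w v) t) v (avg a k (fun w => dF w v) t).
Proof.
  move=> h; elim: k t => [|k IH] t /=; first exact: h.
  rewrite /Rdiv Rmult_comm.
  apply: (is_derive_ext (fun v => / 2 * (avg a k (fun w => F w v) (t + a) +
    avg a k (fun w => F w v) (t - a)))); first by move=> x; rewrite Rmult_comm.
  apply: is_derive_scal.
  exact: (is_derive_plus (fun v => avg a k (fun w => F w v) (t + a))).
Qed.

Lemma pole_bound w phi v : Rabs (pole w phi v) <= 2 * exp (v / 2) / (1 / 2 + Rabs w).
Proof.
  have q0 := quarter_sq_gt0 w.
  have e0 := exp_pos (v / 2).
  have w0 := Rabs_pos w.
  rewrite /pole Rabs_div; last lra.
  rewrite (Rabs_pos_eq (_ + w ^ 2)); last lra.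
  rewrite Rabs_mult (Rabs_pos_eq (exp _)); last lra.
  have h := cos_sin_comb_le w (w * v + phi).
  have p0 := Rabs_pos (cos (w * v + phi) / 2 + w * sin (w * v + phi)).
  have key : (1 / 2 + Rabs w) * (1 / 2 + Rabs w) <= 2 * (1 / 4 + w ^ 2).
  { rewrite -(pow2_abs w); have := pow2_ge_0 (Rabs w - 1 / 2); nra. }
  set q := 1 / 4 + w ^ 2 in q0 key *; set s := 1 / 2 + Rabs w in h key *.
  have s0 : 0 < s by rewrite /s; lra.
  have h1 : s / q <= 2 / s.
  { apply: (Rmult_le_reg_r (q * s)); first exact: Rmult_lt_0_compat.
    have -> : s / q * (q * s) = s * s by field; lra.
    have -> : 2 / s * (q * s) = 2 * q by field; lra.
    by []. }
  have -> : 2 * exp (v / 2) / s = exp (v / 2) * (2 / s) by field; lra.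
  rewrite /Rdiv Rmult_assoc; apply: Rmult_le_compat_l; first lra.
  apply: Rle_trans h1; apply: Rmult_le_compat_r => //.
  exact/Rlt_le/Rinv_0_lt_compat.
Qed.

(** The denominator 1/2 - iu keeps the pole term from being an eigenfunction of [avg], but its
    v-derivative is one. Hence the averaged pole [G] and the multiplied pole [H] have derivatives
    differing only by the term in which the cosine power is differentiated. That term is at most
    (k+1) a B 2/|t|, and it is integrated over a length V with aV <= 1. The 8 comes from the values
    of [G] and [H] at v = 0; differentiation removes one cosine factor, whence [k.+1] against k in
    the decay hypothesis. *)
Lemma avg_pole_bound (a V B t phi : R) (k : nat) :
  0 <= a -> 0 <= V -> a * V <= 1 -> t <> 0 ->
  (forall v, 0 <= v <= V -> exp (v / 2) * Rabs (cos (a * v)) ^ k <= B) ->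
  Rabs (avg a k.+1 (fun w => pole w phi V) t) <= 8 + 2 * B * (1 + INR k.+1) / Rabs t.
Proof.
  move=> a0 V0 aV t0 HB.
  have t1 := Rabs_pos_lt t t0.
  pose G v := avg a k.+1 (fun w => pole w phi v) t.
  pose H v := cos (a * v) ^ k.+1 * pole t phi v.
  have k0 := pos_INR k.+1.
  have pb w v : Rabs (pole w phi v) <= 2 * exp (v / 2) / (1 / 2 + Rabs w) by exact: pole_bound.
  have pt v : Rabs (pole t phi v) <= exp (v / 2) * (2 / Rabs t).
  { apply: Rle_trans (pb t v) _.
    have -> : exp (v / 2) * (2 / Rabs t) = 2 * exp (v / 2) / Rabs t by field; lra.
    rewrite /Rdiv; apply: Rmult_le_compat_l; first by have := exp_pos (v */ 2); lra.
    apply: Rinv_le_contravar; lra. }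
  have p4 w : Rabs (pole w phi 0) <= 4.
  { apply: Rle_trans (pb w 0) _.
    have -> : 0 / 2 = 0 by field.
    rewrite exp_0; apply/Rle_div_l; have := Rabs_pos w; lra. }
  have cs x n : 0 <= Rabs (cos x) ^ n by apply: pow_le; exact: Rabs_pos.
  have c1 x : Rabs (cos x) <= 1 by apply: Rabs_le; exact: COS_bound.
  have s1 x : Rabs (sin x) <= 1 by apply: Rabs_le; exact: SIN_bound.
  have B0 : 0 <= B.
  { apply: Rle_trans (HB 0 _); last lra.
    apply: Rmult_le_pos; [exact/Rlt_le/exp_pos | exact: cs]. }
  have D v : is_derive (fun v => G v - H v) v
    (INR k.+1 * (a * sin (a * v)) * cos (a * v) ^ k * pole t phi v).
  { have -> : INR k.+1 * (a * sin (a * v)) * cos (a * v) ^ k * pole t phi v =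
      avg a k.+1 (fun w => exp (v / 2) * cos (w * v + phi)) t -
      ((INR k.+1 * (- (a * sin (a * v))) * cos (a * v) ^ k) * pole t phi v +
       cos (a * v) ^ k.+1 * (exp (v / 2) * cos (t * v + phi))).
    { rewrite avg_scal avg_cos; ring. }
    apply: (is_derive_minus G H).
    - apply: (avg_derive a k.+1 (fun w v => pole w phi v)
        (fun w v => exp (v / 2) * cos (w * v + phi))) => w; exact: pole_derive.
    - apply: (is_derive_mult (fun v => cos (a * v) ^ k.+1) (pole t phi)).
      + apply: (is_derive_pow (fun v => cos (a * v)) k.+1).
        auto_derive => //; ring.
      + exact: pole_derive.
      + by move=> x y; rewrite /mult /= Rmult_comm. }
  have M := mean_value_le (fun v => G v - H v) _
    (INR k.+1 * a * B * (2 / Rabs t)) 0 V V0 (fun v _ => D v).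
  have {}M : Rabs (G V - H V - (G 0 - H 0)) <= INR k.+1 * a * B * (2 / Rabs t) * (V - 0).
  { apply: M => v hv.
    have h2 := pt v; move: (pole t phi v) h2 => p h2.
    rewrite !Rabs_mult (Rabs_pos_eq (INR _)) // (Rabs_pos_eq a) // -RPow_abs.
    have h1 := HB v hv. have h3 := cs (a * v) k.
    have h4 := Rabs_pos (p).
    have h5 : Rabs (cos (a * v)) ^ k * Rabs (p) <= B * (2 / Rabs t).
    { apply: Rle_trans (_ : Rabs (cos (a * v)) ^ k * (exp (v / 2) * (2 / Rabs t)) <= _).
      - exact: Rmult_le_compat_l.
      - rewrite -Rmult_assoc (Rmult_comm (_ ^ k)); apply: Rmult_le_compat_r => //.
        apply: Rlt_le; apply: Rdiv_lt_0_compat; lra. }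
    have h6 : 0 <= INR k.+1 * a by exact: Rmult_le_pos.
    have h7 := s1 (a * v). have h8 := Rabs_pos (sin (a * v)).
    have h9 : 0 <= Rabs (cos (a * v)) ^ k * Rabs (p) by exact: Rmult_le_pos.
    have -> : INR k.+1 * (a * Rabs (sin (a * v))) * Rabs (cos (a * v)) ^ k * Rabs (p)
      = (INR k.+1 * a) * (Rabs (sin (a * v)) * (Rabs (cos (a * v)) ^ k * Rabs (p))) by ring.
    have -> : INR k.+1 * a * B * (2 / Rabs t) = (INR k.+1 * a) * (1 * (B * (2 / Rabs t))) by ring.
    apply: Rmult_le_compat_l => //; apply: Rmult_le_compat => //. }
  have G0 : Rabs (G 0) <= 4 by apply: avg_bound => // u _; exact: p4.
  have H0 : Rabs (H 0) <= 4.
  { rewrite /H Rabs_mult Rmult_0_r cos_0 pow1 Rabs_R1 Rmult_1_l; exact: p4. }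
  have HV : Rabs (H V) <= B * (2 / Rabs t).
  { rewrite /H Rabs_mult -RPow_abs.
    apply: Rle_trans (_ : Rabs (cos (a * V)) ^ k * (exp (V / 2) * (2 / Rabs t)) <= _).
    - apply: Rmult_le_compat => //; try exact: Rabs_pos; try exact: cs.
      rewrite /=; have := c1 (a * V); have := cs (a * V) k; have := Rabs_pos (cos (a * V)); nra.
    - rewrite -Rmult_assoc (Rmult_comm (_ ^ k)); apply: Rmult_le_compat_r => //.
      + apply: Rlt_le; apply: Rdiv_lt_0_compat; lra.
      + apply: HB; lra. }
  have -> : avg a k.+1 (fun w => pole w phi V) t =
    (G V - H V - (G 0 - H 0)) + H V + (G 0 - H 0) by rewrite /G /H; ring.
  have T1 := Rabs_triang (G V - H V - (G 0 - H 0) + H V) (G 0 - H 0).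
  have T2 := Rabs_triang (G V - H V - (G 0 - H 0)) (H V).
  have T3 := Rabs_triang (G 0) (- H 0). rewrite Rabs_Ropp in T3.
  have T4 : INR k.+1 * a * B * (2 / Rabs t) * (V - 0) <= INR k.+1 * (B * (2 / Rabs t)).
  { have -> : INR k.+1 * a * B * (2 / Rabs t) * (V - 0) =
      (a * V) * (INR k.+1 * (B * (2 / Rabs t))) by ring.
    have : 0 <= INR k.+1 * (B * (2 / Rabs t)).
    { apply: Rmult_le_pos => //; apply: Rmult_le_pos => //.
      apply: Rlt_le; apply: Rdiv_lt_0_compat; lra. }
    nra. }
  have -> : 2 * B * (1 + INR k.+1) / Rabs t =
    INR k.+1 * (B * (2 / Rabs t)) + B * (2 / Rabs t) by field; lra.
  rewrite /Rminus in T1 T2 T3 M *; lra.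
Qed.

Definition smoothed (a : R) (k N : nat) (phi t : R) : R :=
  \sum_(1 <= n < N.+1) cos (a * ln (INR n)) ^ k * pw t phi (ln (INR n)).

(** The smoothed polynomial is the average of [zeta_partial] plus the average of the pole. The first
    is close to an average of zeta over points within (k+1)a of t. *)
Lemma smoothed_bound (a B Z t phi : R) (k N : nat) :
  (0 < N)%N -> 0 <= a -> a * ln (INR N) <= 1 -> t <> 0 ->
  phi = 0 \/ phi = PI / 2 ->
  (forall v, 0 <= v <= ln (INR N) -> exp (v / 2) * Rabs (cos (a * v)) ^ k <= B) ->
  (forall u, Rabs (u - t) <= INR k.+1 * a -> Cmod (zeta (1/2, u)) <= Z) ->
  Rabs (smoothed a k.+1 N phi t) <=
    Z + (2 + 4 * (Rabs t + INR k.+1 * a)) / sqrt (INR N) + 8 +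
    2 * B * (1 + INR k.+1) / Rabs t.
Proof.
  move=> N0 a0 aV t0 hphi HB HZ.
  have N1 : 1 <= INR N by apply: (le_INR 1); lia.
  have V0 : 0 <= ln (INR N).
  { have [h|h] : 1 < INR N \/ 1 = INR N by lra.
    - by rewrite -ln_1; apply/Rlt_le/ln_increasing; lra.
    - by rewrite -h ln_1; lra. }
  have P := avg_pole_bound a (ln (INR N)) B t phi k a0 V0 aV t0 HB.
  have sN : 0 < sqrt (INR N) by apply: sqrt_lt_R0; lra.
  have Q : Rabs (avg a k.+1 (fun w => zeta_partial w phi N) t) <=
    Z + (2 + 4 * (Rabs t + INR k.+1 * a)) / sqrt (INR N).
  { apply: avg_bound => // u hu.
    have [hr hi] := zeta_approx u N N0.
    have hz := HZ u hu.
    have hre := Rle_trans _ _ _ (Rmax_l _ _) (Rmax_Cmod (zeta (1/2, u))).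
    have him := Rle_trans _ _ _ (Rmax_r _ _) (Rmax_Cmod (zeta (1/2, u))).
    have hu' : (2 + 4 * Rabs u) / sqrt (INR N) <=
      (2 + 4 * (Rabs t + INR k.+1 * a)) / sqrt (INR N).
    { rewrite /Rdiv; apply: Rmult_le_compat_r; first by apply/Rlt_le/Rinv_0_lt_compat.
      have := Rabs_triang (u - t) t. have -> : u - t + t = u by ring. lra. }
    have tri x y c : Rabs (x - y) <= c -> Rabs y <= Rabs x + c.
    { move=> h; have -> : y = x + - (x - y) by ring.
      apply: Rle_trans (Rabs_triang _ _) _; rewrite Rabs_Ropp; lra. }
    case: hphi => ->.
    - apply: Rle_trans (tri _ _ _ hr) _; rewrite /Re; lra.
    - apply: Rle_trans (tri _ _ _ hi) _; rewrite /Im; lra. }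
  have -> : smoothed a k.+1 N phi t = avg a k.+1 (fun w => zeta_partial w phi N) t +
    avg a k.+1 (fun w => pole w phi (ln (INR N))) t.
  { rewrite /zeta_partial avg_minus avg_sum /smoothed.
    under eq_bigr do rewrite -avg_pw.
    ring. }
  apply: Rle_trans (Rabs_triang _ _) _; lra.
Qed.

Lemma cos_taylor (x : R) : Rabs x <= 1 -> 1 - x ^ 2 / 2 <= cos x <= 1 - x ^ 2 / 4.
Proof.
  move=> h; have h1 := Rle_abs x; have h2 := Rle_abs (- x); rewrite Rabs_Ropp in h2.
  have p := PI2_1.
  have [l u] := cos_bound x 0 ltac:(lra) ltac:(lra).
  rewrite /cos_approx /cos_term /= /Rdiv !INR_IZR_INZ /= in l u.
  have x2 : x * x <= 1 by nra.
  have x4 : 0 <= x * x by nra.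
  split; nra.
Qed.

Lemma exp_pow_nat (x : R) (k : nat) : exp x ^ k = exp (INR k * x).
Proof.
  elim: k => [|k IH]; first by rewrite /= INR_0 Rmult_0_l exp_0.
  by rewrite /= IH -exp_plus S_INR; congr exp; ring.
Qed.

(* The exponent [v/2 - k (av)^2/4] is maximal at [v = 1/(k a^2)]. *)
Lemma kernel_decay (a V v : R) (k : nat) : (0 < k)%N -> 0 < a -> a * V <= 1 ->
  0 <= v <= V -> exp (v / 2) * Rabs (cos (a * v)) ^ k <= exp (/ (4 * INR k * a ^ 2)).
Proof.
  move=> k0 a0 aV hv.
  have k1 : 0 < INR k by apply: lt_0_INR; lia.
  have av : 0 <= a * v <= 1 by nra.
  have [l u] := cos_taylor (a * v) ltac:(rewrite Rabs_pos_eq; lra).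
  have c0 : 0 <= cos (a * v) by nra.
  rewrite Rabs_pos_eq //.
  have c1 : cos (a * v) <= exp (- ((a * v) ^ 2 / 4)).
  { apply: Rle_trans u _; have := exp_ineq1_le (- ((a * v) ^ 2 / 4)); lra. }
  have c2 : cos (a * v) ^ k <= exp (- ((a * v) ^ 2 / 4)) ^ k by apply: pow_incr.
  rewrite exp_pow_nat in c2.
  apply: Rle_trans (_ : exp (v / 2) * exp (INR k * - ((a * v) ^ 2 / 4)) <= _).
  { apply: Rmult_le_compat_l => //; exact/Rlt_le/exp_pos. }
  rewrite -exp_plus.
  have h : v / 2 + INR k * - ((a * v) ^ 2 / 4) <= / (4 * INR k * a ^ 2).
  { have d0 : 0 < INR k * a ^ 2 by apply: Rmult_lt_0_compat => //; nra.
    have -> : / (4 * INR k * a ^ 2) = / (INR k * a ^ 2) / 4 by field; lra.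
    have -> : v / 2 + INR k * - ((a * v) ^ 2 / 4) = v / 2 - (INR k * a ^ 2) * v ^ 2 / 4 by field.
    set d := INR k * a ^ 2 in d0 *.
    have := pow2_ge_0 (d * v - 1).
    move=> hh; apply: (Rmult_le_reg_l (4 * d)); first lra.
    have -> : 4 * d * (/ d / 4) = 1 by field; lra.
    have -> : 4 * d * (v / 2 - d * v ^ 2 / 4) = 2 * (d * v) - (d * v) ^ 2 by field.
    nra. }
  have [h'|->] := Rle_lt_or_eq_dec _ _ h; last lra.
  exact/Rlt_le/exp_increasing.
Qed.

(** * The resonance inequality *)

Lemma cexp_plus x y : cexp (x + y) = (cexp x * cexp y)%C.
Proof. rewrite /cexp cos_plus sin_plus /Cmult /=; congr pair; ring. Qed.

Lemma Cconj_cexp x : Cconj (cexp x) = cexp (- x).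
Proof. by rewrite /cexp /Cconj cos_neg sin_neg. Qed.

Lemma Cmod_cexp x : Cmod (cexp x) = 1.
Proof.
  rewrite /Cmod /cexp /= -[RHS]sqrt_1; congr sqrt.
  have := sin2_cos2 x; rewrite /Rsqr; lra.
Qed.

Lemma Cconj_RtoC (x : R) : Cconj (RtoC x) = RtoC x.
Proof. by rewrite /Cconj /RtoC /= Ropp_0. Qed.

Definition esum (I : Type) (s : seq I) (P : pred I) (r om : I -> R) (t : R) : C :=
  \big[Cplus/RtoC 0]_(i <- s | P i) (RtoC (r i) * cexp (- (om i * t)))%C.

Lemma Re_esum3 (I1 I2 I3 : Type) (s1 : seq I1) (s2 : seq I2) (s3 : seq I3)
    (P1 : pred I1) (P2 : pred I2) (P3 : pred I3) r1 o1 r2 o2 r3 o3 t :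
  Re (esum I1 s1 P1 r1 o1 t * esum I2 s2 P2 r2 o2 t * Cconj (esum I3 s3 P3 r3 o3 t))%C =
  \sum_(i <- s1 | P1 i) \sum_(j <- s2 | P2 j) \sum_(k <- s3 | P3 k)
    r1 i * (r2 j * r3 k) * cos (t * (o1 i + o2 j - o3 k)).
Proof.
  rewrite /esum Cconj_sum -Cmult_assoc big_distrl Re_sum; apply: eq_bigr => i _.
  rewrite big_distrl big_distrr Re_sum; apply: eq_bigr => j _.
  rewrite !big_distrr Re_sum; apply: eq_bigr => k _.
  change (Re (RtoC (r1 i) * cexp (- (o1 i * t)) * (RtoC (r2 j) * cexp (- (o2 j * t)) *
    Cconj (RtoC (r3 k) * cexp (- (o3 k * t)))))%C =
    r1 i * (r2 j * r3 k) * cos (t * (o1 i + o2 j - o3 k))).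
  rewrite Cmult_conj Cconj_RtoC Cconj_cexp.
  have -> : (RtoC (r1 i) * cexp (- (o1 i * t)) *
    (RtoC (r2 j) * cexp (- (o2 j * t)) * (RtoC (r3 k) * cexp (- - (o3 k * t)))))%C =
    (RtoC (r1 i * (r2 j * r3 k)) * (cexp (- (o1 i * t)) * (cexp (- (o2 j * t)) *
      cexp (- - (o3 k * t)))))%C by rewrite !RtoC_mult; ring.
  rewrite -!cexp_plus /cexp /RtoC /Cmult /=.
  rewrite -(cos_neg (t * _)) Rmult_0_l Rminus_0_r; congr (_ * cos _); ring.
Qed.

Lemma Cmod_esum_sq (I : Type) (s : seq I) (P : pred I) r om t :
  Cmod (esum I s P r om t) ^ 2 =
  \sum_(i <- s | P i) \sum_(j <- s | P j) r i * r j * cos (t * (om i - om j)).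
Proof.
  have -> : Cmod (esum I s P r om t) ^ 2 =
    Re (RtoC 1 * esum I s P r om t * Cconj (esum I s P r om t))%C.
  { rewrite Cmult_1_l -Cmod2_conj /= //. }
  (* The constant 1 is a one-term exponential sum of frequency 0, so the triple product formula also
     covers squares. *)
  have -> : RtoC 1 = esum unit [:: tt] xpredT (fun _ => 1) (fun _ => 0) t.
  { rewrite /esum big_cons big_nil /= Rmult_0_l Ropp_0 /cexp cos_0 sin_0.
    rewrite /RtoC /Cmult /Cplus /=; congr pair; ring. }
  rewrite Re_esum3 big_cons big_nil /= Rplus_0_r.
  apply: eq_bigr => i _; apply: eq_bigr => j _; rewrite Rmult_1_l Rplus_0_l //.
Qed.

Lemma Cmod_esum_le (I : Type) (s : seq I) (P : pred I) r om t :
  (forall i, P i -> 0 <= r i) ->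
  Cmod (esum I s P r om t) <= \sum_(i <- s | P i) r i.
Proof.
  move=> r0; apply: Rle_trans (Cmod_sum_le _ _ _ _) _; apply: sumR_le => i Pi.
  rewrite Cmod_mult Cmod_cexp Cmod_R Rabs_pos_eq; first lra. exact: r0.
Qed.

(** * The Fejer kernel and a discrete Parseval identity *)

Definition fejer (J : nat) (x : R) : R :=
  \sum_(j < J) \sum_(j' < J) cos ((INR j - INR j') * x).

Lemma fejer_sq J x :
  fejer J x = (\sum_(j < J) cos (INR j * x)) ^ 2 + (\sum_(j < J) sin (INR j * x)) ^ 2.
Proof.
  rewrite /= !Rmult_1_r !big_distrl -big_split; apply: eq_bigr => j _ /=.
  rewrite !big_distrr -big_split; apply: eq_bigr => j' _ /=.
  by rewrite Rmult_minus_distr_r cos_minus.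
Qed.

Lemma fejer_ge0 J x : 0 <= fejer J x.
Proof.
  rewrite fejer_sq; have := pow2_ge_0 (\sum_(j < J) cos (INR j * x)).
  have := pow2_ge_0 (\sum_(j < J) sin (INR j * x)); lra.
Qed.

(** Each cos(jx) with j < J is at least 1/2 because |jx| <= 1. The integers q and q' record the
    whole turns that are lost when frequencies are reduced to a grid in [0, 2 pi). *)
Lemma fejer_lower J x y (q q' : nat) : y + 2 * PI * INR q = x + 2 * PI * INR q' ->
  Rabs x * INR J <= 1 -> INR J ^ 2 / 4 <= fejer J y.
Proof.
  move=> e hx.
  have -> : fejer J y = fejer J x.
  { have hc (j : nat) : INR j * y + 2 * INR (j * q) * PI = INR j * x + 2 * INR (j * q') * PI.
    { rewrite !mult_INR; have -> : INR j * y + 2 * (INR j * INR q) * PI =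
        INR j * (y + 2 * PI * INR q) by ring. rewrite e; ring. }
    rewrite !fejer_sq; congr (_ ^ 2 + _ ^ 2); apply: eq_bigr => j _.
    - by rewrite -(cos_period _ (j * q)) hc cos_period.
    - by rewrite -(sin_period _ (j * q)) hc sin_period. }
  have h : INR J * (1 / 2) <= \sum_(j < J) cos (INR j * x).
  { rewrite -sumR_const_nat; apply: sumR_le => j _.
    have hj : INR j <= INR J by apply: le_INR; have := ltn_ord j; lia.
    have j0 := pos_INR j. have x0 := Rabs_pos x.
    have ha : Rabs (INR j * x) <= 1.
    { rewrite Rabs_mult Rabs_pos_eq //; nra. }
    have [l _] := cos_taylor _ ha.
    rewrite -(pow2_abs (INR j * x)) in l.
    have := Rabs_pos (INR j * x); nra. }
  rewrite fejer_sq.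
  have := pow2_ge_0 (\sum_(j < J) sin (INR j * x)).
  have J0 := pos_INR J; nra.
Qed.

Lemma sum_cos_telescope M d c :
  2 * sin (d / 2) * \sum_(0 <= j < M) cos ((INR j - c) * d) =
  sin ((INR M - c) * d - d / 2) - sin (- c * d - d / 2).
Proof.
  elim: M => [|M IH].
  - rewrite big_geq // INR_0 Rminus_0_l; ring.
  - rewrite big_nat_recr //= Rmult_plus_distr_l IH S_INR.
    have -> : (INR M + 1 - c) * d - d / 2 = (INR M - c) * d + d / 2 by field.
    rewrite sin_plus sin_minus; ring.
Qed.

Definition freq (M : nat) (b : 'I_M) : R := 2 * PI * INR b / INR M.

(** M times the frequency difference is a multiple of 2 pi, so the two sines left by telescoping
    agree, while sin(d/2) is nonzero because 0 < |b - b'| < M. The shift c will be the second index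
    j'. *)
Lemma sum_cos_orth (M : nat) (b b' : 'I_M) (c : R) : b != b' ->
  \sum_(0 <= j < M) cos ((INR j - c) * (freq M b - freq M b')) = 0.
Proof.
  move=> bb'.
  have M0 : 0 < INR M by apply: lt_0_INR; have := ltn_ord b; lia.
  have p0 := PI_RGT_0.
  set d := freq M b - freq M b'.
  have hd : d / 2 = PI * ((INR b - INR b') / INR M) by rewrite /d /freq; field; lra.
  have hx : -1 < (INR b - INR b') / INR M < 1.
  { have hb : INR b < INR M by apply: lt_INR; have := ltn_ord b; lia.
    have hb' : INR b' < INR M by apply: lt_INR; have := ltn_ord b'; lia.
    have := pos_INR b. have := pos_INR b'.
    move=> h1 h2; split.
    - apply: (Rmult_lt_reg_r (INR M)) => //; have -> : (INR b - INR b') / INR M * INR M = INR b - INR b' by field; lra. lra.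
    - apply: (Rmult_lt_reg_r (INR M)) => //; have -> : (INR b - INR b') / INR M * INR M = INR b - INR b' by field; lra. lra. }
  have hx0 : (INR b - INR b') / INR M <> 0.
  { move=> h; move/eqP: bb'; apply; apply: val_inj; apply: INR_eq => /=.
    have : (INR b - INR b') / INR M * INR M = INR b - INR b' by field; lra.
    rewrite h; lra. }
  have s0 : sin (d / 2) <> 0.
  { rewrite hd; set x := (_ / _) in hx hx0 *.
    have [h|h] : 0 < x \/ x < 0 by lra.
    - apply: Rgt_not_eq; apply: sin_gt_0; nra.
    - have -> : PI * x = - (PI * - x) by ring.
      rewrite sin_neg; have : 0 < sin (PI * - x) by apply: sin_gt_0; nra.
      lra. }
  have h := sum_cos_telescope M d c.
  have hM : (INR M - c) * d - d / 2 + 2 * INR b' * PI = - c * d - d / 2 + 2 * INR b * PI.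
  { have : INR M * d = 2 * PI * (INR b - INR b') by rewrite /d /freq; field; lra. lra. }
  have : sin ((INR M - c) * d - d / 2) = sin (- c * d - d / 2).
  { by rewrite -(sin_period _ b') hM sin_period. }
  move=> e; rewrite e Rminus_diag in h.
  by case: (Rmult_integral _ _ h) => //; lra.
Qed.

Lemma esum_parseval (M : nat) (r : 'I_M -> R) (c : R) :
  \sum_(0 <= j < M) Cmod (esum 'I_M (index_enum _) xpredT r (freq M) (INR j - c)) ^ 2 =
  INR M * \sum_b r b ^ 2.
Proof.
  under eq_bigr do rewrite Cmod_esum_sq.
  rewrite exchange_big sumR_mull; apply: eq_bigr => b _ /=.
  rewrite exchange_big (bigD1 b) //= [X in _ + X]big1 ?Rplus_0_r.
  - rewrite -sumR_mull Rminus_diag.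
    under eq_bigr do rewrite Rmult_0_r cos_0.
    rewrite big_mkord sumR_const_nat; ring.
  - move=> b' bb'; rewrite -sumR_mull sum_cos_orth; first by ring.
    by rewrite eq_sym.
Qed.

(** * Merging frequencies into bins *)

Lemma sum_inj_le (I J : finType) (Q : pred I) (P : pred J) (f : I -> J) (F : J -> R) :
  (forall i, Q i -> P (f i)) -> {in Q &, injective f} -> (forall j, P j -> 0 <= F j) ->
  \sum_(i | Q i) F (f i) <= \sum_(j | P j) F j.
Proof.
  move=> QP inj F0; rewrite (partition_big f P) //; apply: sumR_le => j Pj.
  case: (pickP (fun i => Q i && (f i == j))) => [i0 /andP[Qi0 /eqP fi0] | none].
  - rewrite (big_pred1 i0) => [|i]; first by rewrite fi0; lra.
    rewrite /=; apply/andP/eqP => [[Qi /eqP fi] | ->]; last by rewrite Qi0 fi0.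
    by apply: inj => //; rewrite fi fi0.
  - rewrite big_pred0 //; exact: F0.
Qed.

Lemma sqrt_sum_sq_le (I : Type) (r : seq I) (P : pred I) (x : I -> R) :
  (forall i, P i -> 0 <= x i) ->
  sqrt (\sum_(i <- r | P i) x i ^ 2) <= \sum_(i <- r | P i) x i.
Proof.
  move=> x0; set s := \big[_/_]_(_ <- _ | _) x _.
  have s0 : 0 <= s by exact: sumR_ge0.
  rewrite -(sqrt_pow2 s) //; apply: sqrt_le_1_alt.
  suff : 0 <= \sum_(i <- r | P i) x i ^ 2 <= s ^ 2 /\ 0 <= s by case=> -[].
  rewrite /s; apply: (big_ind2 (fun a b => 0 <= a <= b ^ 2 /\ 0 <= b)); first by lra.
  - move=> a b a' b' [[? ?] ?] [[? ?] ?]; split; [split; nra | lra].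
  - by move=> i Pi; split; [split; [exact: pow2_ge_0 | lra] | exact: x0].
Qed.

(** The l2 norm of the weights in a bin preserves the total sum of squares, so Parseval for the
    binned resonator returns the original normalization. *)
Definition binned (I : finType) (M : nat) (P : pred I) (x : I -> R) (bin : I -> 'I_M)
  (b : 'I_M) : R := sqrt (\sum_(i | P i && (bin i == b)) x i ^ 2).

Lemma binned_ge0 I M P x bin b : 0 <= binned I M P x bin b.
Proof. exact: sqrt_pos. Qed.

Lemma binned_sq (I : finType) M (P : pred I) x bin :
  \sum_b binned I M P x bin b ^ 2 = \sum_(i | P i) x i ^ 2.
Proof.
  rewrite [RHS](partition_big bin xpredT) //; apply: eq_bigr => b _.
  rewrite /binned pow2_sqrt //; apply: sumR_ge0 => i _; exact: pow2_ge_0.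
Qed.

Lemma sum_binned_le (I : finType) M (P : pred I) x bin : (forall i, 0 <= x i) ->
  \sum_b binned I M P x bin b <= sqrt (INR #|P|) * sqrt (\sum_(i | P i) x i ^ 2).
Proof.
  move=> x0; apply: Rle_trans (_ : \sum_(i | P i) x i <= _).
  - rewrite [X in _ <= X](partition_big bin xpredT) //; apply: sumR_le => b _.
    by apply: sqrt_sum_sq_le => i _; exact: x0.
  - have -> : \sum_(i | P i) x i = \sum_(i | P i) 1 * x i by apply: eq_bigr => i _; ring.
    apply: Rle_trans (Cauchy_Schwarz_sqrt _ _ _ (fun _ => 1) x) _.
    have -> : INR #|P| = \sum_(i | P i) 1 ^ 2; last by lra.
    rewrite -sum1_card INR_sum; apply: eq_bigr => i _; rewrite pow1 //.
Qed.

(** For each pair of bins, Cauchy-Schwarz bounds the matching terms by the product of the two bin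
    norms; injectivity of [join] ensures that no x1 S ^ 2 is counted twice. Binning thus never
    decreases the correlation. [W] will be the Fejer kernel and w its lower bound J^2/4. *)
Lemma binned_correlation (I1 I2 : finType) (P1 : pred I1) (P2 Q : pred I2)
    (join : I2 -> I1) (x1 : I1 -> R) (x2 : I2 -> R) (M : nat)
    (bin1 : I1 -> 'I_M) (bin2 : I2 -> 'I_M) (W : 'I_M -> 'I_M -> R) (w : R) :
  (forall A, Q A -> P2 A && P1 (join A)) -> {in Q &, injective join} ->
  0 <= w -> (forall b b', 0 <= W b b') ->
  (forall A, 0 <= x2 A) -> (forall S, 0 <= x1 S) ->
  (forall A, Q A -> w <= W (bin2 A) (bin1 (join A))) ->
  w * \sum_(A | Q A) x2 A * x1 (join A) <=
  \sum_b \sum_b' binned _ _ P2 x2 bin2 b * binned _ _ P1 x1 bin1 b' * W b b'.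
Proof.
  move=> QP inj w0 W0 x20 x10 hW.
  rewrite pair_big /=.
  rewrite (partition_big (fun A => (bin2 A, bin1 (join A))) xpredT) // sumR_mull.
  apply: sumR_le => -[b b'] _ /=.
  set q := binned _ _ _ _ _ _ * _.
  have q0 : 0 <= q by apply: Rmult_le_pos; exact: binned_ge0.
  case: (pickP (fun A => Q A && ((bin2 A, bin1 (join A)) == (b, b')))) => [A0 | none].
  - case/andP=> QA0 /eqP[e1 e2]; have := hW A0 QA0; rewrite e1 e2 => hw.
    rewrite Rmult_comm; apply: Rmult_le_compat => //.
    { by apply: sumR_ge0 => A _; apply: Rmult_le_pos. }
    apply: Rle_trans (Cauchy_Schwarz_sqrt _ _ _ x2 (fun A => x1 (join A))) _.
    apply: Rmult_le_compat; try exact: sqrt_pos; apply: sqrt_le_1_alt.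
    + apply: sumR_subset => A; last by move=> _; exact: pow2_ge_0.
      by case/andP=> QA /eqP[-> _]; case/andP: (QP A QA) => ->; rewrite eqxx.
    + apply: (sum_inj_le _ _ _ _ join (fun S => x1 S ^ 2)).
      * by move=> A /andP[QA /eqP[_ ->]]; case/andP: (QP A QA) => _ ->; rewrite eqxx.
      * by move=> A B /andP[QA _] /andP[QB _]; exact: inj.
      * by move=> S _; exact: pow2_ge_0.
  - rewrite big_pred0 // Rmult_0_r; exact: Rmult_le_pos.
Qed.

(** * Testing a Dirichlet polynomial against two resonators *)

Definition dpoly (N : nat) (alpha : nat -> R) (t : R) : C :=
  esum 'I_N.+1 (index_enum _) (fun n => 0 < n)%N (fun n => alpha n) (fun n => ln (INR n)) t.

Definition resonator (M : nat) (r : 'I_M -> R) (t : R) : C :=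
  esum 'I_M (index_enum _) xpredT r (freq M) t.

Lemma resonance_expand (N M J : nat) alpha (r1 r2 : 'I_M -> R) :
  \sum_(j < J) \sum_(j' < J)
    Re (dpoly N alpha (INR j - INR j') * resonator M r2 (INR j - INR j') *
        Cconj (resonator M r1 (INR j - INR j')))%C =
  \sum_(n < N.+1 | (0 < n)%N) alpha n * \sum_b \sum_b' r2 b * r1 b' *
    fejer J (ln (INR n) + freq M b - freq M b').
Proof.
  under eq_bigr do under eq_bigr do rewrite Re_esum3.
  under eq_bigr do rewrite exchange_big.
  rewrite exchange_big; apply: eq_bigr => n _; rewrite sumR_mull.
  under eq_bigr do rewrite exchange_big.
  rewrite exchange_big; apply: eq_bigr => b _; rewrite sumR_mull.
  under eq_bigr do rewrite exchange_big.
  rewrite exchange_big; apply: eq_bigr => b' _.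
  rewrite /fejer !sumR_mull; apply: eq_bigr => j _.
  rewrite !sumR_mull; apply: eq_bigr => j' _; ring.
Qed.

Lemma count_near (J tau : nat) (j' : nat) :
  \sum_(j < J | (j < j' + tau)%N && (j' < j + tau)%N) 1 <= 2 * INR tau.
Proof.
  have -> : \sum_(j < J | (j < j' + tau)%N && (j' < j + tau)%N) 1 =
    INR #|[pred j : 'I_J | (j < j' + tau)%N && (j' < j + tau)%N]|.
  { by rewrite -sum1_card INR_sum; apply: eq_bigr. }
  have -> : 2 * INR tau = INR (2 * tau) by rewrite mult_INR.
  apply: le_INR; apply/leP.
  case: tau => [|tau].
  - rewrite muln0 leqn0; apply/eqP/eq_card0 => j; rewrite !inE; lia.
  - have -> : (2 * tau.+1)%N = #|'I_(2 * tau).+2| by rewrite card_ord; lia.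
    apply: (leq_card_in (fun j : 'I_J => inord (j + tau.+1 - j'))).
    + move=> j k; rewrite !inE => hj hk /(f_equal val) /=.
      rewrite !inordK; try lia.
      by move=> h; apply: val_inj => /=; lia.
Qed.

(** Pairs with |j - j'| < tau give heights at which nothing is known about zeta; they are charged a
    constant c, and there are at most 2 tau of them for each j'. *)
Lemma sum_near_far (J tau : nat) (F : nat -> nat -> R) (G : nat -> nat -> R) (c : R) :
  (forall j j', 0 <= G j j') -> 0 <= c ->
  (forall j j', (j < J)%N -> (j' < J)%N -> F j j' <=
     if (j < j' + tau)%N && (j' < j + tau)%N then c else G j j') ->
  \sum_(j < J) \sum_(j' < J) F j j' <=
  2 * INR J * INR tau * c + \sum_(j < J) \sum_(j' < J) G j j'.
Proof.
  move=> G0 c0 hF; rewrite exchange_big [X in _ <= _ + X]exchange_big.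
  have -> : 2 * INR J * INR tau * c = \sum_(j' < J) 2 * INR tau * c.
  { rewrite sumR_const_nat; ring. }
  rewrite -big_split; apply: sumR_le => j' _.
  apply: Rle_trans (_ : \sum_(j < J) ((if (j < j' + tau)%N && (j' < j + tau)%N then 1 else 0) * c
     + G j j') <= _).
  - apply: sumR_le => j _; apply: Rle_trans (hF _ _ _ _) _ => //.
    case: ifP => _; have := G0 j j'; lra.
  - rewrite big_split -sumR_mulr -big_mkcond /=.
    apply: Rplus_le_compat_r; apply: Rmult_le_compat_r => //; exact: count_near.
Qed.

(** After Cauchy-Schwarz, each sum of squares is extended from J to a full period of M points, where
    Parseval is exact. *)
Lemma resonator_mean_le (M J : nat) (r1 r2 : 'I_M -> R) (c : R) : (J <= M)%N ->
  \sum_(0 <= j < J) Cmod (resonator M r2 (INR j - c)) * Cmod (resonator M r1 (INR j - c)) <=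
  INR M * sqrt ((\sum_b r1 b ^ 2) * \sum_b r2 b ^ 2).
Proof.
  move=> JM.
  apply: Rle_trans (Cauchy_Schwarz_sqrt _ _ _ _ _) _.
  have H r : sqrt (\sum_(0 <= j < J) Cmod (resonator M r (INR j - c)) ^ 2) <=
    sqrt (INR M) * sqrt (\sum_b r b ^ 2).
  { rewrite -sqrt_mult; last first.
    - by apply: sumR_ge0 => b _; exact: pow2_ge_0.
    - exact: pos_INR.
    apply: sqrt_le_1_alt; rewrite -(esum_parseval M r c).
    rewrite [X in _ <= X](@big_cat_nat _ _ _ J) //.
    rewrite -[X in X <= _]Rplus_0_r; apply: Rplus_le_compat_l.
    suff : 0 <= \sum_(J <= j < M) Cmod (esum 'I_M (index_enum _) xpredT r (freq M) (INR j - c)) ^ 2.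
    { by []. }
    by apply: sumR_ge0 => j _; exact: pow2_ge_0. }
  have s0 x : 0 <= sqrt x by exact: sqrt_pos.
  rewrite sqrt_mult; try by apply: sumR_ge0 => b _; exact: pow2_ge_0.
  apply: Rle_trans (Rmult_le_compat _ _ _ _ (s0 _) (s0 _) (H r2) (H r1)) _.
  have := sqrt_sqrt (INR M) (pos_INR M) => e.
  set a := sqrt _; set b := sqrt (\sum_b r2 b ^ 2).
  have -> : a * b * (a * sqrt (\sum_b r1 b ^ 2)) = a * a * (sqrt (\sum_b r1 b ^ 2) * b) by ring.
  rewrite /a e; lra.
Qed.

Lemma exists_bin (M : nat) (u : R) : (0 < M)%N -> 0 <= u ->
  exists bq : 'I_M * nat,
    0 <= u - (freq M bq.1 + 2 * PI * INR bq.2) <= 2 * PI / INR M.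
Proof.
  move=> M0 u0.
  have M1 : 0 < INR M by apply: lt_0_INR; lia.
  have p0 := PI_RGT_0.
  have h0 : 0 <= u * INR M / (2 * PI).
  { apply: Rmult_le_pos; first by nra. apply/Rlt_le/Rinv_0_lt_compat; lra. }
  have [f [f1 f2]] := nfloor_ex _ h0.
  exists (Ordinal (ltn_pmod f M0), (f %/ M)%N) => /=.
  have -> : freq M (Ordinal (ltn_pmod f M0)) + 2 * PI * INR (f %/ M) = 2 * PI / INR M * INR f.
  { have -> : INR f = INR (f %/ M) * INR M + INR (f %% M).
    { by rewrite {1}(divn_eq f M) -plusE plus_INR -multE mult_INR. }
    rewrite /freq /=; field; lra. }
  have e : u = 2 * PI / INR M * (u * INR M / (2 * PI)) by field; lra.
  have k0 : 0 < 2 * PI / INR M by apply: Rdiv_lt_0_compat; lra.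
  split; rewrite {1}e; nra.
Qed.

(* Frequencies are rounded down to multiples of [2 pi / M] so that Parseval is exact; all
   members of a bin are merged into a single term of the resonator. *)
Theorem resonance (I1 I2 IK : finType) (P1 : pred I1) (P2 : pred I2) (PK : pred IK)
    (Q : IK -> pred I2) (join : IK -> I2 -> I1)
    (x1 u1 : I1 -> R) (x2 u2 : I2 -> R) (nu : IK -> nat)
    (N J tau : nat) (alpha : nat -> R) (A0 Z : R) :
  (forall K A, PK K -> Q K A -> P2 A && P1 (join K A)) ->
  (forall K, PK K -> {in Q K &, injective (join K)}) ->
  (forall K, PK K -> (0 < nu K <= N)%N) -> {in PK &, injective nu} ->
  (forall A, 0 <= x2 A) -> (forall S, 0 <= x1 S) ->
  (forall A, 0 <= u2 A) -> (forall S, 0 <= u1 S) ->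
  (forall K A, PK K -> Q K A -> ln (INR (nu K)) + u2 A = u1 (join K A)) ->
  (forall n, (0 < n <= N)%N -> 0 <= alpha n) -> (0 < J)%N -> 0 <= A0 -> 0 <= Z ->
  (forall t, Cmod (dpoly N alpha t) <= A0) ->
  (forall j j', (j < J)%N -> (j' < J)%N -> ~~ ((j < j' + tau)%N && (j' < j + tau)%N) ->
     Cmod (dpoly N alpha (INR j - INR j')) <= Z) ->
  INR J / 4 * \sum_(K | PK K) alpha (nu K) * \sum_(A | Q K A) x2 A * x1 (join K A) <=
  (2 * INR tau * A0 * sqrt (INR #|P1| * INR #|P2|) + 8 * INR J * Z) *
  sqrt ((\sum_(S | P1 S) x1 S ^ 2) * \sum_(A | P2 A) x2 A ^ 2).
Proof.
  move=> QP inj nuN nuinj x20 x10 u20 u10 hu al0 J0 hA0 hZ0 hA hZ.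
  (* Two rounding errors lie in [0, 2 pi / M], so their difference times J is at most 2 pi / 8 <= 1,
     which is what [fejer_lower] asks for. *)
  set M := (8 * J)%N.
  have M0 : (0 < M)%N by lia.
  have [bq1 hb1] := fin_all_exists (fun S => exists_bin M (u1 S) M0 (u10 S)).
  have [bq2 hb2] := fin_all_exists (fun A => exists_bin M (u2 A) M0 (u20 A)).
  pose bin1 S := (bq1 S).1. pose bin2 A := (bq2 A).1.
  pose r1 := binned _ _ P1 x1 bin1. pose r2 := binned _ _ P2 x2 bin2.
  have J1 : 0 < INR J by apply: lt_0_INR; lia.
  set D1 := \sum_(S | P1 S) x1 S ^ 2. set D2 := \sum_(A | P2 A) x2 A ^ 2.
  have D10 : 0 <= D1 by apply: sumR_ge0 => S _; exact: pow2_ge_0.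
  have D20 : 0 <= D2 by apply: sumR_ge0 => A _; exact: pow2_ge_0.
  have lower : INR J ^ 2 / 4 * \sum_(K | PK K) alpha (nu K) *
      \sum_(A | Q K A) x2 A * x1 (join K A) <=
    \sum_(j < J) \sum_(j' < J)
      Re (dpoly N alpha (INR j - INR j') * resonator M r2 (INR j - INR j') *
        Cconj (resonator M r1 (INR j - INR j')))%C.
  { rewrite resonance_expand.
    pose F (n : 'I_N.+1) := alpha n * \sum_b \sum_b' r2 b * r1 b' *
      fejer J (ln (INR n) + freq M b - freq M b').
    have F0 (n : 'I_N.+1) : (0 < n)%N -> 0 <= F n.
    { move=> n0; apply: Rmult_le_pos; first by apply: al0; have := ltn_ord n; lia.
      apply: sumR_ge0 => b _; apply: sumR_ge0 => b' _; apply: Rmult_le_pos.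
      - by apply: Rmult_le_pos; exact: binned_ge0.
      - exact: fejer_ge0. }
    have nuK K : PK K -> nat_of_ord (inord (nu K) : 'I_N.+1) = nu K.
    { by move=> /nuN h; rewrite inordK; lia. }
    (* Every term of the expansion is nonnegative, so only the indices n = nu K are kept. *)
    apply: Rle_trans (sum_inj_le IK _ PK (fun n : 'I_N.+1 => 0 < n)%N
      (fun K => inord (nu K)) F _ _ F0); last first.
    { by move=> K L hK hL /(f_equal (@nat_of_ord _)); rewrite !nuK //; exact: nuinj. }
    { by move=> K hK; rewrite nuK //; case/andP: (nuN K hK). }
    rewrite sumR_mull; apply: sumR_le => K hK; rewrite /F nuK //.
    have -> : forall a b c : R, a * (b * c) = b * (a * c) by move=> *; ring.
    apply: Rmult_le_compat_l; first exact/al0/nuN.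
    apply: binned_correlation => //.
    - by move=> A hQ; exact: QP.
    - exact: inj.
    - nra.
    - move=> b b'; exact: fejer_ge0.
    - move=> A hQ; rewrite /bin1 /bin2.
      have h1 := hb1 (join K A). have h2 := hb2 A. have h3 := hu K A hK hQ.
      set y1 := freq M _ in h1 *; set y2 := freq M _ in h2 *.
      apply: (fejer_lower _ (ln (INR (nu K)) + (y2 + 2 * PI * INR (bq2 A).2)
        - (y1 + 2 * PI * INR (bq1 (join K A)).2)) _ (bq2 A).2 (bq1 (join K A)).2); first by ring.
      have M1 : INR M = 8 * INR J by rewrite /M mult_INR (INR_IZR_INZ 8).
      have hx : Rabs (ln (INR (nu K)) + (y2 + 2 * PI * INR (bq2 A).2)
        - (y1 + 2 * PI * INR (bq1 (join K A)).2)) <= 2 * PI / INR M by apply: Rabs_le; lra.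
      apply: Rle_trans (Rmult_le_compat_r _ _ _ (Rlt_le _ _ J1) hx) _.
      rewrite M1; have -> : 2 * PI / (8 * INR J) * INR J = PI / 4 by field; lra.
      have := PI_4; lra. }
  have upper : \sum_(j < J) \sum_(j' < J)
      Re (dpoly N alpha (INR j - INR j') * resonator M r2 (INR j - INR j') *
        Cconj (resonator M r1 (INR j - INR j')))%C <=
    2 * INR J * INR tau * (A0 * sqrt (INR #|P1| * INR #|P2|) * sqrt (D1 * D2)) +
    \sum_(j < J) \sum_(j' < J) Z * (Cmod (resonator M r2 (INR j - INR j')) *
      Cmod (resonator M r1 (INR j - INR j'))).
  { have sp x : 0 <= sqrt x by exact: sqrt_pos.
    apply: (sum_near_far J tau (fun j j' => Re (dpoly N alpha (INR j - INR j') *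
      resonator M r2 (INR j - INR j') * Cconj (resonator M r1 (INR j - INR j')))%C)
      (fun j j' => Z * (Cmod (resonator M r2 (INR j - INR j')) *
      Cmod (resonator M r1 (INR j - INR j'))))).
    - move=> j j'; apply: Rmult_le_pos => //; apply: Rmult_le_pos; exact: Cmod_ge_0.
    - by apply: Rmult_le_pos => //; apply: Rmult_le_pos.
    - move=> j j' hj hj'; set t := INR j - INR j'.
      apply: Rle_trans (Rle_abs _) _; apply: Rle_trans (re_le_Cmod _) _.
      rewrite !Cmod_mult Cmod_conj Rmult_assoc.
      have g1 := Cmod_ge_0 (resonator M r1 t). have g2 := Cmod_ge_0 (resonator M r2 t).
      case: ifP => near.
      + have R1 : Cmod (resonator M r1 t) <= sqrt (INR #|P1|) * sqrt D1.
        { apply: Rle_trans (sum_binned_le _ _ P1 x1 bin1 x10).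
          by apply: Cmod_esum_le => b _; exact: binned_ge0. }
        have R2 : Cmod (resonator M r2 t) <= sqrt (INR #|P2|) * sqrt D2.
        { apply: Rle_trans (sum_binned_le _ _ P2 x2 bin2 x20).
          by apply: Cmod_esum_le => b _; exact: binned_ge0. }
        rewrite Rmult_assoc; apply: Rmult_le_compat => //; try exact: Cmod_ge_0.
        { exact: Rmult_le_pos. }
        rewrite !sqrt_mult //; try exact: pos_INR.
        apply: Rle_trans (Rmult_le_compat _ _ _ _ g2 g1 R2 R1) _; lra.
      + apply: Rmult_le_compat_r; first exact: Rmult_le_pos.
        by apply: hZ => //; rewrite near. }
  have mean : \sum_(j < J) \sum_(j' < J) Z * (Cmod (resonator M r2 (INR j - INR j')) *
      Cmod (resonator M r1 (INR j - INR j'))) <= 8 * INR J ^ 2 * Z * sqrt (D1 * D2).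
  { rewrite exchange_big.
    have -> : 8 * INR J ^ 2 * Z * sqrt (D1 * D2) =
      \sum_(j' < J) Z * (INR M * sqrt (D1 * D2)).
    { rewrite sumR_const_nat /M mult_INR (INR_IZR_INZ 8) [Z.of_nat 8]/=; ring. }
    apply: sumR_le => j' _; rewrite -sumR_mull; apply: Rmult_le_compat_l => //.
    have := resonator_mean_le M J r1 r2 (INR j') ltac:(lia).
    by rewrite big_mkord !binned_sq. }
  have := Rle_trans _ _ _ lower (Rle_trans _ _ _ upper (Rplus_le_compat_l _ _ _ mean)).
  move=> h; apply: (Rmult_le_reg_l (INR J)) => //.
  apply: Rle_trans (Rle_trans _ _ _ _ h) _; apply: Req_le; first by field.
  ring.
Qed.

(** * Elementary symmetric functions and products of blocks *)

Definition draws (T : finType) (P : {set T}) (w : nat) : pred {set T} :=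
  fun S => (S \subset P) && (#|S| == w).

Definition esym (T : finType) (y : T -> R) (P : {set T}) (w : nat) : R :=
  \sum_(S | draws T P w S) \prod_(p in S) y p.

(** Correlation on one block: A is drawn by the second resonator, K comes from zeta, and their
    disjoint union is the draw of the first. The weights K^(-1/2), A^(-1/2) and (KA)^(-1/2) multiply
    to 1/(KA), so y will be 1/p. *)
Definition corr (T : finType) (y : T -> R) (P : {set T}) (w r : nat) : R :=
  \sum_(K | draws T P r K) \sum_(A | draws T P (w - r) A && [disjoint K & A])
    (\prod_(p in K) y p) * \prod_(p in A) y p.

Lemma prod_setU (T : finType) (F : T -> R) (A B : {set T}) : [disjoint A & B] ->
  \prod_(p in A :|: B) F p = (\prod_(p in A) F p) * \prod_(p in B) F p.
Proof.
  move=> dAB; rewrite -[RHS]/(Rmult _ _) -(@bigU _ _ Rmult _ (mem A) (mem B)) //.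
  by apply: eq_bigl => p; rewrite !inE.
Qed.

(** A set S of w elements arises as a disjoint union once for each of its r-element subsets K. *)
Lemma corr_esym (T : finType) (y : T -> R) (P : {set T}) (w r : nat) : (r <= w)%N ->
  corr T y P w r = INR 'C(w, r) * esym T y P w.
Proof.
  move=> rw.
  transitivity (\sum_(K | draws T P r K) \sum_(S | draws T P w S && (K \subset S))
    \prod_(p in S) y p).
  { apply: eq_bigr => K /andP[KP /eqP cK].
    rewrite [RHS](reindex_onto (fun A => K :|: A) (fun S => S :\: K)) /=; last first.
    { move=> S /andP[_ KS]; by rewrite setDE setUIr setUCr setIT; apply/setUidPr. }
    apply: eq_big => [A | A /andP[_ dKA]].
    - rewrite /draws subUset KP subsetUl andbT /=.
      have -> : ((K :|: A) :\: K == A) = [disjoint K & A].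
      { rewrite setDUl setDv set0U disjoint_sym -setI_eq0; apply/eqP/eqP => [<- | h].
        - by rewrite setDE -setIA [~: K :&: K]setIC setICr setI0.
        - by apply/setDidPl; rewrite -setI_eq0 h. }
      case dKA: [disjoint K & A]; rewrite ?andbF // !andbT.
      have -> : #|K :|: A| = (r + #|A|)%N.
      { by rewrite cardsU -cK; move: dKA; rewrite -setI_eq0 => /eqP ->; rewrite cards0 subn0. }
      congr (_ && _); lia.
    - by rewrite prod_setU. }
  rewrite /esym sumR_mull (exchange_big_dep (draws T P w)) /=; last by move=> K S _ /andP[].
  apply: eq_bigr => S /andP[SP /eqP cS].
  rewrite -{1}[\big[Rmult/R1]_(p in S) y p]Rmult_1_l -sumR_mulr; congr (_ * _).
  have -> : INR 'C(w, r) = \sum_(K in [set A : {set T} | A \subset S & #|A| == r]) 1.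
  { by rewrite -cS -cards_draws -sum1_card INR_sum. }
  apply: eq_bigl => K; rewrite /draws inE SP cS eqxx andbT /=.
  case KS: (K \subset S); rewrite ?andbF // andbT andTb.
  by rewrite (subset_trans KS SP).
Qed.

Lemma corr_sum (T : finType) (y : T -> R) (P : {set T}) (w r : nat) :
  corr T y P w r =
  \sum_(A | draws T P (w - r) A) (\prod_(p in A) y p) * esym T y (P :\: A) r.
Proof.
  rewrite /corr (exchange_big_dep (draws T P (w - r))) /=; last by move=> K A _ /andP[].
  apply: eq_bigr => A dA; rewrite /esym sumR_mull; apply: eq_big => [K | K _]; last by ring.
  by rewrite dA /= /draws subsetD; case: (K \subset P) => //=; rewrite andbC.
Qed.

Lemma sum_setD_ge (T : finType) (y : T -> R) (P A : {set T}) (eta : R) :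
  A \subset P -> (forall p, p \in P -> y p <= eta) ->
  \sum_(p in P) y p - INR #|A| * eta <= \sum_(p in P :\: A) y p.
Proof.
  move=> AP hy; rewrite (big_setID A) /=; rewrite (setIidPr AP).
  suff : \sum_(p in A) y p <= INR #|A| * eta by set a := \big[_/_]_(_ in A) _; lra.
  apply: Rle_trans (_ : \sum_(p in A) eta <= _).
  - by apply: sumR_le => p pA; apply: hy; apply: (subsetP AP).
  - by rewrite -sum1_card INR_sum sumR_mulr; apply: sumR_le => p _; rewrite INR_1; lra.
Qed.

Lemma esym0 (T : finType) (y : T -> R) (P : {set T}) : esym T y P 0 = 1.
Proof.
  rewrite /esym (big_pred1 set0); first by rewrite big_set0.
  move=> S; rewrite /draws cards_eq0 /=; case: eqP => [->|]; rewrite ?andbF //.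
  by rewrite sub0set.
Qed.

Lemma esym1_ge (T : finType) (y : T -> R) (P : {set T}) : (forall p, 0 <= y p) ->
  \sum_(p in P) y p <= esym T y P 1.
Proof.
  move=> y0; rewrite /esym.
  have := sum_inj_le _ _ (fun p => p \in P) (draws T P 1) (fun p => [set p])
    (fun S : {set T} => \prod_(p in S) y p).
  under eq_bigr do rewrite big_set1.
  apply.
  - by move=> p pP; rewrite /draws sub1set pP cards1.
  - by move=> p q _ _ /set1_inj.
  - by move=> S _; apply: prodR_ge0 => p _; exact: y0.
Qed.

(** Induction through (w+1) e_{w+1} = sum_A y_A e_1(P minus A), which is the case r = 1 of the two
    evaluations of [corr]. Avoiding the at most w elements already chosen lowers the available sum
    by at most w eta. *)
Lemma esym_ge (T : finType) (y : T -> R) (P : {set T}) (w : nat) (eta s : R) :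
  (forall p, 0 <= y p) -> (forall p, p \in P -> y p <= eta) -> 0 <= eta ->
  0 <= s <= \sum_(p in P) y p - INR w * eta -> s ^ w / INR w`! <= esym T y P w.
Proof.
  move=> y0 hy e0; elim: w => [|w IH] hs.
  - rewrite esym0 fact0 INR_1 /=; lra.
  - have h := corr_esym T y P w.+1 1 isT.
    rewrite bin1 corr_sum subn1 /= in h.
    have {}IH := IH ltac:(rewrite S_INR in hs; lra).
    have g : s * esym T y P w <= INR w.+1 * esym T y P w.+1.
    { rewrite -h Rmult_comm /esym sumR_mulr; apply: sumR_le => A /andP[AP /eqP cA].
      apply: Rmult_le_compat_l; first by apply: prodR_ge0 => p _; exact: y0.
      apply: Rle_trans (esym1_ge _ _ _ y0).
      apply: Rle_trans (sum_setD_ge _ _ _ _ _ AP hy).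
      rewrite cA; rewrite S_INR in hs; lra. }
    have w1 : 0 < INR w.+1 by apply: lt_0_INR; lia.
    have f1 : 0 < INR w`! by apply: lt_0_INR; have := fact_gt0 w; lia.
    apply: (Rmult_le_reg_l (INR w.+1)) => //; apply: Rle_trans g.
    rewrite factS -multE mult_INR.
    have -> : INR w.+1 * (s ^ w.+1 / (INR w.+1 * INR w`!)) = s * (s ^ w / INR w`!).
    { rewrite /=; field; lra. }
    apply: Rmult_le_compat_l => //; lra.
Qed.

Lemma prodR_const (n : nat) (x : R) : \prod_(i < n) x = x ^ n.
Proof. by rewrite big_const_ord; elim: n => [|n IH] //=; rewrite IH. Qed.

Lemma bin_fact_ge (w r : nat) : (r <= w)%N -> INR (w - r) ^ r <= INR 'C(w, r) * INR r`!.
Proof.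
  move=> rw; rewrite -mult_INR multE bin_ffact ffact_prod INR_prod.
  rewrite -prodR_const.
  apply: prodR_le => i _; split; first exact: pos_INR.
  by apply: le_INR; have := ltn_ord i; lia.
Qed.

(** [corr] equals C(w,r) e_w and is at least (s^r/r!) e_{w-r}. Multiplying the two evaluations makes
    the normalization e_w e_{w-r} appear by itself. By C(w,r) >= (w-r)^r/r! and r^2 <= (w-r) s, the
    remaining factor is at least (r^r/r!)^2, roughly e^(2r). *)
Lemma corr_sq_ge (T : finType) (y : T -> R) (P : {set T}) (w r : nat) (eta s : R) :
  (forall p, 0 <= y p) -> (forall p, p \in P -> y p <= eta) -> 0 <= eta ->
  0 < s <= \sum_(p in P) y p - INR w * eta -> (r <= w)%N ->
  INR r ^ 2 <= INR (w - r) * s ->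
  [/\ 0 < esym T y P w, 0 < esym T y P (w - r) &
   (INR r ^ r / INR r`!) ^ 2 * (esym T y P w * esym T y P (w - r)) <= corr T y P w r ^ 2].
Proof.
  move=> y0 hy e0 hs rw hr.
  have f0 n : 0 < INR n`! by apply: lt_0_INR; have := fact_gt0 n; lia.
  have wr : INR (w - r) <= INR w by apply: le_INR; lia.
  have wr' : INR (w - r) = INR w - INR r by rewrite minus_INR //; lia.
  have pos n : INR n <= INR w -> 0 < esym T y P n.
  { move=> h; apply: Rlt_le_trans (esym_ge T y P n eta s y0 hy e0 _); last by nra.
    apply: Rdiv_lt_0_compat => //; apply: pow_lt; lra. }
  have p1 := pos w (Rle_refl _). have p2 := pos (w - r)%N wr.
  split=> //.
  have h1 := corr_esym T y P w r rw.
  have h2 : s ^ r / INR r`! * esym T y P (w - r) <= corr T y P w r.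
  { rewrite corr_sum Rmult_comm /esym sumR_mulr; apply: sumR_le => A /andP[AP /eqP cA].
    apply: Rmult_le_compat_l; first by apply: prodR_ge0 => p _; exact: y0.
    apply: (esym_ge T y (P :\: A) r eta s) => //.
    - by move=> p /setDP[pP _]; exact: hy.
    - split; first lra.
      have := sum_setD_ge T y P A eta AP hy; rewrite cA wr'; nra. }
  have h3 := bin_fact_ge w r rw.
  have h4 : (INR r ^ r / INR r`!) ^ 2 <= INR 'C(w, r) * (s ^ r / INR r`!).
  { apply: (Rmult_le_reg_r (INR r`! ^ 2)); first by apply: pow_lt; exact: f0.
    have fr := f0 r.
    have -> : (INR r ^ r / INR r`!) ^ 2 * INR r`! ^ 2 = (INR r ^ 2) ^ r.
    { rewrite -pow_mult Nat.mul_comm pow_mult; field; lra. }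
    have -> : INR 'C(w, r) * (s ^ r / INR r`!) * INR r`! ^ 2 =
      (INR 'C(w, r) * INR r`!) * s ^ r by field; lra.
    apply: Rle_trans (_ : (INR (w - r) * s) ^ r <= _).
    - apply: pow_incr; split=> //; exact: pow2_ge_0.
    - rewrite Rpow_mult_distr; apply: Rmult_le_compat_r => //; apply: pow_le; lra. }
  have c0 : 0 <= INR 'C(w, r) by exact: pos_INR.
  have s0 : 0 <= s ^ r / INR r`!.
  { apply/Rlt_le/Rdiv_lt_0_compat => //; apply: pow_lt; lra. }
  apply: Rle_trans (Rmult_le_compat_r _ _ _ _ h4) _; first by apply: Rmult_le_pos; lra.
  have -> : INR 'C(w, r) * (s ^ r / INR r`!) * (esym T y P w * esym T y P (w - r)) =
    (INR 'C(w, r) * esym T y P w) * (s ^ r / INR r`! * esym T y P (w - r)) by ring.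
  rewrite -h1 -Rsqr_pow2 /Rsqr; apply: Rmult_le_compat_l => //.
  by rewrite h1; apply: Rmult_le_pos; lra.
Qed.

(** * One subset from each block, and the products they define *)

Definition block_family (B n : nat) (P : 'I_n -> {set 'I_B}) (v : 'I_n -> nat) :
  pred {ffun 'I_n -> {set 'I_B}} := fun f => f \in family (fun j => draws _ (P j) (v j)).

Definition disjoint_family (B n : nat) (P : 'I_n -> {set 'I_B}) (v : 'I_n -> nat)
    (K : {ffun 'I_n -> {set 'I_B}}) : pred {ffun 'I_n -> {set 'I_B}} :=
  fun f => f \in family (fun j A => draws _ (P j) (v j) A && [disjoint K j & A]).

Definition block_join (B n : nat) (K A : {ffun 'I_n -> {set 'I_B}}) :
  {ffun 'I_n -> {set 'I_B}} := [ffun j => K j :|: A j].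

Definition block_prod (B n : nat) (f : {ffun 'I_n -> {set 'I_B}}) : nat :=
  (\prod_j \prod_(p in f j) p)%N.

Definition recip (B : nat) (p : 'I_B) : R := / INR p.

Lemma recip_ge0 B p : 0 <= recip B p.
Proof.
  (* ['I_B] contains 0, whose inverse is 0 by convention. *)
  rewrite /recip; case: (Req_dec (INR p) 0) => [-> | h]; first by rewrite Rinv_0; lra.
  apply/Rlt_le/Rinv_0_lt_compat; have := pos_INR p; lra.
Qed.

Lemma INR_block_prod B n (f : {ffun 'I_n -> {set 'I_B}}) :
  INR (block_prod B n f) = \prod_j \prod_(p in f j) INR p.
Proof. by rewrite /block_prod INR_prod; apply: eq_bigr => j _; rewrite INR_prod. Qed.

Lemma inv_block_prod B n (f : {ffun 'I_n -> {set 'I_B}}) : (forall j (p : 'I_B), p \in f j -> (0 < p)%N) ->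
  / INR (block_prod B n f) = \prod_j \prod_(p in f j) recip B p.
Proof.
  move=> h.
  have h0 j (p : 'I_B) : p \in f j -> 0 < INR p by move=> /h ?; apply: lt_0_INR; lia.
  rewrite INR_block_prod prodR_inv; last by move=> j _; apply: prodR_gt0 => p; exact: h0.
  by apply: eq_bigr => j _; rewrite prodR_inv // => p; exact: h0.
Qed.

Lemma block_prod_gt0 B n (f : {ffun 'I_n -> {set 'I_B}}) : (forall j (p : 'I_B), p \in f j -> (0 < p)%N) ->
  (0 < block_prod B n f)%N.
Proof. by move=> h; apply: prodn_gt0 => j; apply: prodn_cond_gt0 => p; exact: h. Qed.

Lemma block_prod_join B n (K A : {ffun 'I_n -> {set 'I_B}}) :
  (forall j, [disjoint K j & A j]) ->
  INR (block_prod B n (block_join B n K A)) = INR (block_prod B n K) * INR (block_prod B n A).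
Proof.
  move=> d; rewrite !INR_block_prod -prodR_mul; apply: eq_bigr => j _.
  by rewrite ffunE prod_setU.
Qed.

Lemma prime_dvd_block_prod B n (f : {ffun 'I_n -> {set 'I_B}}) (p : 'I_B) :
  (forall j (q : 'I_B), q \in f j -> prime q) -> prime p ->
  (p %| block_prod B n f)%N = [exists j, p \in f j].
Proof.
  move=> hf pp; apply/idP/existsP => [|[j pj]].
  - rewrite /block_prod Euclid_dvd_prod // big_has_cond.
    case/hasP => j _ /=; rewrite Euclid_dvd_prod // big_has_cond.
    case/hasP => q _ /andP[/= qj]; rewrite dvdn_prime2 //; last exact: hf qj.
    by move=> /eqP e; exists j; rewrite (_ : p = q) //; apply: val_inj.
  - by rewrite /block_prod (bigD1 j) //= (bigD1 p) //= -mulnA dvdn_mulr.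
Qed.

(** Unique factorization: a prime divides the product exactly when some component contains it, and
    disjointness of the blocks tells which component. *)
Lemma block_prod_inj B n (P : 'I_n -> {set 'I_B}) (v : 'I_n -> nat) :
  (forall j (q : 'I_B), q \in P j -> prime q) ->
  (forall i j (q : 'I_B), q \in P i -> q \in P j -> i = j) ->
  {in block_family B n P v &, injective (block_prod B n)}.
Proof.
  move=> hP dP f g /familyP hf /familyP hg e; apply/ffunP => j; apply/setP => p.
  have sub h (hh : forall x, h x \in draws _ (P x) (v x)) j' q : q \in h j' -> q \in P j'.
  { by case/andP: (hh j') => /subsetP s _; exact: s. }
  have pr h (hh : forall x, h x \in draws _ (P x) (v x)) j' (q : 'I_B) : q \in h j' -> prime q.
  { by move=> /(sub h hh) /hP. }
  have key (h h' : {ffun 'I_n -> {set 'I_B}}) (hh : forall x, h x \in draws _ (P x) (v x))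
    (hh' : forall x, h' x \in draws _ (P x) (v x)) :
    block_prod B n h = block_prod B n h' -> p \in h j -> p \in h' j.
  { move=> eh ph.
    have pp := pr h hh j p ph.
    have : (p %| block_prod B n h)%N.
    { by rewrite prime_dvd_block_prod //; [apply/existsP; exists j | exact: pr hh]. }
    rewrite eh prime_dvd_block_prod //; last exact: pr hh'.
    case/existsP => i pi.
    by rewrite (dP j i p (sub h hh j p ph) (sub h' hh' i p pi)). }
  by apply/idP/idP; apply: key.
Qed.

Lemma sum_block_family B n (P : 'I_n -> {set 'I_B}) v :
  \sum_(f | block_family B n P v f) \prod_j \prod_(p in f j) recip B p =
  \prod_j esym _ (recip B) (P j) (v j).
Proof.
  by rewrite /esym (bigA_distr_big_dep (fun j => draws _ (P j) (v j))
    (fun _ (S : {set 'I_B}) => \prod_(p in S) recip B p)).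
Qed.

Lemma sum_disjoint_family B n (P : 'I_n -> {set 'I_B}) (w r : 'I_n -> nat) :
  \sum_(K | block_family B n P r K)
    \sum_(A | disjoint_family B n P (fun j => w j - r j)%N K A)
      (\prod_j \prod_(p in K j) recip B p) * (\prod_j \prod_(p in A j) recip B p) =
  \prod_j corr _ (recip B) (P j) (w j) (r j).
Proof.
  rewrite /corr (bigA_distr_big_dep (fun j => draws _ (P j) (r j))
    (fun j (K : {set 'I_B}) => \sum_(A | draws _ (P j) (w j - r j) A && [disjoint K & A])
       (\prod_(p in K) recip B p) * \prod_(p in A) recip B p)).
  apply: eq_bigr => K _.
  rewrite (bigA_distr_big_dep (fun j A => draws _ (P j) (w j - r j) A && [disjoint K j & A])
    (fun j (A : {set 'I_B}) => (\prod_(p in K j) recip B p) * \prod_(p in A) recip B p)).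
  by apply: eq_bigr => A _; rewrite big_split.
Qed.

Lemma card_block_family B n (P : 'I_n -> {set 'I_B}) v :
  INR #|block_family B n P v| = \prod_j INR 'C(#|P j|, v j).
Proof.
  rewrite -sum1_card INR_sum.
  have h := bigA_distr_big_dep (fun j => draws _ (P j) (v j)) (fun (_ : 'I_n) (_ : {set 'I_B}) => 1).
  transitivity (\sum_(f in family (fun j => draws _ (P j) (v j))) \prod_(j < n) 1).
  - by apply: eq_bigr => f _; rewrite big1_eq.
  - rewrite -h; apply: eq_bigr => j _; rewrite -cards_draws -sum1_card INR_sum.
    by apply: eq_bigl => S; rewrite inE.
Qed.

(** [resonance] with weights n^(-1/2) and frequencies ln n. Since draws in different blocks are
    independent, the correlation is a product of [corr] and the norms are products of [esym], so
    [corr_sq_ge] applies block by block and the norms cancel. The kernel weight g enters only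
    through its minimum over the products supplied by zeta. *)
Theorem block_resonance (B n N J tau : nat) (P : 'I_n -> {set 'I_B})
    (w r : 'I_n -> nat) (eta : 'I_n -> R) (s gmin A0 Z : R) (g : nat -> R) :
  (forall j (q : 'I_B), q \in P j -> prime q) ->
  (forall i j (q : 'I_B), q \in P i -> q \in P j -> i = j) ->
  (forall j (q : 'I_B), q \in P j -> / INR q <= eta j) -> (forall j, 0 <= eta j) ->
  (forall j, 0 < s <= \sum_(p in P j) / INR p - INR (w j) * eta j) ->
  (forall j, (r j <= w j)%N) -> (forall j, INR (r j) ^ 2 <= INR (w j - r j) * s) ->
  (forall K, block_family B n P r K ->
     (block_prod B n K <= N)%N /\ gmin <= g (block_prod B n K)) ->
  0 <= gmin -> (forall m, (0 < m <= N)%N -> 0 <= g m) -> (0 < J)%N -> 0 <= A0 -> 0 <= Z ->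
  (forall t, Cmod (dpoly N (fun m => g m / sqrt (INR m)) t) <= A0) ->
  (forall j j', (j < J)%N -> (j' < J)%N -> ~~ ((j < j' + tau)%N && (j' < j + tau)%N) ->
     Cmod (dpoly N (fun m => g m / sqrt (INR m)) (INR j - INR j')) <= Z) ->
  INR J / 4 * gmin * \prod_j (INR (r j) ^ r j / INR (r j)`!) <=
  2 * INR tau * A0 * sqrt ((\prod_j INR 'C(#|P j|, w j)) * \prod_j INR 'C(#|P j|, w j - r j))
  + 8 * INR J * Z.
Proof.
  move=> hP dP he e0 hs rw hr hK g0' g0 J0 hA0 hZ0 hA hZ.
  pose x (f : {ffun 'I_n -> {set 'I_B}}) := / sqrt (INR (block_prod B n f)).
  pose u (f : {ffun 'I_n -> {set 'I_B}}) := ln (INR (block_prod B n f)).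
  have x0 f : 0 <= x f.
  { rewrite /x; have := sqrt_pos (INR (block_prod B n f)); set y := sqrt _ => y0.
    case: (Req_dec y 0) => [-> | h]; first by rewrite Rinv_0; lra.
    apply/Rlt_le/Rinv_0_lt_compat; lra. }
  have u0 f : 0 <= u f.
  { rewrite /u; case: (posnP (block_prod B n f)) => [-> | h].
    (* Nonnegativity of u is asked of every function f, including those with product 0, where [ln]
       has default value 0. *)
    - rewrite INR_0 /ln; case: Rlt_dec => h; [by case: (Rlt_irrefl 0) | exact: Rle_refl].
    - rewrite -ln_1; apply: ln_le; first lra. by apply: (le_INR 1); lia. }
  have mem v f j (p : 'I_B) : block_family B n P v f -> p \in f j -> p \in P j.
  { by move=> /familyP /(_ j) /andP[/subsetP h _]; exact: h. }
  have gt0 v f j (p : 'I_B) : block_family B n P v f -> p \in f j -> (0 < p)%N.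
  { by move=> hf /(mem _ _ _ _ hf) /hP /prime_gt0. }
  have bp0 v f : block_family B n P v f -> 0 < INR (block_prod B n f).
  { move=> hf; apply: lt_0_INR; apply/ltP; apply: block_prod_gt0 => j p; exact: gt0 hf. }
  have dis K A : block_family B n P r K -> disjoint_family B n P (fun j => w j - r j)%N K A ->
    [/\ block_family B n P (fun j => w j - r j)%N A, (forall j, [disjoint K j & A j]) &
        block_family B n P w (block_join B n K A)].
  { move=> /familyP hKf /familyP hAf; split.
    - by apply/familyP => j; case/andP: (hAf j).
    - by move=> j; case/andP: (hAf j).
    - apply/familyP => j; rewrite ffunE.
      case/andP: (hAf j) => /andP[sA /eqP cA] dj.
      case/andP: (hKf j) => sK /eqP cK.
      rewrite /in_mem /= /draws subUset sK sA /= cardsU cA cK.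
      move: dj; rewrite -setI_eq0 => /eqP ->; rewrite cards0; have := rw j; lia. }
  have xsq v : \sum_(f | block_family B n P v f) x f ^ 2 = \prod_j esym _ (recip B) (P j) (v j).
  { rewrite -sum_block_family; apply: eq_bigr => f hf.
    rewrite -inv_block_prod; last by move=> j p; exact: gt0 hf.
    have := bp0 v f hf => b0.
    rewrite /x -{2}(pow2_sqrt (INR (block_prod B n f))); last lra.
    rewrite pow_inv //. }
  set D1 := \prod_j esym _ (recip B) (P j) (w j).
  set D2 := \prod_j esym _ (recip B) (P j) (w j - r j).
  set G := \prod_j (INR (r j) ^ r j / INR (r j)`!).
  set Nm := \prod_j corr _ (recip B) (P j) (w j) (r j).
  have blk j := corr_sq_ge _ (recip B) (P j) (w j) (r j) (eta j) s (recip_ge0 B) (he j)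
    (e0 j) (hs j) (rw j) (hr j).
  have D10 : 0 < D1 by apply: prodR_gt0 => j _; case: (blk j).
  have D20 : 0 < D2 by apply: prodR_gt0 => j _; case: (blk j).
  have f0 m : 0 < INR m`! by apply: lt_0_INR; have := fact_gt0 m; lia.
  have rr0 j : 0 <= INR (r j) ^ r j / INR (r j)`!.
  { apply: Rmult_le_pos; first by apply: pow_le; exact: pos_INR.
    exact/Rlt_le/Rinv_0_lt_compat. }
  have G0 : 0 <= G by apply: prodR_ge0 => j _; exact: rr0.
  have Nm0 : 0 <= Nm.
  { apply: prodR_ge0 => j _; rewrite corr_esym //; apply: Rmult_le_pos; first exact: pos_INR.
    by apply: Rlt_le; case: (blk j). }
  have NG : G * sqrt (D1 * D2) <= Nm.
  { rewrite -(sqrt_pow2 Nm) // -(sqrt_pow2 G) // -sqrt_mult; try exact: pow2_ge_0; last by nra.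
    apply: sqrt_le_1_alt; rewrite /G /D1 /D2 /Nm /= !Rmult_1_r -!prodR_mul.
    apply: prodR_le => j _; case: (blk j) => p1 p2 p3; split.
    - apply: Rmult_le_pos; [exact: Rmult_le_pos | apply: Rmult_le_pos; lra].
    - by rewrite /= !Rmult_1_r in p3. }
  have R : INR J / 4 * \sum_(K | block_family B n P r K)
      (g (block_prod B n K) / sqrt (INR (block_prod B n K))) *
      \sum_(A | disjoint_family B n P (fun j => w j - r j)%N K A) x A * x (block_join B n K A) <=
    (2 * INR tau * A0 * sqrt ((\prod_j INR 'C(#|P j|, w j)) * \prod_j INR 'C(#|P j|, w j - r j))
     + 8 * INR J * Z) * sqrt (D1 * D2).
  { rewrite /D1 /D2 -!card_block_family -(xsq w) -(xsq (fun j => w j - r j)%N).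
    apply: (resonance _ _ _ (block_family B n P w) (block_family B n P (fun j => w j - r j)%N)
      (block_family B n P r) (disjoint_family B n P (fun j => w j - r j)%N) (block_join B n)
      x u x u (block_prod B n) N J tau (fun m => g m / sqrt (INR m)) A0 Z) => //.
    - by move=> K A hKf hQ; case: (dis K A hKf hQ) => -> _ ->.
    - move=> K hKf A A' hQ hQ' e; apply/ffunP => j.
      case: (dis K A hKf hQ) => _ /(_ j) d _. case: (dis K A' hKf hQ') => _ /(_ j) d' _.
      have := f_equal (fun h : {ffun 'I_n -> {set 'I_B}} => h j :\: K j) e.
      rewrite !ffunE !setDUl setDv !set0U.
      by move: d d'; rewrite disjoint_sym => /setDidPl ->; rewrite disjoint_sym => /setDidPl ->.
    - move=> K hKf; case: (hK K hKf) => -> _; rewrite andbT.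
      apply: block_prod_gt0 => j p; exact: gt0 hKf.
    - exact: block_prod_inj hP dP.
    - move=> K A hKf hQ; case: (dis K A hKf hQ) => hA' d hS.
      rewrite /u block_prod_join // ln_mult //; [exact: bp0 hKf | exact: bp0 hA'].
    - move=> m hm; apply: Rmult_le_pos; first exact: g0.
      apply/Rlt_le/Rinv_0_lt_compat/sqrt_lt_R0/lt_0_INR; lia. }
  have L : gmin * Nm <= \sum_(K | block_family B n P r K)
      (g (block_prod B n K) / sqrt (INR (block_prod B n K))) *
      \sum_(A | disjoint_family B n P (fun j => w j - r j)%N K A) x A * x (block_join B n K A).
  { rewrite /Nm -sum_disjoint_family sumR_mull; apply: sumR_le => K hKf.
    rewrite !sumR_mull; apply: sumR_le => A hQ.
    case: (dis K A hKf hQ) => hA' d hS.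
    rewrite -!inv_block_prod; [| by move=> j p; exact: gt0 hA' | by move=> j p; exact: gt0 hKf].
    have k0 := bp0 _ _ hKf. have a0 := bp0 _ _ hA'.
    have sk := sqrt_lt_R0 _ k0. have sa := sqrt_lt_R0 _ a0.
    have -> : g (block_prod B n K) / sqrt (INR (block_prod B n K)) * (x A * x (block_join B n K A))
      = g (block_prod B n K) * (/ INR (block_prod B n K) * / INR (block_prod B n A)).
    { rewrite /x block_prod_join // sqrt_mult; try lra.
      have sq y : 0 < y -> / y = / sqrt y * / sqrt y.
      { by move=> y0; rewrite -Rinv_mult sqrt_sqrt //; lra. }
      rewrite (sq _ k0) (sq _ a0).
      field; lra. }
    apply: Rmult_le_compat_r; last by case: (hK K hKf).
    by apply: Rmult_le_pos; apply/Rlt_le/Rinv_0_lt_compat. }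
  have J1 : 0 < INR J by apply: lt_0_INR; lia.
  have sD : 0 < sqrt (D1 * D2) by apply: sqrt_lt_R0; nra.
  apply: (Rmult_le_reg_r (sqrt (D1 * D2))) => //; apply: Rle_trans R.
  have -> : INR J / 4 * gmin * G * sqrt (D1 * D2) =
    INR J / 4 * (gmin * (G * sqrt (D1 * D2))) by ring.
  apply: Rmult_le_compat_l; first lra.
  apply: Rle_trans L; exact: Rmult_le_compat_l.
Qed.

(** * Mertens-type bounds *)

Lemma INR_ge1 (n : nat) : (0 < n)%N -> 1 <= INR n.
Proof. by move=> h; apply: (le_INR 1); lia. Qed.

Lemma INR_gt0 (n : nat) : (0 < n)%N -> 0 < INR n.
Proof. by move=> /INR_ge1; lra. Qed.

Lemma ln_INR_ge0 (n : nat) : (0 < n)%N -> 0 <= ln (INR n).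
Proof. by move=> /INR_ge1 h; rewrite -ln_1; apply: ln_le; lra. Qed.

Lemma ln_le_sub1 (x : R) : 0 < x -> ln x <= x - 1.
Proof.
  move=> x0; have := exp_ineq1_le (ln x); rewrite exp_ln //; lra.
Qed.

Lemma ln_fact_le (n : nat) : ln (INR n`!) <= INR n * ln (INR n).
Proof.
  elim: n => [|n IH]; first by rewrite fact0 INR_1 ln_1 INR_0; lra.
  have h := INR_gt0 n.+1 isT.
  rewrite factS -multE mult_INR ln_mult //; last by apply: INR_gt0; exact: fact_gt0.
  have hn : INR n * ln (INR n) <= INR n * ln (INR n.+1).
  { case: n {IH} h => [|n] h; first by rewrite INR_0; lra.
    apply: Rmult_le_compat_l; first exact: pos_INR.
    apply: ln_le; first exact: INR_gt0. by apply: le_INR; lia. }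
  rewrite {2}S_INR; lra.
Qed.

Lemma ln_fact_ge (n : nat) : INR n * ln (INR n) - INR n <= ln (INR n`!).
Proof.
  elim: n => [|n IH]; first by rewrite fact0 INR_1 ln_1 INR_0; lra.
  have h := INR_gt0 n.+1 isT.
  rewrite factS -multE mult_INR ln_mult //; last by apply: INR_gt0; exact: fact_gt0.
  case: n IH h => [|n] IH h.
  - rewrite fact0 INR_1 ln_1; lra.
  - have h' := INR_gt0 n.+1 isT.
    have hl : ln (INR n.+2) - ln (INR n.+1) <= / INR n.+1.
    { rewrite -ln_div //; apply: Rle_trans (ln_le_sub1 _ _) _; first exact: Rdiv_lt_0_compat.
      rewrite (S_INR n.+1); apply: Req_le; field; lra. }
    have : INR n.+1 * (ln (INR n.+2) - ln (INR n.+1)) <= 1.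
    { apply: Rle_trans (Rmult_le_compat_l _ _ _ (Rlt_le _ _ h') hl) _.
      rewrite Rinv_r; lra. }
    set L := ln (INR n.+2); rewrite (S_INR n.+1); lra.
Qed.

Lemma ln_fact_primes (n : nat) :
  ln (INR n`!) = \sum_(1 <= p < n.+1 | prime p) INR (logn p n`!) * ln (INR p).
Proof.
  have e : n`! = (\prod_(1 <= p < n.+1 | prime p) p ^ logn p n`!)%N.
  { rewrite -{1}(@partnT n`!) ?fact_gt0 // /partn.
    rewrite (@big_cat_nat _ _ _ n.+1) //=; last by have := fact_geq n; lia.
    rewrite [X in (_ * X)%N]big1_seq ?muln1; last first.
    { move=> p /andP[_]; rewrite mem_index_iota => /andP[hp _].
      case pp: (prime p); last by rewrite lognE pp.
      rewrite logn_fact // big1_seq // => k /andP[_]; rewrite mem_index_iota => /andP[k1 _].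
      rewrite divn_small //; apply: leq_trans hp _.
      by rewrite -{1}(expn1 p) leq_exp2l // prime_gt1. }
    rewrite big_ltn // -{1}[(0 ^ _)%N]/(0 ^ 0)%N expn0 mul1n.
    rewrite [RHS]big_mkcond; apply: eq_bigr => p _ /=.
    by case: ifP => // pp; rewrite lognE pp. }
  rewrite {1}e INR_prod ln_prod; last first.
  { by move=> p pp; apply: INR_gt0; rewrite expn_gt0 prime_gt0. }
  apply: eq_bigr => p pp; have p0 := INR_gt0 p (prime_gt0 pp).
  elim: (logn p n`!) => [|k IH]; first by rewrite expn0 INR_1 ln_1 INR_0; ring.
  have pk : 0 < INR (p ^ k) by apply: INR_gt0; rewrite expn_gt0 prime_gt0.
  rewrite expnS -multE mult_INR ln_mult // IH S_INR; ring.
Qed.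

Definition mertens (n : nat) : R := \sum_(1 <= p < n.+1 | prime p) ln (INR p) / INR p.

(* Working with (q n)! instead of n! makes Chebyshev's bound on primes unnecessary, at the
   cost of an error term ln q. *)
Lemma mertens_le (n q : nat) : (0 < n)%N -> (1 < q)%N ->
  (INR q - 1) * mertens n <= INR q * (ln (INR n) + ln (INR q)).
Proof.
  move=> n0 q1.
  have hn := INR_gt0 n n0. have hq := INR_gt0 q ltac:(lia).
  have F := ln_fact_le (q * n).
  rewrite ln_fact_primes -multE mult_INR ln_mult // in F.
  apply: (Rmult_le_reg_l (INR n)) => //.
  apply: Rle_trans (_ : INR q * INR n * (ln (INR q) + ln (INR n)) <= _); last by lra.
  apply: Rle_trans F; rewrite multE.
  rewrite [X in _ <= X](@big_cat_nat _ _ _ n.+1) //=; last by nia.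
  apply: Rle_trans (_ : \sum_(1 <= p < n.+1 | prime p) INR (logn p (q * n)`!) * ln (INR p) <= _);
    last first.
  { rewrite -[X in X <= _]Rplus_0_r; apply: Rplus_le_compat_l; apply: sumR_ge0 => p pp.
    apply: Rmult_le_pos; [exact: pos_INR | exact: ln_INR_ge0 (prime_gt0 pp)]. }
  rewrite /mertens -Rmult_assoc sumR_mull big_nat_cond [X in _ <= X]big_nat_cond.
  apply: sumR_le => p /andP[/andP[p1 pn] pp].
  have hp := INR_gt0 p (prime_gt0 pp).
  have -> : INR n * (INR q - 1) * (ln (INR p) / INR p) =
    (INR n * (INR q - 1) / INR p) * ln (INR p) by field; lra.
  apply: Rmult_le_compat_r; first exact: ln_INR_ge0 (prime_gt0 pp).
  apply: Rle_trans (_ : INR (q * n %/ p) <= _); last first.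
  { apply: le_INR; rewrite logn_fact //; apply/leP.
    by rewrite big_ltn ?expn1 ?leq_addr //; nia. }
  apply: (Rmult_le_reg_r (INR p)) => //.
  have -> : INR n * (INR q - 1) / INR p * INR p = INR n * INR q - INR n by field; lra.
  have hpn : INR p <= INR n by apply: le_INR; lia.
  have : INR (q * n) <= INR (q * n %/ p) * INR p + INR p.
  { rewrite -mult_INR -plus_INR; apply: le_INR.
    have := divn_eq (q * n) p; have := ltn_pmod (q * n) (prime_gt0 pp); lia. }
  rewrite mult_INR; lra.
Qed.

(** Legendre's formula and a geometric series of ratio 1/p; the remainder is kept exactly so that
    the induction on the number of terms closes. *)
Lemma logn_fact_le (p n : nat) : prime p ->
  INR (logn p n`!) <= INR n / (INR p - 1).
Proof.
  move=> pp; rewrite logn_fact // INR_sum.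
  have hp : 2 <= INR p by apply: (le_INR 2); have := prime_gt1 pp; lia.
  have hn := pos_INR n.
  suff h m : \sum_(1 <= k < m.+1) INR (n %/ p ^ k) <=
    INR n / (INR p - 1) - INR n / (INR p - 1) / INR p ^ m.
  { have := h n; have : 0 <= INR n / (INR p - 1) / INR p ^ n.
    { apply: Rmult_le_pos; last by apply/Rlt_le/Rinv_0_lt_compat/pow_lt; lra.
      apply: Rmult_le_pos => //; apply/Rlt_le/Rinv_0_lt_compat; lra. }
    lra. }
  have pm k : 0 < INR p ^ k by apply: pow_lt; lra.
  elim: m => [|m IH].
  - rewrite big_geq //= Rdiv_1_r; lra.
  - rewrite big_nat_recr //=.
    have d : INR (n %/ p ^ m.+1) <= INR n / INR p ^ m.+1.
    { apply: (Rmult_le_reg_r (INR p ^ m.+1)) => //.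
      have -> : INR n / INR p ^ m.+1 * INR p ^ m.+1 = INR n by field; have := pm m.+1; lra.
      have -> : INR p ^ m.+1 = INR (p ^ m.+1).
      { elim: m.+1 => [|k IHk]; first by rewrite expn0 INR_1.
        by rewrite expnS -multE mult_INR -IHk. }
      rewrite -mult_INR; apply: le_INR; apply/leP; exact: leq_trunc_div. }
    have e : INR n / (INR p - 1) / INR p ^ m - INR n / INR p ^ m.+1 =
      INR n / (INR p - 1) / INR p ^ m.+1.
    { have pm0 := pm m; rewrite /=; field; lra. }
    rewrite /= in d e *; lra.
Qed.

(** From ln p <= 2 (sqrt p - 1) each term is at most 2 p^(-3/2), and [inv_three_halves_le]
    telescopes this with total 2 * 4 = 8. *)
Lemma sum_ln_prime_tail (n : nat) :
  \sum_(1 <= p < n.+1 | prime p) ln (INR p) / (INR p * (INR p - 1)) <= 8.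
Proof.
  suff h : \sum_(1 <= p < n.+1 | prime p) ln (INR p) / (INR p * (INR p - 1)) <=
    8 - 8 / sqrt (INR n.+1).
  { have : 0 < / sqrt (INR n.+1) by apply/Rinv_0_lt_compat/sqrt_lt_R0; exact: INR_gt0.
    lra. }
  case: n => [|n].
  { rewrite big_geq // INR_1 sqrt_1; lra. }
  elim: n => [|n IH].
  { rewrite big_nat_cond big_pred0; last by case=> [|[|m]].
    have : / sqrt (INR 2) <= 1; last by lra.
    rewrite -Rinv_1; apply: Rinv_le_contravar; first lra.
    rewrite -{1}sqrt_1; apply: sqrt_le_1_alt; exact: INR_ge1. }
  rewrite big_mkcond big_nat_recr // -big_mkcond.
  set x := INR n.+1.
  have x1 : 1 <= x by exact: INR_ge1.
  have x2 : INR n.+2 = x + 1 by rewrite S_INR.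
  have x3 : INR n.+3 = x + 1 + 1 by rewrite S_INR x2.
  rewrite x2 in IH; rewrite x2 x3.
  have t := inv_three_halves_le (x + 1) ltac:(lra).
  have p0 : 0 < / ((x + 1) * sqrt (x + 1)).
  { apply/Rinv_0_lt_compat/Rmult_lt_0_compat; first lra. apply: sqrt_lt_R0; lra. }
  suff : (if prime n.+2 then ln (x + 1) / ((x + 1) * (x + 1 - 1)) else 0) <=
    8 / sqrt (x + 1) - 8 / sqrt (x + 1 + 1).
  { move=> h; apply: Rle_trans (Rplus_le_compat _ _ _ _ IH h) _; lra. }
  case: ifP => _; last by lra.
  have s1 : 1 <= sqrt (x + 1) by rewrite -{1}sqrt_1; apply: sqrt_le_1_alt; lra.
  have ss : sqrt (x + 1) * sqrt (x + 1) = x + 1 by apply: sqrt_sqrt; lra.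
  have l1 : ln (x + 1) <= 2 * (sqrt (x + 1) - 1).
  { rewrite -{1}ss ln_mult; try lra; have := ln_le_sub1 (sqrt (x + 1)); lra. }
  set s := sqrt (x + 1) in s1 ss l1 t p0 *.
  have xs : x = s * s - 1 by lra.
  have s2 : 1 < s by nra.
  apply: Rle_trans (_ : 2 * / ((x + 1) * s) <= _); last by lra.
  have -> : x + 1 - 1 = x by ring.
  apply: (Rmult_le_reg_r ((x + 1) * x)); first by nra.
  have -> : ln (x + 1) / ((x + 1) * x) * ((x + 1) * x) = ln (x + 1) by field; lra.
  have -> : 2 * / ((x + 1) * s) * ((x + 1) * x) = 2 * (x / s) by field; lra.
  apply: Rle_trans l1 _; apply: Rmult_le_compat_l; first lra.
  rewrite xs; have -> : (s * s - 1) / s = s - / s by field; lra.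
  have : / s <= 1 by rewrite -Rinv_1; apply: Rinv_le_contravar; lra.
  lra.
Qed.

(** Legendre's formula bounds ln n! by n times [mertens n] plus the tail; the 9 is 1 from the lower
    bound for n! and 8 from the tail. *)
Lemma mertens_ge (n : nat) : (0 < n)%N -> ln (INR n) - 9 <= mertens n.
Proof.
  move=> n0; have hn := INR_gt0 n n0.
  have F := ln_fact_ge n; rewrite ln_fact_primes in F.
  have T := sum_ln_prime_tail n.
  apply: (Rmult_le_reg_l (INR n)) => //.
  suff : \sum_(1 <= p < n.+1 | prime p) INR (logn p n`!) * ln (INR p) <=
    INR n * (mertens n + \sum_(1 <= p < n.+1 | prime p) ln (INR p) / (INR p * (INR p - 1))).
  { nra. }
  rewrite /mertens -big_split sumR_mull; apply: sumR_le => p pp.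
  have hp : 2 <= INR p by apply: (le_INR 2); have := prime_gt1 pp; lia.
  apply: Rle_trans (Rmult_le_compat_r _ _ _ (ln_INR_ge0 p (prime_gt0 pp)) (logn_fact_le p n pp)) _.
  apply: Req_le; rewrite /=; field; lra.
Qed.

(** The condition on q makes the factor q/(q-1) in the upper bound cost at most 1, hence 10 = 9 + 1.
    For a window near log T, q is of order loglog T and the error ln q of order logloglog T. *)
Lemma mertens_window (a b q : nat) : (0 < a)%N -> (a <= b)%N -> (1 < q)%N ->
  ln (INR a) + ln (INR q) <= INR q - 1 ->
  ln (INR b) - ln (INR a) - ln (INR q) - 10 <=
  \sum_(a.+1 <= p < b.+1 | prime p) ln (INR p) / INR p.
Proof.
  move=> a0 ab q1 hq.
  have L := mertens_ge b ltac:(lia). have U := mertens_le a q a0 q1.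
  have e : mertens b = mertens a + \sum_(a.+1 <= p < b.+1 | prime p) ln (INR p) / INR p.
  { rewrite /mertens (@big_cat_nat _ _ _ a.+1) //=; lia. }
  have q2 : 2 <= INR q by apply: (le_INR 2); lia.
  suff : mertens a <= ln (INR a) + ln (INR q) + 1 by lra.
  apply: (Rmult_le_reg_l (INR q - 1)); lra.
Qed.

(** * Large values of zeta from a family of blocks *)

Lemma exp_le x y : x <= y -> exp x <= exp y.
Proof. by case=> [/exp_increasing/Rlt_le // | ->]; lra. Qed.

Lemma exp_ge_sq (x : R) : 0 <= x -> x ^ 2 / 4 <= exp x.
Proof.
  move=> x0; have -> : x = x / 2 + x / 2 by field.
  rewrite exp_plus; have := exp_ineq1_le (x / 2); nra.
Qed.

Lemma eventually_lin_le_exp (A B al : R) : 0 < al ->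
  exists l0, forall l, l0 <= l -> A + B * l <= exp (al * l).
Proof.
  move=> a0; exists (1 + 4 * (Rabs A + Rabs B) / al ^ 2) => l hl.
  have p1 := Rabs_pos A. have p2 := Rabs_pos B.
  have h0 : 0 <= 4 * (Rabs A + Rabs B) / al ^ 2.
  { apply: Rmult_le_pos; first lra. apply/Rlt_le/Rinv_0_lt_compat; nra. }
  have h1 : 4 * (Rabs A + Rabs B) <= al ^ 2 * l.
  { have -> : 4 * (Rabs A + Rabs B) = al ^ 2 * (4 * (Rabs A + Rabs B) / al ^ 2).
    { field; lra. }
    apply: Rmult_le_compat_l; nra. }
  apply: Rle_trans (exp_ge_sq (al * l) _); last by nra.
  have q1 := Rle_abs A. have q2 := Rle_abs B. nra.
Qed.

Lemma harmonic_le (N : nat) : (0 < N)%N -> \sum_(1 <= n < N.+1) / INR n <= 1 + ln (INR N).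
Proof.
  case: N => [|N] // _; elim: N => [|N IH].
  - rewrite /index_iota big_cons big_nil INR_1 ln_1; lra.
  - rewrite big_nat_recr // -[Monoid.Law.sort _ _ _]/(Rplus _ _).
    have h1 := INR_gt0 N.+1 isT. have h2 := INR_gt0 N.+2 isT.
    have : / INR N.+2 <= ln (INR N.+2) - ln (INR N.+1).
    { have := ln_le_sub1 (INR N.+1 / INR N.+2) (Rdiv_lt_0_compat _ _ h1 h2).
      rewrite ln_div //.
      have -> : INR N.+1 / INR N.+2 - 1 = - / INR N.+2; last by lra.
      rewrite (S_INR N.+1); field; rewrite S_INR in h2; lra. }
    rewrite /=; lra.
Qed.

Lemma dpoly_smoothed (a : R) (k N : nat) (t : R) :
  dpoly N (fun m => cos (a * ln (INR m)) ^ k / sqrt (INR m)) t =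
  (smoothed a k N 0 t, smoothed a k N (PI / 2) t).
Proof.
  have E (F : nat -> R) : \sum_(1 <= n < N.+1) F n = \sum_(n < N.+1 | (0 < n)%N) F n.
  { by rewrite big_geq_mkord. }
  rewrite /dpoly /esum.
  have pe (z : C) : z = (Re z, Im z) by case: z.
  rewrite [LHS]pe Re_sum Im_sum /smoothed !E; congr pair; apply: eq_bigr => n n0.
  - rewrite /pw exp_neg_half_ln; last exact: INR_gt0.
    rewrite /cexp /RtoC /Cmult /= cos_neg Rmult_0_l Rminus_0_r Rplus_0_r (Rmult_comm t).
    rewrite /Rdiv; ring.
  - rewrite /pw exp_neg_half_ln; last exact: INR_gt0.
    rewrite /cexp /RtoC /Cmult /= sin_neg Rmult_0_l Rplus_0_r cos_plus cos_PI2 sin_PI2 (Rmult_comm t).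
    rewrite /Rdiv; ring.
Qed.

Lemma Cmod_le_components (z : C) : Cmod z <= Rabs (Re z) + Rabs (Im z).
Proof.
  have -> : z = Cplus (RtoC (Re z)) (Cmult Ci (RtoC (Im z))).
  { case: z => x y; rewrite /Ci /RtoC /Cplus /Cmult /=; congr pair; ring. }
  apply: Rle_trans (Cmod_triangle _ _) _; rewrite Cmod_mult Cmod_Ci !Cmod_R.
  rewrite /Re /Im /=; apply: Req_le; rewrite !Rmult_0_l !Rmult_0_r; congr (Rabs _ + _).
  - ring.
  - rewrite Rmult_1_l; congr Rabs; ring.
Qed.

Lemma one_sub_ge_exp (y : R) : 0 <= y <= 1 / 2 -> exp (- (2 * y)) <= 1 - y.
Proof.
  move=> hy; have h := exp_ineq1_le (2 * y). have p := exp_pos (2 * y).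
  rewrite exp_Ropp; apply: (Rmult_le_reg_l (exp (2 * y))) => //.
  rewrite Rinv_r; last lra. nra.
Qed.

(** With l = log T: if zeta were small on all of [T^beta, T], the averaged polynomial would be small
    at every far pair and the resonance inequality would fail. The factor exp(-C1 Lam^2/l) bounds
    from below the kernel weight cos(av)^(k+1) at v <= Lam. [C1] and [l0] are chosen before the
    blocks, which may then depend on l. *)
Theorem large_value_of_blocks (beta kappa : R) :
  0 <= beta -> 0 < kappa -> beta + kappa < 1 ->
  exists C1 l0 : R, 0 < C1 /\ forall l, l0 <= l ->
  forall (B n : nat) (P : 'I_n -> {set 'I_B}) (w r : 'I_n -> nat) (eta : 'I_n -> R) (s Lam : R),
  (forall j (q : 'I_B), q \in P j -> prime q) ->
  (forall i j (q : 'I_B), q \in P i -> q \in P j -> i = j) ->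
  (forall j (q : 'I_B), q \in P j -> / INR q <= eta j) -> (forall j, 0 <= eta j) ->
  (forall j, 0 < s <= \sum_(p in P j) / INR p - INR (w j) * eta j) ->
  (forall j, (r j <= w j)%N) -> (forall j, INR (r j) ^ 2 <= INR (w j - r j) * s) ->
  (forall K, block_family B n P r K -> ln (INR (block_prod B n K)) <= Lam) ->
  0 <= Lam <= l ->
  sqrt ((\prod_j INR 'C(#|P j|, w j)) * \prod_j INR 'C(#|P j|, w j - r j)) <= exp (kappa * l) ->
  exists t, exp (beta * l) <= t <= exp l /\
    exp (- (C1 * Lam ^ 2 / l)) * \prod_j (INR (r j) ^ r j / INR (r j)`!) <=
    2500 * (1 + Cmod (zeta (1/2, t))).
Proof.
  move=> b0 k0 bk.
  (* Budget of exponents of T: beta + gap/2 for [tau], 2 eps = gap/4 for the kernel bound [BB],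
     kappa for the resonators. The last gap/4 absorbs constants and powers of l. *)
  pose gap := 1 - beta - kappa.
  pose beta1 := beta + gap / 2.
  pose eps := gap / 8.
  have gap0 : 0 < gap by rewrite /gap; lra.
  have eps0 : 0 < eps by rewrite /eps; lra.
  (* Bound for the width (k+1) a of the averaging, where a = 1/V and k is about V/(4 eps). *)
  pose q0 := / (4 * eps) + 1.
  have q01 : 1 < q0.
  { rewrite /q0; have : 0 < / (4 * eps) by apply: Rinv_0_lt_compat; lra. lra. }
  have [l1 hl1] := eventually_lin_le_exp (2 * (q0 + 2)) 0 1 Rlt_0_1.
  have [l2 hl2] := eventually_lin_le_exp (q0 + 1) 0 (gap / 4) ltac:(lra).
  have [l3 hl3] := eventually_lin_le_exp (2 * exp eps * (3 + q0)) (4 * exp eps * q0) (gap / 4) ltac:(lra).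
  have [l4 hl4] := eventually_lin_le_exp (32 * exp eps * 2) (32 * exp eps * 2) (gap / 4) ltac:(lra).
  exists q0, (Rmax 1 (Rmax l1 (Rmax l2 (Rmax l3 l4)))).
  split; first lra.
  move=> l hl.
  have {hl} [hl0 [ha [hb [hc hd]]]] : 1 <= l /\ l1 <= l /\ l2 <= l /\ l3 <= l /\ l4 <= l.
  { move: hl; have := Rmax_l 1 (Rmax l1 (Rmax l2 (Rmax l3 l4))).
    have := Rmax_r 1 (Rmax l1 (Rmax l2 (Rmax l3 l4))).
    have := Rmax_l l1 (Rmax l2 (Rmax l3 l4)). have := Rmax_r l1 (Rmax l2 (Rmax l3 l4)).
    have := Rmax_l l2 (Rmax l3 l4). have := Rmax_r l2 (Rmax l3 l4).
    have := Rmax_l l3 l4. have := Rmax_r l3 l4. lra. }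
  have {}ha := hl1 l ha. have {}hb := hl2 l hb. have {}hc := hl3 l hc. have {}hd := hl4 l hd.
  clear hl1 hl2 hl3 hl4 l1 l2 l3 l4.
  rewrite Rmult_1_l in ha.
  move=> B n P w r eta s Lam hP dP he e0 hs rw hr hLam Lam0 hcost.
  set T := exp l in ha *.
  have T2 : 2 * (q0 + 2) <= T by lra.
  set G := \prod_j (INR (r j) ^ r j / INR (r j)`!).
  set X := exp _ * G.
  apply: NNPP => none.
  have small t : exp (beta * l) <= t <= T -> 2500 * (1 + Cmod (zeta (1/2, t))) < X.
  { by move=> ht; apply: Rnot_le_lt => h; apply: none; exists t. }
  clear none.
  (* N about T^2 keeps the truncation error (2 + 4|t|)/sqrt N bounded for |t| <= T. *)
  have [N0 [N01 N02]] := nfloor_ex (T ^ 2) (pow2_ge_0 T).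
  pose N := N0.+1.
  have NT : T ^ 2 <= INR N <= T ^ 2 + 1 by rewrite /N S_INR; lra.
  have Npos : (0 < N)%N by [].
  have N1 : 0 < INR N by exact: INR_gt0.
  set V := ln (INR N).
  have V2 : 2 * l <= V.
  { have -> : 2 * l = ln (T ^ 2).
    { rewrite /T /= Rmult_1_r -exp_plus ln_exp; ring. }
    apply: ln_le; [nra | lra]. }
  have V3 : V <= 2 * l + 1.
  { have -> : 2 * l + 1 = ln (T ^ 2 * exp 1).
    { rewrite /T /= Rmult_1_r -!exp_plus ln_exp; ring. }
    apply: ln_le => //; have := exp_ineq1_le 1; nra. }
  (* The largest step for which av stays in [0, 1] on the whole range, where the cosine is at least
     1/2. With k >= V/(4 eps), [kernel_decay] then bounds e^(v/2) cos(av)^k by e^(eps V). *)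
  pose a := / V.
  have V0 : 0 < V by lra.
  have a0 : 0 < a by exact: Rinv_0_lt_compat.
  have aV : a * V = 1 by rewrite /a; field; lra.
  have hk0 : 0 <= V / (4 * eps) by apply: Rmult_le_pos; [lra | apply/Rlt_le/Rinv_0_lt_compat; lra].
  have [k1 [k11 k12]] := nfloor_ex _ hk0.
  pose k := k1.+1.
  have kV : V / (4 * eps) <= INR k by rewrite /k S_INR; lra.
  have kV' : INR k <= V / (4 * eps) + 1 by rewrite /k S_INR; lra.
  have kS : INR k.+1 * a <= q0 /\ INR k.+1 <= q0 * V.
  { have h : INR k.+1 <= q0 * V.
    { rewrite S_INR /q0 Rmult_plus_distr_r.
      have -> : / (4 * eps) * V = V / (4 * eps) by field; lra. lra. }
    split=> //; apply: (Rmult_le_reg_r V) => //; rewrite Rmult_assoc aV; lra. }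
  case: kS => kS kS2.
  pose BB := exp (eps * V).
  have BBb : BB <= exp eps * exp (2 * eps * l).
  { rewrite -exp_plus; apply: exp_le; nra. }
  have decay v : 0 <= v <= V -> exp (v / 2) * Rabs (cos (a * v)) ^ k <= BB.
  { move=> hv; apply: Rle_trans (kernel_decay a V v k isT a0 ltac:(lra) hv) _; apply: exp_le.
    have k2 : 0 < INR k by exact: INR_gt0.
    apply: (Rmult_le_reg_r (4 * INR k * a ^ 2)).
    { apply: Rmult_lt_0_compat; [lra | nra]. }
    rewrite Rinv_l; last by apply: Rgt_not_eq; apply: Rmult_lt_0_compat; [lra | nra].
    have -> : eps * V * (4 * INR k * a ^ 2) = (4 * eps * INR k) * ((a * V) * a) by ring.
    rewrite aV Rmult_1_l.
    have h : V <= 4 * eps * INR k.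
    { have -> : V = 4 * eps * (V / (4 * eps)) by field; lra.
      apply: Rmult_le_compat_l; lra. }
    have -> : 1 = V * a by rewrite Rmult_comm aV.
    apply: Rmult_le_compat_r; lra. }
  have BB1 : 1 <= BB by rewrite /BB -exp_0; apply: exp_le; nra.
  set A0 := BB * (1 + V).
  pose g m := cos (a * ln (INR m)) ^ k.+1.
  have lnV m : (0 < m <= N)%N -> 0 <= ln (INR m) <= V.
  { move=> hm; split; first by apply: ln_INR_ge0; lia.
    by apply: ln_le; [apply: INR_gt0; lia | apply: le_INR; lia]. }
  have av1 v : 0 <= v <= V -> 0 <= a * v <= 1 by move=> hv; rewrite -aV; nra.
  have cpos v : 0 <= v <= V -> 1 / 2 <= cos (a * v) <= 1.
  { move=> hv; have := av1 v hv => h; split; last by have := COS_bound (a * v); lra.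
    have [] := cos_taylor (a * v) ltac:(rewrite Rabs_pos_eq; lra); nra. }
  have g0 m : (0 < m <= N)%N -> 0 <= g m.
  { by move=> hm; apply: pow_le; have := cpos _ (lnV m hm); lra. }
  have hA t : Cmod (dpoly N (fun m => g m / sqrt (INR m)) t) <= A0.
  { apply: Rle_trans (Cmod_esum_le _ _ _ _ _ _ _) _.
    { move=> m m0; apply: Rmult_le_pos; first by apply: g0; have := ltn_ord m; lia.
      by apply/Rlt_le/Rinv_0_lt_compat/sqrt_lt_R0; exact: INR_gt0. }
    apply: Rle_trans (_ : BB * \sum_(m < N.+1 | (0 < m)%N) / INR m <= _); last first.
    { apply: Rmult_le_compat_l; first lra.
      have := harmonic_le N Npos; by rewrite big_geq_mkord. }
    rewrite sumR_mull; apply: sumR_le => m m0.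
    have hm : (0 < m <= N)%N by have := ltn_ord m; lia.
    have m1 := INR_gt0 m m0. have sm := sqrt_lt_R0 _ m1.
    have hv := lnV m hm. have hc' := cpos _ hv.
    have := decay _ hv; rewrite exp_half_ln // Rabs_pos_eq; last lra.
    move=> h.
    have -> : g m / sqrt (INR m) = (sqrt (INR m) * g m) * / INR m.
    { rewrite -{3}(sqrt_sqrt (INR m)); last lra. field; lra. }
    apply: Rmult_le_compat_r; first exact/Rlt_le/Rinv_0_lt_compat.
    apply: Rle_trans h; apply: Rmult_le_compat_l; first lra.
    rewrite /g -tech_pow_Rmult.
    have : 0 <= cos (a * ln (INR m)) ^ k by apply: pow_le; lra.
    move: (_ ^ k) => y y0; nra. }
  have e1pos := exp_pos (beta1 * l).
  have [tau0 [ta1 ta2]] := nfloor_ex _ (Rlt_le _ _ e1pos).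
  pose tau := tau0.+1.
  have tau1 : exp (beta1 * l) <= INR tau <= exp (beta1 * l) + 1 by rewrite /tau S_INR; lra.
  have eb1 : 1 <= exp (beta * l) by rewrite -exp_0; apply: exp_le; nra.
  have ebb : exp (beta1 * l) = exp (beta * l) * (exp (gap / 4 * l) * exp (gap / 4 * l)).
  { rewrite -!exp_plus; congr exp; rewrite /beta1; field. }
  have eg1 : q0 + 1 <= exp (gap / 4 * l) by lra.
  have tau2 : exp (beta * l) + q0 <= INR tau.
  { apply: Rle_trans (proj1 tau1); rewrite ebb.
    have h : q0 + 1 <= exp (gap / 4 * l) * exp (gap / 4 * l) by nra.
    have := Rmult_le_compat_l _ _ _ (Rle_trans _ _ _ Rle_0_1 eb1) h; nra. }
  have T0 : 0 < T by exact: exp_pos.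
  have [J0 [J01 J02]] := nfloor_ex (T / 2) ltac:(lra).
  pose J := J0.+1.
  have J1 : T / 2 <= INR J <= T / 2 + 1 by rewrite /J S_INR; lra.
  have JT : INR J + q0 <= T by lra.
  have X0 : 0 < X / 2500.
  { have := small (exp (beta * l)) ltac:(split; [lra | apply: exp_le; rewrite /gap in gap0; nra]).
    have := Cmod_ge_0 (zeta (1/2, exp (beta * l))); lra. }
  have Xbig : 2500 < X.
  { have := small (exp (beta * l)) ltac:(split; [lra | apply: exp_le; rewrite /gap in gap0; nra]).
    have := Cmod_ge_0 (zeta (1/2, exp (beta * l))); lra. }
  (* [tau] exceeds T^beta by the averaging width q0, and J + q0 <= T, so every point used in the
     average at t lies in the range of the assumption, up to sign. *)
  have zsmall t : INR tau <= Rabs t -> Rabs t <= INR J ->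
    forall u, Rabs (u - t) <= INR k.+1 * a -> Cmod (zeta (1/2, u)) <= X / 2500.
  { move=> h1 h2 u hu.
    have hu' : exp (beta * l) <= Rabs u <= T.
    { have t1 := Rabs_triang (u - t) t. have t2 := Rabs_triang (t - u) u.
      rewrite (Rabs_minus_sym t u) in t2.
      have e1 : u - t + t = u by ring. have e2 : t - u + u = t by ring.
      rewrite e1 in t1; rewrite e2 in t2; lra. }
    have -> : Cmod (zeta (1/2, u)) = Cmod (zeta (1/2, Rabs u)).
    { rewrite /Rabs; case: Rcase_abs => // _; by rewrite zeta_conj Cmod_conj. }
    have := small _ hu'; lra. }
  (* Each component is at most X/2500 + 6 + 8 + 1: truncation, pole at v = 0, decay of the averaged
     pole. The number 19 leaves room, and the final inequality X <= 1 + 32 Z contradicts X >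
     2500. *)
  set Z := 2 * (X / 2500 + 19).
  have hZ j j' : (j < J)%N -> (j' < J)%N -> ~~ ((j < j' + tau)%N && (j' < j + tau)%N) ->
    Cmod (dpoly N (fun m => g m / sqrt (INR m)) (INR j - INR j')) <= Z.
  { move=> hj hj' far.
    set t := INR j - INR j'.
    have tJ : Rabs t <= INR J.
    { have := lt_INR j J ltac:(lia). have := lt_INR j' J ltac:(lia).
      have := pos_INR j. have := pos_INR j'. move=> *; apply: Rabs_le; rewrite /t; lra. }
    have tT : INR tau <= Rabs t.
    { have [h|h] : (j' + tau <= j)%N \/ (j + tau <= j')%N by lia.
      - have := le_INR (j' + tau) j ltac:(lia); rewrite plus_INR => h'.
        apply: Rle_trans (Rle_abs _); rewrite /t; lra.
      - have := le_INR (j + tau) j' ltac:(lia); rewrite plus_INR => h'.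
        rewrite -Rabs_Ropp; apply: Rle_trans (Rle_abs _); rewrite /t; lra. }
    have tau0' : 0 < INR tau by lra.
    have tn0 : t <> 0 by move=> h; rewrite h Rabs_R0 in tT; lra.
    have comp phi : phi = 0 \/ phi = PI / 2 -> Rabs (smoothed a k.+1 N phi t) <= X / 2500 + 19.
    { move=> hphi.
      apply: Rle_trans (smoothed_bound a BB (X / 2500) t phi k N Npos (Rlt_le _ _ a0)
        ltac:(rewrite -/V; lra) tn0 hphi decay (zsmall t tT tJ)) _.
      have sN : T <= sqrt (INR N).
      { rewrite -(sqrt_pow2 T); last lra. apply: sqrt_le_1_alt; lra. }
      have b1 : (2 + 4 * (Rabs t + INR k.+1 * a)) / sqrt (INR N) <= 6.
      { apply/Rle_div_l; first lra. nra. }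
      have b2 : 2 * BB * (1 + INR k.+1) / Rabs t <= 1.
      { apply/Rle_div_l; first lra. rewrite Rmult_1_l; apply: Rle_trans tT.
        apply: Rle_trans (proj1 tau1).
        have hA1 : 2 * BB * (1 + INR k.+1) <=
          2 * (exp eps * exp (2 * eps * l)) * (1 + q0 * (2 * l + 1)).
        { apply: Rmult_le_compat; try lra.
          - by have := pos_INR k.+1; lra.
          - nra. }
        apply: Rle_trans hA1 _.
        have -> : 2 * eps * l = gap / 4 * l by rewrite /eps; field.
        rewrite ebb.
        have ex := exp_pos eps.
        set E := exp (gap / 4 * l) in hc eg1 *.
        have hA2 : 2 * exp eps * (1 + q0 * (2 * l + 1)) <= E by nra.
        have -> : 2 * (exp eps * E) * (1 + q0 * (2 * l + 1)) =
          E * (2 * exp eps * (1 + q0 * (2 * l + 1))) by ring.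
        apply: Rle_trans (_ : 1 * (E * E) <= _); first by nra.
        apply: Rmult_le_compat_r; nra. }
      lra. }
    rewrite /g dpoly_smoothed; apply: Rle_trans (Cmod_le_components _) _.
    have := comp 0 (or_introl erefl). have := comp (PI / 2) (or_intror erefl).
    rewrite /Z /=; lra. }
  set gmin := exp (- (q0 * Lam ^ 2 / l)).
  have hK K : block_family B n P r K ->
    (block_prod B n K <= N)%N /\ gmin <= g (block_prod B n K).
  { move=> hf.
    have bp : (0 < block_prod B n K)%N.
    { apply: block_prod_gt0 => j p pj.
      by move/familyP: hf => /(_ j) /andP[/subsetP h _]; exact: prime_gt0 (hP j p (h p pj)). }
    have hL := hLam K hf.
    have bp1 := INR_gt0 _ bp.
    have le : (block_prod B n K <= N)%N.
    { apply/leP; apply: INR_le; apply: Rnot_lt_le => h.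
      have := ln_increasing _ _ N1 h; rewrite -/V; lra. }
    split=> //.
    set v := ln (INR (block_prod B n K)) in hL *.
    have hv : 0 <= v <= V by apply: lnV; lia.
    have hav := av1 v hv.
    have [hc1 _] := cos_taylor (a * v) ltac:(rewrite Rabs_pos_eq; lra).
    have h1 : exp (- (a * v) ^ 2) <= cos (a * v).
    { apply: Rle_trans hc1.
      have -> : - (a * v) ^ 2 = - (2 * ((a * v) ^ 2 / 2)) by field.
      apply: one_sub_ge_exp; nra. }
    rewrite /g -/v; apply: Rle_trans (_ : exp (- (a * v) ^ 2) ^ k.+1 <= _); last first.
    { apply: pow_incr; split=> //; exact/Rlt_le/exp_pos. }
    rewrite exp_pow_nat; apply: exp_le.
    have h2 : INR k.+1 * (a * v) ^ 2 <= q0 * Lam ^ 2 / l.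
    { have -> : INR k.+1 * (a * v) ^ 2 = (INR k.+1 * a) * (a * v ^ 2) by ring.
      have -> : q0 * Lam ^ 2 / l = q0 * (/ l * Lam ^ 2) by field; lra.
      have a1 : a <= / l by rewrite /a; apply: Rinv_le_contravar; lra.
      have il : 0 < / l by apply: Rinv_0_lt_compat; lra.
      apply: Rmult_le_compat => //.
      - by apply: Rmult_le_pos; [exact: pos_INR | lra].
      - nra.
      - apply: Rmult_le_compat; try lra; first exact: pow2_ge_0.
        apply: pow_incr; lra. }
    lra. }
  have V1 : 0 <= 1 + V by lra.
  have R := block_resonance B n N J tau P w r eta s gmin A0 Z g hP dP he e0 hs rw hr hK
    (Rlt_le _ _ (exp_pos _)) g0 isT ltac:(rewrite /A0; nra) ltac:(rewrite /Z; lra) hA hZ.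
  rewrite -/G in R.
  set cost := sqrt _ in hcost R.
  have main : 2 * INR tau * A0 * cost <= INR J / 4.
  { apply: Rle_trans (_ : T / 8 <= _); last lra.
    have c0 : 0 <= cost by exact: sqrt_pos.
    have tt : INR tau <= 2 * exp (beta1 * l).
    { have : 1 <= exp (beta1 * l); last by lra.
      rewrite -exp_0; apply: exp_le; rewrite /beta1; nra. }
    have hA0 : A0 <= exp eps * exp (2 * eps * l) * (2 * l + 2).
    { rewrite /A0; apply: Rmult_le_compat; lra. }
    have A00 : 0 <= A0 by rewrite /A0; nra.
    have h1 : 2 * INR tau * A0 * cost <=
      2 * (2 * exp (beta1 * l)) * (exp eps * exp (2 * eps * l) * (2 * l + 2)) * exp (kappa * l).
    { apply: Rmult_le_compat => //; last first.
      - by apply: Rmult_le_compat => //; lra.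
      - by apply: Rmult_le_pos => //; lra. }
    apply: Rle_trans h1 _.
    have -> : T = exp (beta1 * l) * exp (2 * eps * l) * exp (kappa * l) * exp (gap / 4 * l).
    { rewrite /T -!exp_plus; congr exp; rewrite /beta1 /eps /gap; field. }
    set E1 := exp (beta1 * l); set E2 := exp (2 * eps * l); set E3 := exp (kappa * l).
    set E4 := exp (gap / 4 * l) in hd *.
    have E0 : 0 <= E1 * E2 * E3.
    { by apply/Rlt_le/Rmult_lt_0_compat; [apply: Rmult_lt_0_compat |]; exact: exp_pos. }
    have -> : 2 * (2 * E1) * (exp eps * E2 * (2 * l + 2)) * E3 =
      (E1 * E2 * E3) * (4 * exp eps * (2 * l + 2)) by ring.
    have -> : E1 * E2 * E3 * E4 / 8 = E1 * E2 * E3 * (E4 / 8) by field.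
    apply: Rmult_le_compat_l => //; lra. }
  have Jp : 0 < INR J by lra.
  have XX : gmin * G = X by [].
  have fin : INR J * X <= INR J * (1 + 32 * Z).
  { have -> : INR J * X = 4 * (INR J / 4 * gmin * G) by rewrite -XX; field. lra. }
  have {}fin := Rmult_le_reg_l _ _ _ Jp fin.
  rewrite /Z in fin; lra.
Qed.

(** * Blocks of primes *)

Lemma ln_fact_le_stirling (n : nat) : (0 < n)%N ->
  ln (INR n`!) <= INR n * ln (INR n) - INR n + 1 + ln (INR n).
Proof.
  case: n => [|n] // _; elim: n => [|n IH].
  - rewrite factS fact0 muln1 INR_1 ln_1; lra.
  - have h1 := INR_gt0 n.+1 isT. have h2 := INR_gt0 n.+2 isT.
    rewrite factS -multE mult_INR ln_mult //; last by apply: INR_gt0; exact: fact_gt0.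
    have h : 1 <= INR n.+2 * (ln (INR n.+2) - ln (INR n.+1)).
    { have := ln_le_sub1 (INR n.+1 / INR n.+2) (Rdiv_lt_0_compat _ _ h1 h2).
      rewrite ln_div //.
      have -> : INR n.+1 / INR n.+2 - 1 = - / INR n.+2.
      { rewrite (S_INR n.+1); field; rewrite S_INR in h2; lra. }
      move=> h; have -> : 1 = INR n.+2 * / INR n.+2 by field; lra.
      apply: Rmult_le_compat_l; lra. }
    set a := ln (INR n.+2) in h *; set b := ln (INR n.+1) in h IH *.
    rewrite (S_INR n.+1) in h h2 *; lra.
Qed.

Lemma pow_self_div_fact_ge (n : nat) : (0 < n)%N ->
  exp (INR n - 1 - ln (INR n)) <= INR n ^ n / INR n`!.
Proof.
  move=> n0; have h := INR_gt0 n n0.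
  have f : 0 < INR n`! by apply: INR_gt0; exact: fact_gt0.
  have -> : INR n ^ n / INR n`! = exp (INR n * ln (INR n) - ln (INR n`!)).
  { rewrite /Rminus exp_plus exp_Ropp !exp_ln // -exp_pow_nat exp_ln //. }
  apply: exp_le; have := ln_fact_le_stirling n n0; lra.
Qed.

(** M^v/v! increases with v up to M, so a single bound at w serves both resonators, which draw w and
    w - r primes from the block. *)
Lemma bin_le_pow_fact (m M v w : nat) : (m <= M)%N -> (v <= w)%N -> (w <= M)%N ->
  INR 'C(m, v) <= INR M ^ w / INR w`!.
Proof.
  move=> mM vw wM.
  have f0 n : 0 < INR n`! by apply: INR_gt0; exact: fact_gt0.
  apply: Rle_trans (_ : INR M ^ v / INR v`! <= _).
  - apply/Rle_div_r; first exact: f0.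
    rewrite -mult_INR multE bin_ffact ffact_prod INR_prod -prodR_const.
    apply: prodR_le => i _; split; [exact: pos_INR | apply: le_INR; lia].
  - elim: w vw wM => [|w IH] vw wM; first by move: vw; rewrite leqn0 => /eqP ->; lra.
    have [->|h] : v = w.+1 \/ (v <= w)%N by lia.
    { exact: Rle_refl. }
    apply: Rle_trans (IH h ltac:(lia)) _.
    have w1 := INR_gt0 w.+1 isT. have fw := f0 w.
    have -> : INR M ^ w.+1 / INR w.+1`! = INR M ^ w / INR w`! * (INR M / INR w.+1).
    { rewrite factS -multE mult_INR /=; field; lra. }
    rewrite -[X in X <= _]Rmult_1_r; apply: Rmult_le_compat_l.
    + apply: Rmult_le_pos; first by apply: pow_le; exact: pos_INR.
      exact/Rlt_le/Rinv_0_lt_compat.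
    + apply/Rle_div_r => //; rewrite Rmult_1_l; apply: le_INR; lia.
Qed.

Lemma bin_le_exp (m M v w : nat) : (m <= M)%N -> (v <= w)%N -> (0 < w <= M)%N ->
  INR 'C(m, v) <= exp (INR w * (1 + ln (INR M) - ln (INR w))).
Proof.
  move=> mM vw /andP[w0 wM].
  apply: Rle_trans (bin_le_pow_fact m M v w mM vw wM) _.
  have f : 0 < INR w`! by apply: INR_gt0; exact: fact_gt0.
  have M0 : 0 < INR M by apply: INR_gt0; lia.
  have -> : INR M ^ w / INR w`! = exp (INR w * ln (INR M) - ln (INR w`!)).
  { rewrite /Rminus exp_plus exp_Ropp !exp_ln // -exp_pow_nat exp_ln //. }
  apply: exp_le; have := ln_fact_ge w; lra.
Qed.

Lemma sum_inv_ge (n : nat) : ln (INR n.+1) <= \sum_(j < n) / INR j.+1.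
Proof.
  elim: n => [|n IH]; first by rewrite big_ord0 INR_1 ln_1; apply: Rle_refl.
  rewrite big_ord_recr; apply: Rle_trans (Rplus_le_compat_r _ _ _ IH) => /=.
  have h1 := INR_gt0 n.+1 isT. have h2 := INR_gt0 n.+2 isT.
  have : ln (INR n.+2) - ln (INR n.+1) <= / INR n.+1.
  { rewrite -ln_div //; apply: Rle_trans (ln_le_sub1 _ _) _; first exact: Rdiv_lt_0_compat.
    rewrite (S_INR n.+1); apply: Req_le; field; lra. }
  lra.
Qed.

Lemma sum_inv_le (n : nat) : (0 < n)%N -> \sum_(j < n) / INR j.+1 <= 1 + ln (INR n).
Proof. by move=> n0; have := harmonic_le n n0; rewrite big_add1 big_mkord. Qed.

Lemma sum_inv_sq_le (n : nat) : \sum_(j < n) / INR j.+1 ^ 2 <= 2.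
Proof.
  case: n => [|n]; first by rewrite big_ord0; apply: Rlt_le; lra.
  suff : \sum_(j < n.+1) / INR j.+1 ^ 2 <= 2 - / INR n.+1.
  { have := Rinv_0_lt_compat _ (INR_gt0 n.+1 isT); lra. }
  elim: n => [|n IH]; first by rewrite big_ord_recr big_ord0 /= INR_1; lra.
  rewrite big_ord_recr; apply: Rle_trans (Rplus_le_compat_r _ _ _ IH) _ => /=.
  have h1 := INR_gt0 n.+1 isT.
  rewrite !Rmult_1_r (S_INR n.+1); set y := INR n.+1 in h1 *.
  have : / ((y + 1) * (y + 1)) <= / (y * (y + 1)) by apply: Rinv_le_contravar; nra.
  have -> : / (y * (y + 1)) = / y - / (y + 1) by field; lra. lra.
Qed.

Definition prime_block (B a b : nat) : {set 'I_B} := [set p : 'I_B | prime p && (a < p <= b)%N].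

Lemma prime_block_sum (B a b q : nat) (Lmax : R) : (0 < a)%N -> (a <= b)%N -> (b < B)%N ->
  (1 < q)%N -> ln (INR a) + ln (INR q) <= INR q - 1 -> 0 < Lmax -> ln (INR b) <= Lmax ->
  (ln (INR b) - ln (INR a) - ln (INR q) - 10) / Lmax <= \sum_(p in prime_block B a b) / INR p.
Proof.
  move=> a0 ab bB q1 hq L0 hL.
  have W := mertens_window a b q a0 ab q1 hq.
  apply/Rle_div_l => //; apply: Rle_trans W _; rewrite sumR_mulr.
  rewrite (big_nat_widen _ _ B) // big_geq_mkord.
  rewrite (eq_bigl (fun p : 'I_B => p \in prime_block B a b)); last first.
  { by move=> p; rewrite inE /=; case: (prime p) => //=; lia. }
  apply: sumR_le => p; rewrite inE => /andP[pp /andP[pa pb]].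
  have p0 := INR_gt0 p (prime_gt0 pp).
  rewrite /Rdiv Rmult_comm; apply: Rmult_le_compat_l; first exact/Rlt_le/Rinv_0_lt_compat.
  apply: Rle_trans hL; apply: ln_le => //; apply: le_INR; lia.
Qed.

(** Counting all integers up to b is accurate enough, because only the logarithm of the size of a
    block enters the cost. *)
Lemma prime_block_card (B a b : nat) : (#|prime_block B a b| <= b)%N.
Proof.
  rewrite cardE -(size_map val) -{2}(size_iota 1 b); apply: uniq_leq_size.
  - by rewrite map_inj_uniq ?enum_uniq //; exact: val_inj.
  - move=> x /mapP[p]; rewrite mem_enum inE => /andP[_ h] ->.
    by rewrite mem_iota /=; lia.
Qed.

Lemma ln_le_half (x : R) : 0 < x -> ln x <= x / 2.
Proof.
  move=> x0; have s0 := sqrt_lt_R0 x x0.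
  have e : sqrt x * sqrt x = x by apply: sqrt_sqrt; lra.
  rewrite -{1}e ln_mult //; have := ln_le_sub1 (sqrt x) s0.
  have := pow2_ge_0 (sqrt x - 2); nra.
Qed.

Lemma le_div_of_mul (a b c : R) : 0 < c -> a * c <= b -> a <= b / c.
Proof. by move=> c0 h; apply/Rle_div_r. Qed.

Lemma div_le_of_le_mul (a b c : R) : 0 < c -> a <= b * c -> a / c <= b.
Proof. by move=> c0 h; apply/Rle_div_l. Qed.

(* [z], [x = e^z] and [L = e^x] stand for logloglog T, loglog T and log T. *)
Lemma blocks_exist (dl c1 kappa z x L rho : R) :
  0 < dl <= 1 / 4 -> 0 < c1 -> x = exp z -> L = exp x -> 0 < rho ->
  rho ^ 2 * (x * z) = c1 ^ 2 * L ->
  1 <= z -> z + 14 <= dl ^ 2 * z ^ 2 -> 2 * z ^ 3 <= exp (dl * z) ->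
  z ^ 2 + 2 <= dl * x / 2 -> 4 <= dl * z -> 2 * x <= rho -> 2 * z ^ 2 <= dl * rho ->
  x * (2 + ln rho) <= dl * rho * z -> (1 + dl) * c1 ^ 2 <= (1 - dl) * z ^ 3 ->
  ln ((1 - dl) * z ^ 3 / c1 ^ 2) + 4 <= z ^ 2 ->
  (z ^ 2 + 3) * (1 + z) + 4 * (z ^ 2 + 1) <= (1 + dl) * z ^ 3 ->
  (1 + dl) ^ 2 * c1 ^ 2 <= kappa * (1 - dl) ->
  exists (B n : nat) (P : 'I_n -> {set 'I_B}) (w r : 'I_n -> nat) (eta : 'I_n -> R) (s : R),
  [/\ (forall j (q : 'I_B), q \in P j -> prime q) /\
      (forall i j (q : 'I_B), q \in P i -> q \in P j -> i = j),
      (forall j (q : 'I_B), q \in P j -> / INR q <= eta j) /\ (forall j, 0 <= eta j),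
      (forall j, 0 < s <= \sum_(p in P j) / INR p - INR (w j) * eta j) /\
      (forall j, (r j <= w j)%N) /\ (forall j, INR (r j) ^ 2 <= INR (w j - r j) * s),
      (forall K, block_family B n P r K -> ln (INR (block_prod B n K)) <= 3 * rho * z * x) /\
      sqrt ((\prod_j INR 'C(#|P j|, w j)) * \prod_j INR 'C(#|P j|, w j - r j))
        <= exp (kappa * L) &
      exp ((1 - 2 * dl) * rho * z) <= \prod_j (INR (r j) ^ r j / INR (r j)`!)].
Proof.
  move=> hdl c0 ex eL r0 hrho z1 hz2 hz3 hx hz4 hrx hrz hrl hcz hlnz hz5 hk.
  have x0 : 0 < x by rewrite ex; exact: exp_pos.
  have L0 : 0 < L by rewrite eL; exact: exp_pos.
  have xz : z + 1 <= x by rewrite ex; have := exp_ineq1_le z; lra.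
  have Lx : x + 1 <= L by rewrite eL; have := exp_ineq1_le x; lra.
  have lnx : ln x = z by rewrite ex ln_exp.
  have lnL : ln L = x by rewrite eL ln_exp.
  have z16 : 16 <= z.
  { have := Rmult_le_compat_r z dl (1 / 4) ltac:(lra) ltac:(lra); lra. }
  have z2 : 256 <= z ^ 2 by clear -z16; nra.
  have dlx : dl * x <= x / 4.
  { have := Rmult_le_compat_r x dl (1 / 4) ltac:(lra) ltac:(lra); lra. }
  have z3 : 0 < z ^ 3 by apply: pow_lt; lra.
  (* Ratio of consecutive blocks. Its logarithm z^2 must dominate the Mertens error, which is of
     order z. *)
  have [E0 [E01 E02]] := nfloor_ex (exp (z ^ 2)) (Rlt_le _ _ (exp_pos _)).
  pose E := E0.+1.
  have eE : exp (z ^ 2) <= INR E <= exp (z ^ 2) + 1 by rewrite /E S_INR; lra.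
  pose H := ln (INR E).
  have E1 : 0 < INR E by exact: INR_gt0.
  have hH : z ^ 2 <= H <= z ^ 2 + 1.
  { split; first by rewrite -(ln_exp (z ^ 2)); apply: ln_le; [exact: exp_pos | lra].
    rewrite -(ln_exp (z ^ 2 + 1)); apply: ln_le => //; rewrite exp_plus.
    have h1 := exp_ineq1_le 1.
    have h2 : 1 <= exp (z ^ 2) by rewrite -exp_0; apply: exp_le; lra.
    case: eE => _ h3; clear -h1 h2 h3; nra. }
  have [Y1 [Y11 Y12]] := nfloor_ex L (Rlt_le _ _ L0).
  pose Y0 := Y1.+1.
  have eY : L <= INR Y0 <= L + 1 by rewrite /Y0 S_INR; lra.
  have Y0p : 0 < INR Y0 by lra.
  have lnY : x <= ln (INR Y0) <= x + 1.
  { split; first by rewrite -lnL; apply: ln_le; lra.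
    rewrite -(ln_exp (x + 1)); apply: ln_le => //; rewrite exp_plus -eL.
    have h1 := exp_ineq1_le 1; case: eY => _ h3; clear -h1 h3 Lx x0; nra. }
  have xz3 : 0 <= x / z ^ 3 by apply: Rmult_le_pos; [lra | apply/Rlt_le/Rinv_0_lt_compat].
  (* n blocks of logarithmic length z^2 extend the logarithms of the primes from x by only about
     x/z, so all stay below (1 + dl) x, while ln n is still at least (1 - dl) z. *)
  have [n [n1 n2]] := nfloor_ex (x / z ^ 3) xz3.
  have ndl : exp ((1 - dl) * z) <= INR n.
  { have h : 2 * exp ((1 - dl) * z) <= x / z ^ 3.
    { have e : x = exp ((1 - dl) * z) * exp (dl * z) by rewrite ex -exp_plus; congr exp; ring.
      apply: le_div_of_mul => //; rewrite e.
      have := Rmult_le_compat_l _ _ _ (Rlt_le _ _ (exp_pos ((1 - dl) * z))) hz3; lra. }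
    have : 1 <= exp ((1 - dl) * z).
    { have := exp_ineq1_le ((1 - dl) * z).
      have : 0 <= (1 - dl) * z by apply: Rmult_le_pos; lra.
      lra. }
    lra. }
  have n0 : (0 < n)%N.
  { apply/ltP; apply: INR_lt; rewrite INR_0; have := exp_pos ((1 - dl) * z); lra. }
  have np := INR_gt0 n n0.
  have lnn : (1 - dl) * z <= ln (INR n).
  { rewrite -(ln_exp ((1 - dl) * z)); apply: ln_le => //; exact: exp_pos. }
  have nx3 : INR n * z ^ 3 <= x.
  { have -> : x = x / z ^ 3 * z ^ 3 by field; lra. apply: Rmult_le_compat_r; lra. }
  have nx : INR n <= x.
  { have h : 1 <= z ^ 3 by exact: pow_R1_Rle.
    clear -nx3 np h; nra. }
  have lnn2 : ln (INR n) <= z by rewrite -lnx; apply: ln_le.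
  pose Y i := (Y0 * E ^ i)%N.
  have lnYi i : ln (INR (Y i)) = ln (INR Y0) + INR i * H.
  { rewrite /Y -multE mult_INR; elim: i => [|i IH].
    - rewrite expn0 INR_1 Rmult_1_r INR_0; ring.
    - have ei : 0 < INR (E ^ i) by apply: INR_gt0; rewrite expn_gt0.
      rewrite expnS -multE mult_INR.
      have -> : INR Y0 * (INR E * INR (E ^ i)) = INR E * (INR Y0 * INR (E ^ i)) by ring.
      rewrite ln_mult // ?IH; last exact: Rmult_lt_0_compat.
      rewrite S_INR -/H; ring. }
  have Ypos i : (0 < Y i)%N by rewrite /Y muln_gt0 expn_gt0.
  have Ymono i j : (i <= j)%N -> (Y i <= Y j)%N.
  { by move=> ij; rewrite /Y leq_mul2l leq_pexp2l // orbT. }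
  pose Lmax := (1 + dl) * x.
  have Lmax0 : 0 < Lmax by apply: Rmult_lt_0_compat; lra.
  have hLmax i : (i <= n.+1)%N -> ln (INR (Y i)) <= Lmax.
  { move=> hi; rewrite lnYi.
    have i1 : INR i <= INR n + 1 by rewrite -S_INR; apply: le_INR; lia.
    have i0 := pos_INR i.
    have : INR i * H <= (INR n + 1) * (z ^ 2 + 1) by apply: Rmult_le_compat; lra.
    have h2 : INR n * z ^ 2 <= dl * x / 4.
    { have : INR n * z ^ 2 * 4 <= INR n * z ^ 2 * (dl * z).
      { apply: Rmult_le_compat_l => //; apply: Rmult_le_pos; lra. }
      have : INR n * z ^ 2 * (dl * z) <= dl * x.
      { have -> : INR n * z ^ 2 * (dl * z) = dl * (INR n * z ^ 3) by ring.
        apply: Rmult_le_compat_l; lra. }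
      lra. }
    have h3 : INR n <= dl * x / 4 by clear -h2 z2 np; nra.
    rewrite /Lmax; lra. }
  (* Large enough for [mertens_window]: the endpoints have logarithm at most 5x/4, and ln q <=
     q/2. *)
  have [q1 [q11 q12]] := nfloor_ex (4 * x) ltac:(lra).
  pose q := q1.+1.
  have eq : 4 * x <= INR q <= 4 * x + 1 by rewrite /q S_INR; lra.
  have qp : 0 < INR q by lra.
  have lnq : ln (INR q) <= z + 2.
  { rewrite -(ln_exp (z + 2)); apply: ln_le => //; rewrite exp_plus -ex.
    have h4 : 5 <= exp 2.
    { have -> : 2 = (1 / 2 + 1 / 2) + (1 / 2 + 1 / 2) by field.
      rewrite !exp_plus; have := exp_ineq1_le (1 / 2); move: (exp (1 / 2)) => y h.
      have h' : 9 / 4 <= y * y by clear -h; nra.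
      clear -h'; nra. }
    clear -h4 eq xz z1; nra. }
  have lnq2 := ln_le_half _ qp.
  (* The reciprocals of the primes of a block sum to about z^2/x. The factor 1 - dl covers the
     Mertens error, the bound (1 + dl) x on the logarithms, and the primes already used. *)
  pose s := (1 - dl) * z ^ 2 / x.
  have s0 : 0 < s by apply: Rdiv_lt_0_compat => //; apply: Rmult_lt_0_compat; lra.
  pose i_ (j : 'I_n) := INR j.+1.
  have i1 j : 1 <= i_ j by exact: INR_ge1.
  have in_ j : i_ j <= INR n by apply: le_INR; have := ltn_ord j; lia.
  have rq j : 0 <= rho / i_ j by apply: Rmult_le_pos; [lra | apply/Rlt_le/Rinv_0_lt_compat; have := i1 j; lra].
  have [r hr] := fin_all_exists (fun j => match nfloor_ex _ (rq j) with exist m Hm => ex_intro _ m Hm end).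
  have r2 j : rho / i_ j <= INR (r j) + 1 /\ INR (r j) <= rho / i_ j by have := hr j; lra.
  have rhalf j : rho / (2 * i_ j) <= INR (r j) /\ 1 <= INR (r j).
  { have [h1 _] := r2 j. have h2 := i1 j. have h3 := in_ j.
    have h : 2 <= rho / i_ j by apply: le_div_of_mul; lra.
    have -> : rho / (2 * i_ j) = rho / i_ j / 2 by field; lra.
    split; lra. }
  have sq j : 0 <= INR (r j) ^ 2 / s.
  { apply: Rmult_le_pos; [exact: pow2_ge_0 | exact/Rlt_le/Rinv_0_lt_compat]. }
  have [d hd] := fin_all_exists (fun j => match nfloor_ex _ (sq j) with exist m Hm => ex_intro _ m Hm end).
  (* Here r_j is the integer part of rho/(j+1), and w_j - r_j is the integer part of r_j^2/s plus 1,
     essentially the least value allowed by r_j^2 <= (w_j - r_j) s. *)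
  pose w j := (r j + (d j).+1)%N.
  have wr j : INR (w j - r j) = INR (d j) + 1.
  { by rewrite /w addKn S_INR. }
  have wE j : INR (w j) = INR (r j) + INR (d j) + 1.
  { rewrite /w -plusE plus_INR S_INR; ring. }
  (* w_j has size about D/(j+1)^2, and the relation between rho and L makes D a constant times
     L/z^3. *)
  pose D := rho ^ 2 / s.
  have DE : D * ((1 - dl) * z ^ 3) = c1 ^ 2 * L.
  { rewrite -hrho /D /s; field; repeat split; lra. }
  have D0 : 0 < D by apply: Rdiv_lt_0_compat => //; exact: pow_lt.
  have wup j : INR (w j) <= (1 + dl) * (D / i_ j ^ 2).
  { have h1 := i1 j. have h2 := in_ j. have [_ h3] := r2 j. have [_ h4] := hd j.
    have [h5 h6] := rhalf j.
    have [h7 _] := hd j.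
    have rsq : INR (r j) ^ 2 / s <= D / i_ j ^ 2.
    { have -> : D / i_ j ^ 2 = (rho / i_ j) ^ 2 / s by rewrite /D; field; lra.
      apply: Rmult_le_compat_r; first exact/Rlt_le/Rinv_0_lt_compat.
      apply: pow_incr; split; [exact: pos_INR | lra]. }
    have ns : INR n * s <= z ^ 2.
    { rewrite /s; have -> : INR n * ((1 - dl) * z ^ 2 / x) = (INR n / x) * ((1 - dl) * z ^ 2) by field; lra.
      have hn1 : INR n / x <= 1 by apply: div_le_of_le_mul; lra.
      have hn2 : 0 <= INR n / x by apply: Rmult_le_pos; [lra | exact/Rlt_le/Rinv_0_lt_compat].
      have u0 : 0 <= (1 - dl) * z ^ 2 <= z ^ 2 by clear -hdl z2; nra.
      clear -hn1 hn2 u0; nra. }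
    have key : rho / i_ j + 1 <= dl * (D / i_ j ^ 2).
    { apply: Rle_trans (_ : 2 * (rho / i_ j) <= _).
      { have : 1 <= rho / i_ j by apply: le_div_of_mul; lra. lra. }
      have -> : dl * (D / i_ j ^ 2) = (rho / i_ j) * (dl * rho / (s * i_ j)) by rewrite /D; field; lra.
      rewrite Rmult_comm; apply: Rmult_le_compat_l => //.
      apply: le_div_of_mul; first by apply: Rmult_lt_0_compat; lra.
      have := Rmult_le_compat_l s _ _ (Rlt_le _ _ s0) h2; lra. }
    rewrite wE; lra. }
  have wlow j : D / (4 * i_ j ^ 2) <= INR (w j).
  { have h1 := i1 j. have [h5 _] := rhalf j. have [_ h4] := hd j.
    have h6 : D / (4 * i_ j ^ 2) <= INR (r j) ^ 2 / s.
    { have -> : D / (4 * i_ j ^ 2) = (rho / (2 * i_ j)) ^ 2 / s by rewrite /D; field; lra.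
      apply: Rmult_le_compat_r; first exact/Rlt_le/Rinv_0_lt_compat.
      apply: pow_incr; split=> //; apply/Rlt_le/Rdiv_lt_0_compat; lra. }
    rewrite wE; have := pos_INR (r j); lra. }
  have wL j : INR (w j) <= L.
  { apply: Rle_trans (wup j) _; have h1 := i1 j.
    have i2 : 1 <= i_ j ^ 2 by exact: pow_R1_Rle.
    have hD : D / i_ j ^ 2 <= D.
    { apply: div_le_of_le_mul; first lra.
      have := Rmult_le_compat_l D _ _ (Rlt_le _ _ D0) i2; lra. }
    have h2 : (1 + dl) * D <= L.
    { apply: (Rmult_le_reg_r ((1 - dl) * z ^ 3)); first by apply: Rmult_lt_0_compat; lra.
      have -> : (1 + dl) * D * ((1 - dl) * z ^ 3) = (1 + dl) * (D * ((1 - dl) * z ^ 3)) by ring.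
      rewrite DE; have := Rmult_le_compat_r L _ _ (Rlt_le _ _ L0) hcz; lra. }
    apply: Rle_trans h2; apply: Rmult_le_compat_l; lra. }
  have wY j : (0 < w j <= Y0)%N.
  { apply/andP; split; first by rewrite /w; lia.
    apply/leP; apply: INR_le; have := wL j; lra. }
  pose B := (Y n.+1).+1.
  (* The blocks start at Y 1 = Y0 E instead of Y 0. As w_j <= L <= Y0, the primes already used then
     remove at most w_j/(Y0 E) <= 1/E <= 1/x from a block sum. *)
  pose P (j : 'I_n) := prime_block B (Y j.+1) (Y j.+2).
  pose eta (_ : 'I_n) := / (INR Y0 * INR E).
  exists B, n, P, w, r, eta, s.
  have eta0 j : 0 < eta j by apply/Rinv_0_lt_compat/Rmult_lt_0_compat.
  split.
  - split.
    + by move=> j p; rewrite inE => /andP[].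
    + move=> i j p; rewrite !inE => /andP[_ /andP[hi1 hi2]] /andP[_ /andP[hj1 hj2]].
      apply: val_inj => /=; apply/eqP; rewrite eqn_leq; apply/andP; split; rewrite leqNgt;
        apply/negP => h; [have := Ymono j.+2 i.+1 h | have := Ymono i.+2 j.+1 h]; lia.
  - split; last by move=> j; apply: Rlt_le.
    move=> j p; rewrite inE => /andP[pp /andP[h _]].
    apply: Rinv_le_contravar; first exact: Rmult_lt_0_compat.
    rewrite -mult_INR; apply: le_INR; apply/leP.
    have e1 : Y 1%N = (Y0 * E)%N by rewrite /Y expn1.
    by rewrite multE -e1; apply: leq_trans (Ymono 1%N j.+1 isT) (ltnW h).
  - split; last split.
    + move=> j; split=> //.
      have jn := ltn_ord j.
      have hB : (Y j.+2 < B)%N by rewrite /B ltnS; apply: Ymono; lia.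
      have hq1 : (1 < q)%N by apply/ltP; apply: INR_lt; rewrite INR_1; lra.
      have hq2 : ln (INR (Y j.+1)) + ln (INR q) <= INR q - 1.
      { have := hLmax j.+1 ltac:(lia); rewrite /Lmax; lra. }
      have W := prime_block_sum B (Y j.+1) (Y j.+2) q Lmax (Ypos _) (Ymono _ _ (leqnSn _))
        hB hq1 hq2 Lmax0 (hLmax j.+2 ltac:(lia)).
      have we : INR (w j) * eta j <= / x.
      { have -> : INR (w j) * eta j = (INR (w j) / INR Y0) * / INR E by rewrite /eta; field; lra.
        have h1 : INR (w j) / INR Y0 <= 1 by apply: div_le_of_le_mul => //; have := wL j; lra.
        have h2 : / INR E <= / x.
        { apply: Rinv_le_contravar => //; apply: Rle_trans (proj1 eE); rewrite ex.
          apply: exp_le; clear -z1; nra. }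
        have h3 : 0 < / INR E by exact: Rinv_0_lt_compat.
        have h4 : 0 <= INR (w j) / INR Y0.
        { apply: Rmult_le_pos; [exact: pos_INR | exact/Rlt_le/Rinv_0_lt_compat]. }
        clear -h1 h2 h3 h4; nra. }
      have W2 : (z ^ 2 - z - 12) / Lmax <= \sum_(p in P j) / INR p.
      { apply: Rle_trans W; apply: Rmult_le_compat_r; first exact/Rlt_le/Rinv_0_lt_compat.
        rewrite !lnYi (S_INR j.+1); lra. }
      have : s + / x <= (z ^ 2 - z - 12) / Lmax.
      { apply: le_div_of_mul => //; rewrite /s /Lmax.
        have -> : ((1 - dl) * z ^ 2 / x + / x) * ((1 + dl) * x) =
          ((1 - dl) * z ^ 2 + 1) * (1 + dl) by field; lra.
        lra. }
      lra.
    + by move=> j; rewrite /w; lia.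
    + move=> j; rewrite wr; have [_ h] := hd j.
      have -> : INR (r j) ^ 2 = INR (r j) ^ 2 / s * s by field; lra.
      apply: Rmult_le_compat_r; lra.
  - split.
    + move=> K /familyP hK.
      rewrite INR_block_prod ln_prod; last first.
      { move=> j _; apply: prodR_gt0 => p pK; apply: INR_gt0.
        case/andP: (hK j) => /subsetP h _; move: (h p pK); rewrite inE => /andP[/prime_gt0]. by []. }
      apply: Rle_trans (_ : \sum_(j < n) rho * Lmax * / INR j.+1 <= _).
      { apply: sumR_le => j _.
        case/andP: (hK j) => /subsetP h /eqP cK.
        rewrite ln_prod; last first.
        { move=> p pK; apply: INR_gt0; move: (h p pK); rewrite inE => /andP[/prime_gt0]. by []. }
        apply: Rle_trans (_ : \sum_(p in K j) Lmax <= _).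
        { apply: sumR_le => p pK; move: (h p pK); rewrite inE => /andP[pp /andP[_ hp]].
          apply: Rle_trans (hLmax j.+2 _); last by have := ltn_ord j; lia.
          apply: ln_le; [exact: INR_gt0 (prime_gt0 pp) | apply: le_INR; lia]. }
        have -> : \sum_(p in K j) Lmax = INR (r j) * Lmax.
        { rewrite -cK -sum1_card INR_sum sumR_mulr; apply: eq_bigr => p _; rewrite INR_1; ring. }
        have [_ h3] := r2 j. rewrite /i_ in h3.
        have -> : rho * Lmax * / INR j.+1 = rho / INR j.+1 * Lmax by rewrite /Rdiv; ring.
        apply: Rmult_le_compat_r; lra. }
      rewrite -sumR_mull.
      have S1 := sum_inv_le n n0.
      have RL : 0 <= rho * Lmax by apply: Rmult_le_pos; lra.
      apply: Rle_trans (Rmult_le_compat_l _ _ _ RL S1) _.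
      have -> : 3 * rho * z * x = rho * x * (3 * z) by ring.
      rewrite /Lmax; have -> : rho * ((1 + dl) * x) * (1 + ln (INR n)) =
        rho * x * ((1 + dl) * (1 + ln (INR n))) by ring.
      apply: Rmult_le_compat_l; first by apply: Rmult_le_pos; lra.
      have ln0 := ln_INR_ge0 n n0.
      apply: Rle_trans (_ : 5 / 4 * (1 + z) <= _); last lra.
      apply: Rmult_le_compat; lra.
    + pose kj (j : 'I_n) := INR (w j) * (1 + ln (INR (Y j.+2)) - ln (INR (w j))).
      have C1 v : (forall j, (v j <= w j)%N) -> \prod_j INR 'C(#|P j|, v j) <= exp (\sum_j kj j).
      { move=> hv; rewrite exp_sum; apply: prodR_le => j _; split; first exact: pos_INR.
        apply: bin_le_exp => //; first exact: prime_block_card.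
        have := wY j; have := Ymono 0%N j.+2 isT; rewrite {1}/Y expn0; lia. }
      have cpos v : 0 <= \prod_j INR 'C(#|P j|, v j) by apply: prodR_ge0 => j _; exact: pos_INR.
      apply: Rle_trans (_ : exp (\sum_j kj j) <= _).
      { rewrite -(sqrt_pow2 (exp (\sum_j kj j))); last exact/Rlt_le/exp_pos.
        apply: sqrt_le_1_alt; rewrite /= Rmult_1_r; apply: Rmult_le_compat => //; apply: C1 => j.
        - exact: leqnn.
        - exact: leq_subr. }
      apply: exp_le.
      (* The primes of block j have logarithm about x + (j+2) z^2, and ln w_j is x up to lower order
         terms, so each chosen prime costs about (j+1) z^2. Multiplied by w_j, about D/(j+1)^2, this
         is a harmonic series of sum about z, for a total near D z^3, a constant times L. *)
      apply: Rle_trans (_ : \sum_(j < n) ((1 + dl) * D * (z ^ 2 + 3) * / INR j.+1 +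
        (1 + dl) * D * (2 * (z ^ 2 + 1)) * / INR j.+1 ^ 2) <= _).
      { apply: sumR_le => j _; rewrite /kj.
        have h1 := i1 j. have h2 := wlow j.
        have w0 : 0 < INR (w j) by apply: INR_gt0; have := wY j; lia.
        have lw : x - ln ((1 - dl) * z ^ 3 / c1 ^ 2) - 3 - 2 * i_ j <= ln (INR (w j)).
        { have c2 : 0 < c1 ^ 2 by apply: pow_lt.
          have q0 : 0 < (1 - dl) * z ^ 3 / c1 ^ 2 by apply: Rdiv_lt_0_compat => //; apply: Rmult_lt_0_compat; lra.
          have DD : D = L / ((1 - dl) * z ^ 3 / c1 ^ 2).
          { have -> : L = D * ((1 - dl) * z ^ 3) / c1 ^ 2 by rewrite DE; field; lra.
            field; repeat split; lra. }
          apply: Rle_trans (_ : ln (D / (4 * i_ j ^ 2)) <= _); last first.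
          { apply: ln_le => //; apply: Rdiv_lt_0_compat => //.
            have : 1 <= i_ j ^ 2 by exact: pow_R1_Rle. lra. }
          have i2 : 0 < i_ j ^ 2 by apply: pow_lt; lra.
          rewrite (ln_div D) //; last lra.
          rewrite {1}DD (ln_div L) // lnL (ln_mult 4) //; last lra.
          have -> : ln (i_ j ^ 2) = 2 * ln (i_ j).
          { rewrite /= Rmult_1_r ln_mult; try lra. }
          have := ln_le_sub1 (i_ j) ltac:(lra). have := ln_le_sub1 4 ltac:(lra). lra. }
        have ly : ln (INR (Y j.+2)) <= x + 1 + (i_ j + 1) * H.
        { rewrite lnYi (S_INR j.+1) -/(i_ j); lra. }
        have tot : 1 + ln (INR (Y j.+2)) - ln (INR (w j)) <= i_ j * (z ^ 2 + 3) + 2 * (z ^ 2 + 1).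
        { have : (i_ j + 1) * H <= (i_ j + 1) * (z ^ 2 + 1) by apply: Rmult_le_compat_l; lra.
          lra. }
        have hu := wup j.
        have D2 : 0 <= D / i_ j ^ 2 by apply/Rlt_le/Rdiv_lt_0_compat => //; apply: pow_lt; lra.
        apply: Rle_trans (_ : INR (w j) * (i_ j * (z ^ 2 + 3) + 2 * (z ^ 2 + 1)) <= _).
        { apply: Rmult_le_compat_l; lra. }
        apply: Rle_trans (_ : (1 + dl) * (D / i_ j ^ 2) * (i_ j * (z ^ 2 + 3) + 2 * (z ^ 2 + 1)) <= _).
        { apply: Rmult_le_compat_r => //.
          have : 0 <= i_ j * (z ^ 2 + 3) by apply: Rmult_le_pos; lra.
          lra. }
        rewrite -/(i_ j); apply: Req_le; field; lra. }
      rewrite big_split -!sumR_mull.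
      have S1 := sum_inv_le n n0. have S2 := sum_inv_sq_le n.
      have dD : 0 < (1 + dl) * D by apply: Rmult_lt_0_compat; lra.
      apply: Rle_trans (_ : (1 + dl) * D * (z ^ 2 + 3) * (1 + z) +
        (1 + dl) * D * (2 * (z ^ 2 + 1)) * 2 <= _).
      { apply: Rplus_le_compat.
        - apply: Rmult_le_compat_l; [apply: Rmult_le_pos; lra | apply: Rle_trans S1 _; lra].
        - by apply: Rmult_le_compat_l => //; apply: Rmult_le_pos; lra. }
      apply: Rle_trans (_ : (1 + dl) * D * ((1 + dl) * z ^ 3) <= _).
      { have -> : (1 + dl) * D * (z ^ 2 + 3) * (1 + z) + (1 + dl) * D * (2 * (z ^ 2 + 1)) * 2 =
          (1 + dl) * D * ((z ^ 2 + 3) * (1 + z) + 4 * (z ^ 2 + 1)) by ring.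
        apply: Rmult_le_compat_l; lra. }
      apply: (Rmult_le_reg_r (1 - dl)); first lra.
      have -> : (1 + dl) * D * ((1 + dl) * z ^ 3) * (1 - dl) =
        (1 + dl) ^ 2 * (D * ((1 - dl) * z ^ 3)) by ring.
      rewrite DE; have -> : kappa * L * (1 - dl) = kappa * (1 - dl) * L by ring.
      rewrite -Rmult_assoc; apply: Rmult_le_compat_r; lra.
  (* Stirling's bound and the rounding of r_j lose at most 2 + ln rho per block; over n <= x blocks
     this is at most dl rho z. *)
  - apply: Rle_trans (_ : exp (\sum_(j < n) (rho * / INR j.+1 + - (2 + ln rho))) <= _).
    + apply: exp_le; rewrite big_split /= -sumR_mull sumR_const_nat.
      have S1 := sum_inv_ge n.
      have S3 : ln (INR n) <= ln (INR n.+1) by apply: ln_le => //; apply: le_INR; lia.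
      have lr : 0 <= 2 + ln rho.
      { have : ln 1 <= ln rho by apply: ln_le; lra. rewrite ln_1; lra. }
      have h : INR n * (2 + ln rho) <= x * (2 + ln rho) by apply: Rmult_le_compat_r.
      apply: Rle_trans (Rplus_le_compat_r _ _ _ (Rmult_le_compat_l rho _ _ (Rlt_le _ _ r0)
        (Rle_trans _ _ _ lnn (Rle_trans _ _ _ S3 S1)))); lra.
    + rewrite exp_sum; apply: prodR_le => j _; split; first exact/Rlt_le/exp_pos.
      have [h5 h6] := rhalf j. have [h3 h4] := r2 j.
      have rj : (0 < r j)%N by apply/ltP; apply: INR_lt; rewrite INR_0; lra.
      apply: Rle_trans (pow_self_div_fact_ge (r j) rj); apply: exp_le.
      have : ln (INR (r j)) <= ln rho.
      { apply: ln_le; first lra. apply: Rle_trans h4 _; have h7 := i1 j; apply: div_le_of_le_mul; first lra.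
        clear -r0 h7; nra. }
      rewrite /i_ /Rdiv in h3; lra.
Qed.

(** * Choice of parameters *)

(** exp(al x) is the (m+1)-st power of exp(bx) >= bx, and the one extra power of x outgrows K. *)
Lemma pow_le_exp (K al : R) (m : nat) : 0 < al ->
  exists x0, forall x, x0 <= x -> K * x ^ m <= exp (al * x).
Proof.
  move=> a0; pose b := al / INR m.+1.
  have m0 := INR_gt0 m.+1 isT.
  have b0 : 0 < b by exact: Rdiv_lt_0_compat.
  have bm : 0 < b ^ m.+1 by exact: pow_lt.
  exists (Rmax 0 (K / b ^ m.+1)) => x hx.
  have h1 := Rle_trans _ _ _ (Rmax_l _ _) hx. have h2 := Rle_trans _ _ _ (Rmax_r _ _) hx.
  have -> : exp (al * x) = exp (b * x) ^ m.+1.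
  { rewrite exp_pow_nat; congr exp; rewrite /b; field; lra. }
  apply: Rle_trans (_ : (b * x) ^ m.+1 <= _); last first.
  { apply: pow_incr; split; first by apply: Rmult_le_pos; lra.
    have := exp_ineq1_le (b * x); lra. }
  rewrite Rpow_mult_distr -(tech_pow_Rmult x m) -Rmult_assoc.
  apply: Rmult_le_compat_r; first exact: pow_le.
  have -> : K = b ^ m.+1 * (K / b ^ m.+1) by field; lra.
  apply: Rmult_le_compat_l; lra.
Qed.

(** kappa is put strictly between c^2 and 1 - beta, and c1 strictly between c and sqrt kappa; dl is
    a small part of the resulting margins. *)
Lemma choose_parameters (beta c : R) : 0 <= beta < 1 -> 0 < c -> c < sqrt (1 - beta) ->
  exists kappa c1 dl, [/\ 0 < kappa /\ beta + kappa < 1, 0 < c1, 0 < dl <= 1 / 4,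
    (1 + dl) ^ 2 * c1 ^ 2 <= kappa * (1 - dl) & c <= (1 - 4 * dl) * c1].
Proof.
  move=> hb c0 hc.
  have s0 := sqrt_pos (1 - beta). have ss := sqrt_sqrt (1 - beta) ltac:(lra).
  have c2 : c * c < 1 - beta by nra.
  pose kappa := (c * c + (1 - beta)) / 2.
  have k0 : 0 < kappa by rewrite /kappa; nra.
  have sk := sqrt_lt_R0 _ k0. have sks := sqrt_sqrt kappa ltac:(lra).
  have ck : c < sqrt kappa.
  { apply: Rnot_le_lt => h; have : c * c < kappa by rewrite /kappa; lra. nra. }
  pose c1 := (c + sqrt kappa) / 2.
  have c10 : 0 < c1 by rewrite /c1; lra.
  have c12 : c1 ^ 2 < kappa by rewrite /c1; nra.
  (* Solves (1 + 3 dl) c1^2 = kappa (1 - dl), where 1 + 3 dl majorizes (1 + dl)^2. *)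
  pose d1 := (kappa - c1 ^ 2) / (3 * c1 ^ 2 + kappa).
  pose d2 := (c1 - c) / (4 * c1).
  have d10 : 0 < d1 by apply: Rdiv_lt_0_compat; nra.
  have d20 : 0 < d2 by apply: Rdiv_lt_0_compat; rewrite /c1; lra.
  pose dl := Rmin (1 / 4) (Rmin d1 d2).
  have h1 : dl <= 1 / 4 by exact: Rmin_l.
  have h2 : dl <= d1 by apply: Rle_trans (Rmin_r _ _) (Rmin_l _ _).
  have h3 : dl <= d2 by apply: Rle_trans (Rmin_r _ _) (Rmin_r _ _).
  have h0 : 0 < dl by apply: Rmin_pos; [lra | exact: Rmin_pos].
  exists kappa, c1, dl; split=> //.
  - by split=> //; rewrite /kappa; lra.
  - have e1 : dl * (3 * c1 ^ 2 + kappa) <= kappa - c1 ^ 2.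
    { have -> : kappa - c1 ^ 2 = d1 * (3 * c1 ^ 2 + kappa) by rewrite /d1; field; nra.
      apply: Rmult_le_compat_r; nra. }
    have c13 : 0 <= c1 ^ 2 by exact: pow2_ge_0.
    have e2 : (1 + dl) ^ 2 <= 1 + 3 * dl by clear -h0 h1; nra.
    have := Rmult_le_compat_r _ _ _ c13 e2; lra.
  - have e1 : dl * (4 * c1) <= c1 - c.
    { have -> : c1 - c = d2 * (4 * c1) by rewrite /d2; field; lra.
      apply: Rmult_le_compat_r; lra. }
    lra.
Qed.

(** All conditions compare three widely separated scales: z, then x = e^z, then rho, which lies
    between c1 e^(x/2)/x and c1 e^(x/2). *)
Lemma asymptotics (dl c1 C1 l0 : R) : 0 < dl <= 1 / 4 -> 0 < c1 -> 0 < C1 ->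
  exists z0, forall z x L rho, z0 <= z -> x = exp z -> L = exp x ->
    rho = c1 * sqrt (L / (x * z)) ->
  [/\ [/\ 0 < rho, rho ^ 2 * (x * z) = c1 ^ 2 * L, 1 <= z & z + 14 <= dl ^ 2 * z ^ 2],
      [/\ 2 * z ^ 3 <= exp (dl * z), z ^ 2 + 2 <= dl * x / 2, 4 <= dl * z & 2 * x <= rho],
      [/\ 2 * z ^ 2 <= dl * rho, x * (2 + ln rho) <= dl * rho * z,
          (1 + dl) * c1 ^ 2 <= (1 - dl) * z ^ 3 & ln ((1 - dl) * z ^ 3 / c1 ^ 2) + 4 <= z ^ 2],
      [/\ (z ^ 2 + 3) * (1 + z) + 4 * (z ^ 2 + 1) <= (1 + dl) * z ^ 3, l0 <= L,
          3 * rho * z * x <= L & 9 * C1 * c1 ^ 2 * x <= dl * rho] & 5000 <= dl * rho].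
Proof.
  move=> hdl c0 C0.
  have [za ha] := pow_le_exp 2 dl 3 ltac:(lra).
  have [zb hb] := pow_le_exp (6 / dl) 1 2 ltac:(lra).
  (* The single bound K x^2 <= rho yields all lower bounds required of rho; the numerator dominates
     the coefficients needed in them. *)
  pose K := 2 + (5005 + Rabs (ln c1) + 9 * C1 * c1 ^ 2) / dl.
  have [zc hc] := pow_le_exp (K / c1) (1 / 2) 3 ltac:(lra).
  have [zd hd] := pow_le_exp (3 * c1) (1 / 2) 2 ltac:(lra).
  pose bnd := [:: za; zb; zc; zd; 1; 15 / dl ^ 2; 15 / dl; 2 * c1 ^ 2; 7 + 2 * Rabs (ln c1); l0].
  exists (foldr Rmax 1 bnd) => z x L rho hz ex eL er.
  have {}hz y : List.In y bnd -> y <= z.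
  { move=> yb; apply: Rle_trans hz; elim: bnd yb => [|y' s IH] //=.
    case=> [-> | /IH h]; [exact: Rmax_l | exact: Rle_trans h (Rmax_r _ _)]. }
  have b1 := hz za ltac:(rewrite /bnd /=; tauto).
  have b2 := hz zb ltac:(rewrite /bnd /=; tauto).
  have b3 := hz zc ltac:(rewrite /bnd /=; tauto).
  have b4 := hz zd ltac:(rewrite /bnd /=; tauto).
  have z1 := hz 1 ltac:(rewrite /bnd /=; tauto).
  have b5 := hz (15 / dl ^ 2) ltac:(rewrite /bnd /=; tauto).
  have b6 := hz (15 / dl) ltac:(rewrite /bnd /=; tauto).
  have b7 := hz (2 * c1 ^ 2) ltac:(rewrite /bnd /=; tauto).
  have b8 := hz (7 + 2 * Rabs (ln c1)) ltac:(rewrite /bnd /=; tauto).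
  have b9 := hz l0 ltac:(rewrite /bnd /=; tauto).
  clear hz bnd.
  have x0 : 0 < x by rewrite ex; exact: exp_pos.
  have L0 : 0 < L by rewrite eL; exact: exp_pos.
  have xz : z + 1 <= x by rewrite ex; have := exp_ineq1_le z; lra.
  have Lx : x + 1 <= L by rewrite eL; have := exp_ineq1_le x; lra.
  have c2 : 0 < c1 ^ 2 by exact: pow_lt.
  have p1 := Rabs_pos (ln c1).
  have d2 : 0 < dl ^ 2 by apply: pow_lt; lra.
  have f5 : 15 <= dl ^ 2 * z.
  { have -> : 15 = dl ^ 2 * (15 / dl ^ 2) by field; lra. apply: Rmult_le_compat_l; lra. }
  have f6 : 15 <= dl * z.
  { have -> : 15 = dl * (15 / dl) by field; lra. apply: Rmult_le_compat_l; lra. }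
  have xzp : 0 < x * z by apply: Rmult_lt_0_compat; lra.
  have q0 : 0 < L / (x * z) by exact: Rdiv_lt_0_compat.
  have sq0 := sqrt_lt_R0 _ q0. have sqs := sqrt_sqrt _ (Rlt_le _ _ q0).
  have r0 : 0 < rho by rewrite er; exact: Rmult_lt_0_compat.
  have r2 : rho ^ 2 * (x * z) = c1 ^ 2 * L.
  { have -> : rho ^ 2 = c1 ^ 2 * (sqrt (L / (x * z)) * sqrt (L / (x * z))) by rewrite er; ring.
    rewrite sqs; field; lra. }
  have sL : sqrt L = exp (1 / 2 * x).
  { rewrite -exp_half_ln // eL ln_exp; congr exp; field. }
  have sLs : sqrt L * sqrt L = L by apply: sqrt_sqrt; lra.
  have sL0 := sqrt_lt_R0 _ L0.
  have rup : rho <= c1 * sqrt L.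
  { rewrite er; apply: Rmult_le_compat_l; first lra. apply: sqrt_le_1_alt.
    apply: div_le_of_le_mul => //.
    have h : 1 <= x * z by clear -xz z1; nra.
    have := Rmult_le_compat_l L _ _ (Rlt_le _ _ L0) h; lra. }
  have rlow : c1 * sqrt L / x <= rho.
  { rewrite er; have -> : c1 * sqrt L / x = c1 * (sqrt L / x) by field; lra.
    apply: Rmult_le_compat_l; first lra.
    have -> : sqrt L / x = sqrt (L / (x * x)).
    { rewrite sqrt_div_alt; last by apply: Rmult_lt_0_compat. by rewrite sqrt_square //; lra. }
    apply: sqrt_le_1_alt; apply: Rmult_le_compat_l; first lra.
    apply: Rinv_le_contravar => //; clear -x0 xz z1; nra. }
  have Kx : K * x ^ 2 <= rho.
  { apply: Rle_trans rlow; apply: le_div_of_mul => //.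
    have := hc x ltac:(lra); rewrite -sL => h.
    have -> : K * x ^ 2 * x = c1 * (K / c1 * x ^ 3) by field; lra.
    apply: Rmult_le_compat_l; lra. }
  have x2 : 1 <= x by lra.
  have xx : x <= x ^ 2 by clear -x2; nra.
  have big A : 0 <= A <= 5005 + Rabs (ln c1) + 9 * C1 * c1 ^ 2 -> A * x ^ 2 <= dl * rho.
  { move=> hA; apply: Rle_trans (_ : dl * (K * x ^ 2) <= _); last by apply: Rmult_le_compat_l; lra.
    rewrite -Rmult_assoc; apply: Rmult_le_compat_r; first by clear -x0; nra.
    rewrite /K Rmult_plus_distr_l.
    have -> : dl * ((5005 + Rabs (ln c1) + 9 * C1 * c1 ^ 2) / dl) =
      5005 + Rabs (ln c1) + 9 * C1 * c1 ^ 2 by field; lra. lra. }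
  have CC : 0 < 9 * C1 * c1 ^ 2 by apply: Rmult_lt_0_compat; lra.
  have lnr : ln rho <= ln c1 + x / 2.
  { apply: Rle_trans (ln_le _ _ r0 rup) _; rewrite ln_mult // sL ln_exp; lra. }
  split; [split=> // | split=> // | split=> // | split=> // |].
  - have := Rmult_le_compat_r z _ _ ltac:(lra) f5. lra.
  - by apply: ha.
  - have := hb z b2; rewrite Rmult_1_l -ex => h.
    have h2 : 6 * z ^ 2 <= dl * x.
    { have -> : 6 * z ^ 2 = dl * (6 / dl * z ^ 2) by field; lra. apply: Rmult_le_compat_l; lra. }
    have : 1 <= z ^ 2 by exact: pow_R1_Rle. lra.
  - lra.
  - apply: Rle_trans Kx.
    have K2 : 2 <= K.
    { rewrite /K; have : 0 <= (5005 + Rabs (ln c1) + 9 * C1 * c1 ^ 2) / dl; last by lra.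
      apply/Rlt_le/Rdiv_lt_0_compat; lra. }
    apply: Rle_trans (_ : 2 * x ^ 2 <= _); first lra.
    apply: Rmult_le_compat_r; lra.
  - apply: Rle_trans (big 2 _); last lra.
    apply: Rmult_le_compat_l; first lra. apply: pow_incr; lra.
  - apply: Rle_trans (_ : dl * rho <= _); last first.
    { rewrite -{1}(Rmult_1_r (dl * rho)); apply: Rmult_le_compat_l => //.
      apply: Rmult_le_pos; lra. }
    apply: Rle_trans (big (3 + Rabs (ln c1)) _); last lra.
    have h : 2 + ln rho <= (3 + Rabs (ln c1)) * x.
    { have h1 := Rle_abs (ln c1).
      have h2 : Rabs (ln c1) <= Rabs (ln c1) * x.
      { rewrite -{1}(Rmult_1_r (Rabs _)); apply: Rmult_le_compat_l; lra. }
      lra. }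
    have := Rmult_le_compat_l x _ _ (Rlt_le _ _ x0) h; lra.
  - have h : z <= z ^ 3 by clear -z1; have := pow_R1_Rle z 2 z1; nra.
    have : (1 + dl) * c1 ^ 2 <= 5 / 4 * c1 ^ 2 by apply: Rmult_le_compat_r; lra.
    have : 3 / 4 * z ^ 3 <= (1 - dl) * z ^ 3 by apply: Rmult_le_compat_r; lra.
    lra.
  - have z3 : 0 < z ^ 3 by apply: pow_lt; lra.
    rewrite ln_div //; last by apply: Rmult_lt_0_compat; lra.
    rewrite ln_mult //; last lra.
    have l1 := ln_le_sub1 (1 - dl) ltac:(lra).
    have l2 := ln_le_sub1 z ltac:(lra).
    have e3 : ln (z ^ 3) = 3 * ln z by rewrite /= !ln_mult ?ln_1; nra.
    have e2 : ln (c1 ^ 2) = 2 * ln c1 by rewrite /= !ln_mult ?ln_1; nra.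
    have h1 := Rle_abs (- ln c1). rewrite Rabs_Ropp in h1.
    have h2 := Rmult_le_compat_r z _ _ ltac:(lra) b8.
    have h3 : Rabs (ln c1) <= Rabs (ln c1) * z.
    { rewrite -{1}(Rmult_1_r (Rabs _)); apply: Rmult_le_compat_l; lra. }
    rewrite e3 e2; lra.
  - have zz : 0 <= z ^ 2 by exact: pow2_ge_0.
    have h := Rmult_le_compat_r (z ^ 2) _ _ zz f6.
    have : 1 <= z ^ 2 by exact: pow_R1_Rle.
    have : z <= z ^ 2 by clear -z1; nra.
    lra.
  - lra.
  - have h := hd x ltac:(lra); rewrite -sL in h.
    apply: Rle_trans (_ : (3 * c1 * x ^ 2) * sqrt L <= _); last first.
    { rewrite -{2}sLs; apply: Rmult_le_compat_r; lra. }
    have -> : 3 * rho * z * x = rho * (3 * (z * x)) by ring.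
    have -> : 3 * c1 * x ^ 2 * sqrt L = (c1 * sqrt L) * (3 * x ^ 2) by ring.
    apply: Rmult_le_compat; try lra.
    apply: Rmult_le_compat_l; first lra. rewrite /= Rmult_1_r; apply: Rmult_le_compat_r; lra.
  - apply: Rle_trans (big (9 * C1 * c1 ^ 2) _); last by lra.
    apply: Rmult_le_compat_l; lra.
  - apply: Rle_trans (big 5000 _); lra.
Qed.

(** The margin 4 dl between c and c1 is spent as follows: 2 dl in the gain of the blocks, dl on the
    averaging kernel, and dl on the constant 5000. *)
Theorem theorem1 (beta c : R) :
  0 <= beta < 1 -> 0 < c -> c < sqrt (1 - beta) ->
  exists T0 : R, forall T : R, T0 <= T ->
    exists t : R, Rpower T beta <= t <= T /\
      exp (c * sqrt (ln T * ln (ln (ln T)) / ln (ln T))) <= Cmod (zeta (1/2, t)).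
Proof.
  move=> hb c0 hc.
  have [kappa [c1 [dl [[k0 bk] c10 hdl hk hcd]]]] := choose_parameters beta c hb c0 hc.
  have [C1 [l0 [C0 LV]]] := large_value_of_blocks beta kappa (proj1 hb) k0 bk.
  have [z0 AS] := asymptotics dl c1 C1 l0 hdl c10 C0.
  exists (exp (exp (exp z0))) => T hT.
  have T0 : 0 < T by apply: Rlt_le_trans hT; exact: exp_pos.
  set L := ln T. set x := ln L. set z := ln x.
  have hL : exp (exp z0) <= L.
  { rewrite -(ln_exp (exp (exp z0))); apply: ln_le => //; exact: exp_pos. }
  have L0 : 0 < L by apply: Rlt_le_trans hL; exact: exp_pos.
  have hx : exp z0 <= x.
  { rewrite -(ln_exp (exp z0)); apply: ln_le => //; exact: exp_pos. }
  have x0 : 0 < x by apply: Rlt_le_trans hx; exact: exp_pos.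
  have hz : z0 <= z.
  { rewrite -(ln_exp z0); apply: ln_le => //; exact: exp_pos. }
  have eT : exp L = T by exact: exp_ln.
  have eL : L = exp x by rewrite exp_ln.
  have ex : x = exp z by rewrite exp_ln.
  set rho := c1 * sqrt (L / (x * z)).
  have [[A1 A2 A3 A4] [A5 A6 A7 A8] [A9 A10 A11 A12] [A13 A14 A15 A16] A17] :=
    AS z x L rho hz ex eL erefl.
  have [B [n [P [w [r [eta [s [[H1 H2] [H3 H4] [H5 [H6 H7]] [H8 H9] H10]]]]]]]] :=
    blocks_exist dl c1 kappa z x L rho hdl c10 ex eL A1 A2 A3 A4 A5 A6 A7 A8 A9 A10 A11 A12 A13 hk.
  have Lam0 : 0 <= 3 * rho * z * x.
  { by apply: Rmult_le_pos; [apply: Rmult_le_pos |]; lra. }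
  have [t [ht hG]] := LV L A14 B n P w r eta s (3 * rho * z * x) H1 H2 H3 H4 H5 H6 H7 H8
    (conj Lam0 A15) H9.
  exists t; split; first by rewrite eT in ht; rewrite /Rpower -/L.
  set G := \big[_/_]_(_ < _) _ in H10 hG.
  have rz : c1 * sqrt (L * z / x) = rho * z.
  { rewrite /rho Rmult_assoc; congr (_ * _).
    have -> : L * z / x = L / (x * z) * (z * z) by field; lra.
    have q0 : 0 <= L / (x * z).
    { apply/Rlt_le/Rdiv_lt_0_compat => //; apply: Rmult_lt_0_compat; lra. }
    have zz : 0 <= z * z by apply: Rmult_le_pos; lra.
    rewrite sqrt_mult // sqrt_square //; lra. }
  have rz0 : 0 <= rho * z by apply: Rmult_le_pos; lra.
  have e1 : c * sqrt (L * z / x) <= (1 - 4 * dl) * (rho * z).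
  { rewrite -rz -Rmult_assoc; apply: Rmult_le_compat_r => //; exact: sqrt_pos. }
  (* By rho^2 x z = c1^2 L the kernel loss is only 9 C1 c1^2 x z, and x is negligible against
     rho. *)
  have e2 : C1 * (3 * rho * z * x) ^ 2 / L <= dl * (rho * z).
  { have -> : C1 * (3 * rho * z * x) ^ 2 / L = 9 * C1 * c1 ^ 2 * x * z.
    { have -> : C1 * (3 * rho * z * x) ^ 2 / L = 9 * C1 * x * z * (rho ^ 2 * (x * z)) / L
        by field; lra.
      rewrite A2; field; lra. }
    rewrite -Rmult_assoc; apply: Rmult_le_compat_r; lra. }
  have e3 : 5000 <= exp (dl * (rho * z)).
  { have := exp_ineq1_le (dl * (rho * z)).
    have : dl * rho * 1 <= dl * rho * z by apply: Rmult_le_compat_l; lra. lra. }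
  apply: Rle_trans (exp_le _ _ e1) _.
  set Yv := exp ((1 - 4 * dl) * (rho * z)).
  have Y1 : 1 <= Yv.
  { have := exp_ineq1_le ((1 - 4 * dl) * (rho * z)).
    have : 0 <= (1 - 4 * dl) * (rho * z) by apply: Rmult_le_pos; lra.
    rewrite /Yv; lra. }
  (* The ratio 2 of the constants absorbs the additive 1: since Yv >= 1, 2 Yv - 1 >= Yv. *)
  have e4 : 5000 * Yv <= 2500 * (1 + Cmod (zeta (1/2, t))).
  { apply: Rle_trans hG.
    apply: Rle_trans (_ : exp (dl * (rho * z)) * Yv <= _); first by apply: Rmult_le_compat_r; lra.
    apply: Rle_trans (_ : exp (- (C1 * (3 * rho * z * x) ^ 2 / L)) *
      exp ((1 - 2 * dl) * rho * z) <= _).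
    - rewrite /Yv -!exp_plus; apply: exp_le; lra.
    - apply: Rmult_le_compat_l => //; exact/Rlt_le/exp_pos. }
  lra.
Qed.
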